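(* Let $d\ge 1$ be an integer, let $s\in\mathbf R_\flat$ satisfy $s\le\frac12$, let $t_0\in\mathbf R^d$, let $u=(u_1,\dots,u_d)\in(0,1]^d$ if $s=\frac12$ and $u\in(0,1)^d$ if $s<\frac12$, and let $f\in\mathcal H_0'(\mathbf R^d)$. Put $$\Lambda_{t_0,u}=\{\,t_0+(k_1u_1,\dots,k_du_d)\,;\ k_j\in\mathbf Z,\ 0\le k_ju_j<2,\ j=1,\dots,d\,\}.$$ Then the following conditions are equivalent: (1) $f\in\mathcal H_{0,s}(\mathbf R^d)$; (2) for every $r>0$, $$\sup_{t\in\Lambda_{t_0,u}}\big\|(\mathscr F_tf)\cdot e^{\frac12|\cdot|^2}\,\omega_{d,r,s}\big\|_{L^\infty(\mathbf R^d)}<\infty;$$ (3) for every $r>0$, $$\sup_{t\in\mathbf R^d}\big\|(\mathscr F_tf)\cdot e^{\frac12|\cdot|^2}\,\omega_{d,r,s}\big\|_{L^\infty(\mathbf R^d)}<\infty.$$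
   Context: Index sets. $\mathbf R_\flat=\mathbf R_+\cup\{\flat_\sigma:\sigma>0\}$, where $\mathbf R_+=(0,\infty)$ and the $\flat_\sigma$ are formal symbols. The order extends the usual one on real numbers by $x_1<\flat_{\sigma_1}<\flat_{\sigma_2}<x_2$ whenever $0<x_1<\frac12$, $x_2\ge\frac12$ and $0<\sigma_1<\sigma_2$. In particular $\flat_\sigma<\frac12$ for every $\sigma>0$. Hermite functions: for $\alpha\in\mathbf N^d$ (with $0\in\mathbf N$), $h_\alpha(x)=\pi^{-d/4}(-1)^{|\alpha|}(2^{|\alpha|}\alpha!)^{-1/2}e^{|x|^2/2}\,\partial^\alpha e^{-|x|^2}$, $x\in\mathbf R^d$. Spaces. $\mathcal H_0'(\mathbf R^d)$ is the space of all formal Hermite series $f=\sum_{\alpha\in\mathbf N^d}c(f,\alpha)h_\alpha$ with arbitrary complex coefficients $c(f,\alpha)$. For $s\in\mathbf R_\flat$ and $r>0$ let $\vartheta_{r,s}(\alpha)=e^{r|\alpha|^{1/(2s)}}$ if $s\in\mathbf R_+$, and $\vartheta_{r,s}(\alpha)=r^{|\alpha|}(\alpha!)^{1/(2\sigma)}$ if $s=\flat_\sigma$. The Pilipović space $\mathcal H_{0,s}(\mathbf R^d)$ (of Beurling type) consists of all $f\in\mathcal H_0'(\mathbf R^d)$ such that $\sup_\alpha|c(f,\alpha)|\vartheta_{r,s}(\alpha)<\infty$ for every $r>0$. Functions as elements of $\mathcal H_0'$: a measurable function $g$ on $\mathbf R^d$ such that $g h_\alpha$ is integrable for every $\alpha$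 is identified with $\sum_\alpha\big(\int g\,h_\alpha\,dx\big)h_\alpha$. For $g\in\mathcal H_0'(\mathbf R^d)$, finiteness of a weighted $L^\infty$ norm of $g$ means that $g$ is given by such a measurable function whose weighted essential supremum is finite. (Partial) fractional Fourier transform of order $t\in\mathbf R^d$: $\mathscr F_t:\mathcal H_0'(\mathbf R^d)\to\mathcal H_0'(\mathbf R^d)$ is given by $\mathscr F_t\big(\sum_\alpha c(\alpha)h_\alpha\big)=\sum_\alpha e^{-i\frac\pi2(t_1\alpha_1+\cdots+t_d\alpha_d)}c(\alpha)h_\alpha$. (For $t=(1,\dots,1)$ it is the Fourier transform $\widehat f(\xi)=(2\pi)^{-d/2}\int f(x)e^{-i\langle x,\xi\rangle}dx$.) Weights: with $\langle z\rangle=(1+|z|^2)^{1/2}$, for $z\in\mathbf C^d$ (in particular for $z\in\mathbf R^d$), $$\omega_{d,r,s}(z)=\begin{cases}e^{-r(\log\langle z\rangle)^{1/(1-2s)}},& s\in\mathbf R,\ 0\le s<\frac12,\\ e^{-r|z|^{2\sigma/(\sigma+1)}},& s=\flat_\sigma,\\ e^{-r|z|^2},& s=\frac12.\end{cases}$$ *)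

(* Defs.v *)
From HB Require Import structures.
From mathcomp Require Import all_boot all_order all_algebra.
From mathcomp Require Import complex.
From mathcomp Require Import all_classical all_reals all_analysis.

Set Implicit Arguments.
Unset Strict Implicit.
Unset Printing Implicit Defensive.
Import Order.TTheory GRing.Theory Num.Theory.
Import numFieldNormedType.Exports.
Local Open Scope classical_set_scope.
Local Open Scope ring_scope.

(** ** Lebesgue measure on [R^n = 'rV[R]_n] *)

Definition measure_rV_display : measure_display.
Proof. exact: default_measure_display. Qed.

Section measurable_rV.
Context {R : realType}.
Variable n : nat.

Let coors : 'I_n -> 'rV[R]_n -> R := fun i x => x ord0 i.

Let rV_set0 : g_sigma_preimage coors set0.
Proof. exact: sigma_algebra0. Qed.

Let rV_setC A : g_sigma_preimage coors A -> g_sigma_preimage coors (~` A).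
Proof. exact: sigma_algebraC. Qed.

Let rV_bigcup (F : _^nat) : (forall i, g_sigma_preimage coors (F i)) ->
  g_sigma_preimage coors (\bigcup_i (F i)).
Proof. exact: sigma_algebra_bigcup. Qed.

(* The product of the Borel sigma-algebras, i.e. the Borel sigma-algebra of
   R^n, built from the coordinates as the library does for [n.-tuple R]. *)
HB.instance Definition _ := @isMeasurable.Build
  measure_rV_display 'rV[R]_n
  (g_sigma_preimage coors) rV_set0 rV_setC rV_bigcup.

End measurable_rV.

Section measurable_rV_theory.
Context {R : realType}.

Lemma measurable_coord n (i : 'I_n) :
  measurable_fun [set: 'rV[R]_n] (fun x : 'rV[R]_n => x ord0 i).
Proof.
move=> _ Y mY; rewrite setTI; apply: sub_sigma_algebra => /=.
rewrite -bigcup_seq/=; exists i => /=; first by rewrite mem_index_enum.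
by exists Y => //; rewrite setTI.
Qed.

Lemma measurable_fun_rVP d (T : measurableType d) n (f : T -> 'rV[R]_n) :
  measurable_fun [set: T] f <->
  forall i, measurable_fun [set: T] (fun x => f x ord0 i).
Proof.
split=> [mf i|mf].
  exact: (measurableT_comp (measurable_coord i) mf).
move=> _ A mA; rewrite setTI.
suff: g_sigma_preimage (fun i (x : 'rV[R]_n) => x ord0 i) `<=`
      [set B | measurable (f @^-1` B)] by exact.
apply: smallest_sub.
  split=> [|B /= mB|F /= mF].
  - by rewrite /= preimage_set0.
  - by rewrite setTD preimage_setC; exact: measurableC.
  - by rewrite preimage_bigcup; exact: bigcup_measurable.
rewrite -bigcup_seq => B [i _] [C mC <-] /=.
by rewrite setTI -[X in measurable X]setTI; exact: mf.
Qed.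

Definition rV_cons n (p : measurableTypeR R * 'rV[R]_n) : 'rV[R]_n.+1 :=
  row_mx (p.1%:M : 'rV[R]_1) p.2.

Definition rV_uncons n (x : 'rV[R]_n.+1) : measurableTypeR R * 'rV[R]_n :=
  (x ord0 ord0, \row_j x ord0 (lift ord0 j)).

Lemma rV_cons0 n (p : measurableTypeR R * 'rV[R]_n) :
  rV_cons p ord0 ord0 = p.1.
Proof.
have -> : ord0 = lshift n (ord0 : 'I_1) by exact: val_inj.
by rewrite (row_mxEl (p.1%:M : 'rV[R]_1)) mxE eqxx.
Qed.

Lemma rV_consS n (p : measurableTypeR R * 'rV[R]_n) j :
  rV_cons p ord0 (lift ord0 j) = p.2 ord0 j.
Proof.
have -> : lift ord0 j = rshift 1 j by exact: val_inj.
exact: (row_mxEr (p.1%:M : 'rV[R]_1)).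
Qed.

Lemma rV_consK n : cancel (@rV_cons n) (@rV_uncons n).
Proof.
move=> p; rewrite /rV_uncons rV_cons0 [RHS]surjective_pairing; congr pair.
by apply/rowP => j; rewrite mxE rV_consS.
Qed.

Lemma measurable_rV_cons n :
  measurable_fun [set: measurableTypeR R * 'rV[R]_n] (@rV_cons n).
Proof.
apply/measurable_fun_rVP => i; case: (unliftP ord0 i) => [j ->|->].
- under eq_fun do rewrite rV_consS.
  exact: (measurableT_comp (measurable_coord j) measurable_snd).
- under eq_fun do rewrite rV_cons0.
  exact: measurable_fst.
Qed.

Lemma measurable_rV_uncons n :
  measurable_fun [set: 'rV[R]_n.+1] (@rV_uncons n).
Proof.
apply: measurable_fun_pair; first exact: measurable_coord.
apply/measurable_fun_rVP => i; under eq_fun do rewrite mxE.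
exact: measurable_coord.
Qed.

End measurable_rV_theory.

Section lebesgue_rV.
Local Open Scope ereal_scope.
Context {R : realType}.

Section step.
Variables (n : nat) (m : {sigma_finite_measure set 'rV[R]_n -> \bar R}).

Definition lebesgue_rVS : set 'rV[R]_n.+1 -> \bar R :=
  pushforward (@lebesgue_measure R \x m) (@rV_cons R n).

Let lebesgue_rVS0 : lebesgue_rVS set0 = 0.
Proof. by rewrite /lebesgue_rVS /pushforward preimage_set0 measure0. Qed.

Let lebesgue_rVS_ge0 A : 0 <= lebesgue_rVS A.
Proof. exact: (measure_ge0 (@lebesgue_measure R \x m)). Qed.

Let lebesgue_rVS_sigma_additive : semi_sigma_additive lebesgue_rVS.
Proof.
move=> F mF tF mUF; rewrite /lebesgue_rVS /pushforward preimage_bigcup.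
apply: (measure_semi_sigma_additive (s := @lebesgue_measure R \x m)).
- by move=> k; rewrite -[X in measurable X]setTI; exact: measurable_rV_cons.
- apply/trivIsetP => /= i j _ _ ij; rewrite -preimage_setI.
  by move/trivIsetP : tF => /(_ _ _ _ _ ij) ->//; rewrite preimage_set0.
- rewrite -preimage_bigcup -[X in measurable X]setTI.
  exact: measurable_rV_cons.
Qed.

HB.instance Definition _ := isMeasure.Build _ _ _ lebesgue_rVS
  lebesgue_rVS0 lebesgue_rVS_ge0 lebesgue_rVS_sigma_additive.

Let lebesgue_rVS_sigma_finite : sigma_finite setT lebesgue_rVS.
Proof.
have /sigma_finiteP[F [FT ndF Foo]] := sigma_finiteT (@lebesgue_measure R).
have /sigma_finiteP[G [GT ndG Goo]] := sigma_finiteT m.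
exists (fun k => @rV_uncons R n @^-1` (F k `*` G k)).
  rewrite -preimage_bigcup; apply/esym; rewrite -subTset => x _ /=.
  have : setT (rV_uncons x).1 by [].
  rewrite FT => -[i _ Fi].
  have : setT (rV_uncons x).2 by [].
  rewrite GT => -[j _ Gj].
  exists (maxn i j) => //; split.
  - by move: Fi; exact/subsetPset/ndF/leq_maxl.
  - by move: Gj; exact/subsetPset/ndG/leq_maxr.
move=> k; have [mF Fk] := Foo k; have [mG Gk] := Goo k; split.
  rewrite -[X in measurable X]setTI; apply: measurable_rV_uncons => //.
  exact: measurableX.
rewrite /lebesgue_rVS /pushforward -comp_preimage.
rewrite (_ : _ \o _ = idfun); last by apply/funext => p /=; rewrite rV_consK.
by rewrite preimage_id product_measure1E// lte_mul_pinfty// ge0_fin_numE.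
Qed.

HB.instance Definition _ := Measure_isSigmaFinite.Build _ _ _ lebesgue_rVS
  lebesgue_rVS_sigma_finite.

End step.

Fixpoint lebesgue_rV (n : nat) : {sigma_finite_measure set 'rV[R]_n -> \bar R} :=
  match n with
  | 0 => \d_(0%R : 'rV[R]_0)
  | n'.+1 => lebesgue_rVS (lebesgue_rV n')
  end.

(* This determines the measure: it is the usual Lebesgue measure. *)
Lemma lebesgue_rV_box n (A : 'I_n -> set (measurableTypeR R)) :
  (forall i, measurable (A i)) ->
  lebesgue_rV n [set x : 'rV[R]_n | forall i, A i (x ord0 i)] =
  \prod_(i < n) lebesgue_measure (A i).
Proof.
elim: n A => [|n ih] A mA.
  rewrite big_ord0 /= diracE mem_set//= => -[].
  by case.
rewrite big_ord_recl /= /lebesgue_rVS /pushforward.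
have -> : @rV_cons R n @^-1` [set x : 'rV[R]_n.+1 | forall i, A i (x ord0 i)] =
    A ord0 `*` [set x : 'rV[R]_n | forall i, A (lift ord0 i) (x ord0 i)].
  apply/seteqP; split=> [p /= Ap|p /= [Ap0 Ap] i].
    split; first by rewrite -(rV_cons0 p).
    by move=> i; rewrite -rV_consS.
  by case: (unliftP ord0 i) => [j ->|->]; rewrite ?rV_consS ?rV_cons0.
suff mB : measurable
    [set x : 'rV[R]_n | forall i, A (lift ord0 i) (x ord0 i)].
  by rewrite product_measure1E//= (ih (fun i => A (lift ord0 i))).
have -> : [set x : 'rV[R]_n | forall i, A (lift ord0 i) (x ord0 i)] =
    \bigcap_(i in [set: 'I_n]) ((fun x => x ord0 i) @^-1` A (lift ord0 i)).
  by apply/seteqP; split=> [x Ax i _|x Ax i]; exact: Ax.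
apply: fin_bigcap_measurable => // i _.
rewrite -[X in measurable X]setTI.
have := @measurable_coord R n i measurableT (A (lift ord0 i)).
by apply; exact: mA.
Qed.

End lebesgue_rV.

(** ** The index set R_flat *)

Inductive Rflat (R : realType) :=
| Rpos of {posnum R}
| Flat of {posnum R}.

Section Rflat_order.
Context {R : realType}.

Definition Rflat_lt (s t : Rflat R) : Prop :=
  match s, t with
  | Rpos x, Rpos y => x%:num < y%:num
  | Rpos x, Flat _ => x%:num < 2^-1
  | Flat _, Rpos y => 2^-1 <= y%:num
  | Flat a, Flat b => a%:num < b%:num
  end.

Definition Rflat_le (s t : Rflat R) : Prop := s = t \/ Rflat_lt s t.

Definition Rflat_half : Rflat R := Rpos (2^-1)%:pos.

Lemma Flat_lt_half (a : {posnum R}) : Rflat_lt (Flat a) Rflat_half.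
Proof. exact: lexx. Qed.

End Rflat_order.

Section hermite.
Context {R : realType} {d : nat}.
Implicit Types (x t u : 'rV[R]_d) (a : {ffun 'I_d -> nat}) (s : Rflat R).

(** ** Multi-indices and Hermite functions *)

Definition mlength a : nat := (\sum_i a i)%N.
Definition mfact a : nat := (\prod_i (a i)`!)%N.

(* The library norm on ['rV[R]_d] is the sup norm, hence: *)
Definition sqnorm x : R := \sum_i x ord0 i ^+ 2.
Definition enorm x : R := Num.sqrt (sqnorm x).

Definition partial (i : 'I_d) (F : 'rV[R]_d -> R) : 'rV[R]_d -> R :=
  fun x => 'D_(delta_mx ord0 i) F x.

(* [\partial_1^(a_1) ... \partial_d^(a_d) F] *)
Definition mpartial a (F : 'rV[R]_d -> R) : 'rV[R]_d -> R :=
  foldr (fun i G => iter (a i) (partial i) G) F (enum 'I_d).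

Definition hermite_fun a x : R :=
  pi `^ (- (d%:R / 4)) * (-1) ^+ mlength a *
  (2 ^+ mlength a * (mfact a)%:R) `^ (- 2^-1) *
  expR (sqnorm x / 2) * mpartial a (fun y => expR (- sqnorm y)) x.

(** ** Formal Hermite series and Pilipovic spaces *)

(* A formal Hermite series is given by its coefficients. *)
Definition hermite_series := {ffun 'I_d -> nat} -> R[i].

Definition vartheta (r : R) s a : R :=
  match s with
  | Rpos s => expR (r * (mlength a)%:R `^ (1 / (2 * s%:num)))
  | Flat sigma => r ^+ mlength a * (mfact a)%:R `^ (1 / (2 * sigma%:num))
  end.

Definition pilipovic s : set hermite_series :=
  [set f | forall r : R, 0 < r ->
    has_ubound (range (fun a => Normc.normc (f a) * vartheta r s a))].

(** ** Functions as formal Hermite series *)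

Let mu := @lebesgue_rV R d.

(* [g] is measurable, all [g * h_a] are integrable, and the formal series
   associated with [g] is [f]. *)
Definition given_by (f : hermite_series) (g : 'rV[R]_d -> R[i]) : Prop :=
  [/\ measurable_fun setT (fun x => complex.Re (g x)),
      measurable_fun setT (fun x => complex.Im (g x)) &
      forall a,
        let re x := complex.Re (g x) * hermite_fun a x in
        let im x := complex.Im (g x) * hermite_fun a x in
        [/\ mu.-integrable setT (EFin \o re),
            mu.-integrable setT (EFin \o im) &
            f a = Complex (\int[mu]_x re x) (\int[mu]_x im x)]].

(* [+oo] if [f] is not given by a function. The infimum is needed since
   functions of fast growth are not determined by their Hermite series. *)
Definition Loo_norm (f : hermite_series) (w : 'rV[R]_d -> R) : \bar R :=
  ereal_inf [set Lnorm mu +oo%E (fun x => (Normc.normc (g x) * w x)%:E)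
            | g in given_by f].

(** ** Fractional Fourier transforms and weights *)

Definition expi (y : R) : R[i] := Complex (cos y) (sin y).

Definition frac_fourier t (f : hermite_series) : hermite_series :=
  fun a => expi (- (pi / 2 * \sum_i t ord0 i * (a i)%:R)) * f a.

(* Only meaningful for [s <= 1/2]. *)
Definition omega (r : R) s x : R :=
  match s with
  | Rpos s =>
      if s%:num < 2^-1 then
        expR (- (r * ln (Num.sqrt (1 + sqnorm x)) `^ (1 / (1 - 2 * s%:num))))
      else expR (- (r * enorm x ^+ 2))
  | Flat sigma =>
      expR (- (r * enorm x `^ (2 * sigma%:num / (sigma%:num + 1))))
  end.

Definition weight (r : R) s x : R := expR (enorm x ^+ 2 / 2) * omega r s x.

Definition Lambda t u : set 'rV[R]_d :=
  [set t + \row_j ((k j)%:~R * u ord0 j) | k in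
    [set k : 'I_d -> int | forall j, 0 <= (k j)%:~R * u ord0 j < 2]].

End hermite.
Arguments hermite_series : clear implicits.

(* Main.v *)
Require Import Defs.
From mathcomp Require Import all_boot all_order all_algebra.
From mathcomp Require Import complex.
From mathcomp Require Import all_classical all_reals all_analysis.
From mathcomp Require Import measurable_realfun ess_sup_inf.
From mathcomp Require Import ring lra.

Set Implicit Arguments.
Unset Strict Implicit.
Unset Printing Implicit Defensive.
Import Order.TTheory GRing.Theory Num.Theory.
Import numFieldNormedType.Exports.
Local Open Scope classical_set_scope.
Local Open Scope ring_scope.

(** Let [phi] be the function with [omega r s x = exp (- r phi |x|)]. The bound for
    all [t] contains the one for [t] in [Lambda]; it remains to derive the former
    from the decay of the coefficients, and this decay from the latter.

    The first part holds because the Hermite functions are small enough. Bounding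
    the Hermite polynomials by their three-term recurrence ([herm_le]) shows that
    [|h_a x| <= C exp (- |x|^2 / 2 + e phi |x|) 2^-|a| vartheta r s a] for every
    [e > 0] and some large [r] ([hermite_fun_vartheta_le]). So the Hermite series
    of a Pilipovic element converges to a function with the required bound
    ([hermite_synthesis]). Only the moduli of the coefficients matter, and these
    are the same for all the fractional Fourier transforms of [f].

    For the second part, the formal Bargmann transform
    [V f z = \sum_a f a z^a / sqrt a!] turns the fractional Fourier transform of
    order [t] into the rotation of the variables by [pi / 2 t]
    ([bargmann_frac_fourier]). It is the integral of [f] against the kernel
    [pi^(-d/4) exp (- |y|^2 / 2 + sqrt 2 <y, z> - <z, z> / 2)], the generating
    function of the [h_a / sqrt a!], so a function bounded by
    [exp (- |y|^2 / 2 + r phi |y|)] has a transform bounded by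
    [exp (|Im z|^2 / 2 + r K (phi |Re z| + 1))], up to a constant
    ([bargmann_le]). By assumption, [V f] thus grows like [exp (r K phi |z|)] as
    soon as each [z_j] lies on one of the rays of argument
    [- pi / 2 (t0_j + k u_j)], while it grows at most like a Gaussian elsewhere. Consecutive rays, and also the last
    ray and the negative of the first one, make an angle at most
    [pi / 2 u_j <= pi / 2] ([between_rays]). A function of order [2] which is
    bounded on the sides of a sector of opening less than [pi / 2] is bounded in
    it, by Phragmen and Lindelof ([phragmen_lindelof]); openings equal to
    [pi / 2], which occur for [s = 1/2] only, are made smaller at the price of a
    small Gaussian factor, harmless against the weight ([sector_gap_half]). Hence
    [V f] is of growth [exp (e phi |z|)] for every [e > 0], Cauchy's inequalities
    bound its coefficients [f a / sqrt a!] on every polycircle ([coef_bound]),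
    and optimal radii give the decay ([coef_decay_pow], [coef_decay_log]).

    The analysis is done with finite sums. [V f] is truncated to
    [a j <= N], where the kernel is only known up to an error [2 ^- N]
    ([hgen_le]), and [N] is chosen large at the very end, for a single
    coefficient. Truncations are exponential polynomials in [w_j = log z_j], to
    which the maximum principle applies one variable at a time on rectangles
    ([maximum_modulus]). *)

(** * Complex numbers and the complex exponential *)

(** The modulus as a real number, whereas [`|z|] is a complex number. *)
Notation nc := Normc.normc.

Section complex_norm.
Context {R : realType}.
Implicit Types z w : R[i].

Lemma nc_ge0 z : 0 <= nc z.
Proof. by case: z => a b; exact: sqrtr_ge0. Qed.

Lemma sqr_nc z : nc z ^+ 2 = complex.Re z ^+ 2 + complex.Im z ^+ 2.
Proof. by case: z => a b /=; rewrite sqr_sqrtr// addr_ge0// sqr_ge0. Qed.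

Lemma nc_norm z : `|z| = (nc z)%:C%C.
Proof. by []. Qed.

Lemma ncD z w : nc (z + w) <= nc z + nc w.
Proof. by have := ler_normD z w; rewrite !nc_norm -rmorphD/= lecR. Qed.

Lemma ncN z : nc (- z) = nc z.
Proof. by have := normrN z; rewrite !nc_norm => -[]. Qed.

Lemma ncB z w : nc (z - w) <= nc z + nc w.
Proof. by rewrite -(ncN w) ncD. Qed.

Lemma ncX z n : nc (z ^+ n) = nc z ^+ n.
Proof. by have := normrX n z; rewrite !nc_norm -rmorphXn => -[]. Qed.

Lemma nc_real (x : R) : nc (x%:C)%C = `|x|.
Proof. by rewrite /= expr0n addr0 sqrtr_sqr. Qed.

Lemma nc_nat (n : nat) : nc (n%:R : R[i]) = n%:R.
Proof. by rewrite -(rmorph_nat (real_complex R)) nc_real ger0_norm. Qed.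

Lemma ncV z : nc z^-1 = (nc z)^-1.
Proof. exact: Normc.normcV. Qed.

Lemma nc_sum I (r : seq I) (P : pred I) (F : I -> R[i]) :
  nc (\sum_(i <- r | P i) F i) <= \sum_(i <- r | P i) nc (F i).
Proof.
elim/big_ind2 : _ => [|x1 x2 y1 y2 h1 h2|//]; first by rewrite Normc.normc0.
by rewrite (le_trans (ncD _ _))// lerD.
Qed.

Lemma nc_prod I (r : seq I) (P : pred I) (F : I -> R[i]) :
  nc (\prod_(i <- r | P i) F i) = \prod_(i <- r | P i) nc (F i).
Proof.
by elim/big_rec2 : _ => [|i x y _ <-]; rewrite ?Normc.normc1// Normc.normcM.
Qed.

Lemma Re_le_nc z : `|complex.Re z| <= nc z.
Proof.
rewrite -(@ler_pXn2r _ 2)// ?nnegrE ?nc_ge0//.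
by rewrite sqr_nc real_normK ?num_real// lerDl sqr_ge0.
Qed.

Lemma Im_le_nc z : `|complex.Im z| <= nc z.
Proof.
rewrite -(@ler_pXn2r _ 2)// ?nnegrE ?nc_ge0//.
by rewrite sqr_nc real_normK ?num_real// lerDr sqr_ge0.
Qed.

Lemma nc_le_ReIm z : nc z <= `|complex.Re z| + `|complex.Im z|.
Proof.
rewrite -(@ler_pXn2r _ 2)// ?nnegrE ?nc_ge0 ?addr_ge0// sqr_nc sqrrD.
rewrite !real_normK ?num_real// addrAC lerDl mulrn_wge0// mulr_ge0//.
Qed.

Lemma ReM z w : complex.Re (z * w) =
  complex.Re z * complex.Re w - complex.Im z * complex.Im w.
Proof. by case: z w => a b [c d]. Qed.

Lemma ImM z w : complex.Im (z * w) =
  complex.Re z * complex.Im w + complex.Im z * complex.Re w.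
Proof. by case: z w => a b [c d]. Qed.

Lemma ReZ (x : R) z : complex.Re (x%:C%C * z) = x * complex.Re z.
Proof. by rewrite ReM/= mul0r subr0. Qed.

Lemma ImZ (x : R) z : complex.Im (x%:C%C * z) = x * complex.Im z.
Proof. by rewrite ImM/= mul0r addr0. Qed.

Lemma ReD z w : complex.Re (z + w) = complex.Re z + complex.Re w.
Proof. by case: z w => a b [c d]. Qed.

Lemma ImD z w : complex.Im (z + w) = complex.Im z + complex.Im w.
Proof. by case: z w => a b [c d]. Qed.

Lemma ReN z : complex.Re (- z) = - complex.Re z.
Proof. by case: z. Qed.

Lemma ImN z : complex.Im (- z) = - complex.Im z.
Proof. by case: z. Qed.

Lemma Re_sum I (r : seq I) (P : pred I) (F : I -> R[i]) :
  complex.Re (\sum_(i <- r | P i) F i) = \sum_(i <- r | P i) complex.Re (F i).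
Proof. by elim/big_rec2 : _ => // i x y _ <-; rewrite ReD. Qed.

Lemma Im_sum I (r : seq I) (P : pred I) (F : I -> R[i]) :
  complex.Im (\sum_(i <- r | P i) F i) = \sum_(i <- r | P i) complex.Im (F i).
Proof. by elim/big_rec2 : _ => // i x y _ <-; rewrite ImD. Qed.

Lemma sqr_ncD z w : nc (z + w) ^+ 2 =
  nc z ^+ 2 + 2 * complex.Re (conjc z * w) + nc w ^+ 2.
Proof. by rewrite !sqr_nc; case: z w => a b [c d] /=; ring. Qed.

Lemma nc_conj z : nc (conjc z) = nc z.
Proof. by case: z => a b /=; rewrite sqrrN. Qed.

Lemma nc_mul_conj z : complex.Re (conjc z * z) = nc z ^+ 2.
Proof. by rewrite sqr_nc; case: z => a b /=; ring. Qed.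

End complex_norm.

Section cexp.
Context {R : realType}.
Implicit Types z w : R[i].

Definition cexp z : R[i] :=
  Complex (expR (complex.Re z) * cos (complex.Im z))
          (expR (complex.Re z) * sin (complex.Im z)).

Lemma cexp0 : cexp 0 = 1.
Proof. by rewrite /cexp/= expR0 cos0 sin0 mulr1 mulr0. Qed.

Lemma cexpD z w : cexp (z + w) = cexp z * cexp w.
Proof.
case: z w => a b [c d]; rewrite /cexp /= expRD cosD sinD.
by apply/eqP; rewrite eq_complex/=; apply/andP; split; apply/eqP; ring.
Qed.

Lemma nc_cexp z : nc (cexp z) = expR (complex.Re z).
Proof.
rewrite /cexp /= !exprMn -mulrDr cos2Dsin2 mulr1 sqrtr_sqr ger0_norm// expR_ge0.
Qed.

Lemma cexp_sum I (r : seq I) (P : pred I) (F : I -> R[i]) :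
  cexp (\sum_(i <- r | P i) F i) = \prod_(i <- r | P i) cexp (F i).
Proof. by elim/big_rec2 : _ => [|i x y _ <-]; rewrite ?cexp0// cexpD. Qed.

Lemma is_derive1D (f g : R -> R) (x df dg : R) : is_derive x 1 f df ->
  is_derive x 1 g dg -> is_derive x 1 (fun s => f s + g s) (df + dg).
Proof. exact: is_deriveD. Qed.

Lemma is_derive1M (f g : R -> R) (x df dg : R) : is_derive x 1 f df ->
  is_derive x 1 g dg -> is_derive x 1 (fun s => f s * g s) (df * g x + f x * dg).
Proof.
move=> hf hg; have h := is_deriveM hf hg.
by apply: (is_derive_eq h); rewrite addrC mulrC.
Qed.

Lemma is_derive1N (f : R -> R) (x df : R) : is_derive x 1 f df ->
  is_derive x 1 (fun s => - f s) (- df).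
Proof. exact: is_deriveN. Qed.

Definition cderiv (F : R -> R[i]) (s : R) (D : R[i]) :=
  is_derive s 1 (fun s => complex.Re (F s)) (complex.Re D) /\
  is_derive s 1 (fun s => complex.Im (F s)) (complex.Im D).

Lemma cderiv_eq F s D D' : cderiv F s D -> D = D' -> cderiv F s D'.
Proof. by move=> ? <-. Qed.

Lemma cderiv_cst c s : cderiv (fun=> c) s 0.
Proof. by split; exact: is_derive_cst. Qed.

Lemma cderivD F G s D E :
  cderiv F s D -> cderiv G s E -> cderiv (fun s => F s + G s) s (D + E).
Proof.
by case=> h1 h2 [h3 h4]; split;
  [under eq_fun do rewrite ReD|under eq_fun do rewrite ImD];
  rewrite ?ReD ?ImD; exact: is_deriveD.
Qed.

Lemma cderivM F G s D E : cderiv F s D -> cderiv G s E ->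
  cderiv (fun s => F s * G s) s (D * G s + F s * E).
Proof.
case=> h1 h2 [h3 h4]; split.
- under eq_fun do rewrite ReM.
  apply: (is_derive_eq
    (is_derive1D (is_derive1M h1 h3) (is_derive1N (is_derive1M h2 h4)))).
  by rewrite !(ReD,ReM); ring.
- under eq_fun do rewrite ImM.
  apply: (is_derive_eq (is_derive1D (is_derive1M h1 h4) (is_derive1M h2 h3))).
  by rewrite !(ImD,ImM); ring.
Qed.

Lemma cderiv_id s : cderiv (fun s => s%:C%C) s 1.
Proof. by split; [exact: is_derive_id|exact: is_derive_cst]. Qed.

Lemma cderivZ c F s D : cderiv F s D -> cderiv (fun s => c * F s) s (c * D).
Proof.
move=> h; apply: cderiv_eq (cderivM (cderiv_cst c s) h) _.
by rewrite mul0r add0r.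
Qed.

Lemma cderivB F G s D E :
  cderiv F s D -> cderiv G s E -> cderiv (fun s => F s - G s) s (D - E).
Proof.
move=> hF hG; under eq_fun do rewrite -mulN1r.
by apply: cderiv_eq (cderivD hF (cderivZ (-1) hG)) _; rewrite mulN1r.
Qed.

Lemma cderiv_sum n (F : 'I_n -> R -> R[i]) s (D : 'I_n -> R[i]) :
  (forall i, cderiv (F i) s (D i)) ->
  cderiv (fun s => \sum_i F i s) s (\sum_i D i).
Proof.
elim: n F D => [|n ih] F D h.
  under eq_fun do rewrite big_ord0; rewrite big_ord0; exact: cderiv_cst.
under eq_fun do rewrite big_ord_recl; rewrite big_ord_recl.
by apply: cderivD => //; apply: ih => i; exact: h.
Qed.

Lemma cderivX F s D n : cderiv F s D ->
  cderiv (fun s => F s ^+ n) s (n%:R * F s ^+ n.-1 * D).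
Proof.
move=> h; elim: n => [|n ih].
  by rewrite !mul0r; under eq_fun do rewrite expr0; exact: cderiv_cst.
under eq_fun do rewrite exprS.
apply: cderiv_eq (cderivM h ih) _.
by case: n {ih} => [|n] /=; rewrite ?expr0 ?mulr1 ?mul0r ?mulr0 ?addr0 ?mul1r//;
  rewrite exprS [in RHS]mulrS; ring.
Qed.

Lemma cderiv_cexp F s D : cderiv F s D ->
  cderiv (fun s => cexp (F s)) s (D * cexp (F s)).
Proof.
case=> h1 h2.
have e1 := is_derive1_comp (is_derive_expR (complex.Re (F s))) h1.
have e2 := is_derive1_comp (is_derive_cos (complex.Im (F s))) h2.
have e3 := is_derive1_comp (is_derive_sin (complex.Im (F s))) h2.
split.
- by apply: (is_derive_eq (is_derive1M e1 e2)); rewrite ReM/=; ring.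
- by apply: (is_derive_eq (is_derive1M e1 e3)); rewrite ImM/=; ring.
Qed.

(** The mean value theorem fails for complex valued functions, but its
    consequence survives: apply it to the real part of [conj(F 1 - F 0) F]. *)
Lemma cderiv_mean_value F D (M : R) :
  (forall s : R, 0 <= s <= 1 -> cderiv F s (D s)) ->
  (forall s : R, 0 <= s <= 1 -> nc (D s) <= M) ->
  nc (F 1 - F 0) <= M.
Proof.
move=> dF DM; pose c := conjc (F 1 - F 0).
have dphi (s : R) : 0 <= s <= 1 ->
    is_derive s 1 (fun s => complex.Re (c * F s)) (complex.Re (c * D s)).
  by move=> /dF h; have [] := cderivZ c h.
have [||s s01 E] := @MVT_segment R (fun s => complex.Re (c * F s))
    (fun s => complex.Re (c * D s)) 0 1 ler01.
- by move=> s; rewrite in_itv/= => /andP[s0 s1]; apply: dphi; rewrite !ltW.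
- apply: derivable_within_continuous => s.
  rewrite in_itv/= => s01.
  by have [] := dphi _ s01.
have {}s01 : 0 <= s <= 1 by rewrite in_itv/= in s01.
have : nc (F 1 - F 0) ^+ 2 <= nc (F 1 - F 0) * M.
  rewrite -nc_mul_conj mulrBr ReD ReN E subr0 mulr1.
  rewrite (le_trans (ler_norm _))// (le_trans (Re_le_nc _))//.
  by rewrite Normc.normcM nc_conj ler_wpM2l ?nc_ge0// DM.
have [->|n0] := eqVneq (nc (F 1 - F 0)) 0.
  by move=> _; rewrite (le_trans (nc_ge0 _) (DM 0 _))// lexx ler01.
by rewrite expr2 ler_pM2l// lt_def n0 nc_ge0.
Qed.

Lemma cderiv_ray z s : cderiv (fun s => s%:C%C * z) s z.
Proof.
apply: cderiv_eq (cderivM (cderiv_id s) (cderiv_cst z s)) _.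
by rewrite mul1r mulr0 addr0.
Qed.

Lemma Re_ray_le z (s : R) : 0 <= s <= 1 -> complex.Re (s%:C%C * z) <= nc z.
Proof.
move=> /andP[s0 s1]; rewrite (le_trans (ler_norm _))//.
rewrite (le_trans (Re_le_nc _))// Normc.normcM nc_real ger0_norm//.
by rewrite ler_piMl// nc_ge0.
Qed.

Lemma nc_ray_le z (s : R) : 0 <= s <= 1 -> nc (s%:C%C * z) <= nc z.
Proof.
move=> /andP[s0 s1]; rewrite Normc.normcM nc_real ger0_norm//.
by rewrite ler_piMl// nc_ge0.
Qed.

(** Along the segment from [0] to [z], the derivative of each Taylor remainder is
    [z] times the previous one, so that the mean value bound can be iterated. *)
Lemma cexp_sub1_le z : nc (cexp z - 1) <= nc z * expR (nc z).
Proof.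
have := @cderiv_mean_value (fun s => cexp (s%:C%C * z))
  (fun s => z * cexp (s%:C%C * z)) (nc z * expR (nc z)).
rewrite mul1r mul0r cexp0; apply=> s s01.
  exact: cderiv_cexp (cderiv_ray z s).
by rewrite Normc.normcM ler_wpM2l ?nc_ge0// nc_cexp ler_expR Re_ray_le.
Qed.

Lemma cexp_sub2_le z : nc (cexp z - 1 - z) <= nc z ^+ 2 * expR (nc z).
Proof.
have := @cderiv_mean_value (fun s => cexp (s%:C%C * z) - s%:C%C * z)
  (fun s => z * (cexp (s%:C%C * z) - 1)) (nc z ^+ 2 * expR (nc z)).
rewrite mul1r mul0r cexp0 subr0 addrAC; apply=> s s01.
  apply: cderiv_eq (cderivB (cderiv_cexp (cderiv_ray z s)) (cderiv_ray z s)) _.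
  by rewrite mulrBr mulr1.
rewrite Normc.normcM expr2 -mulrA ler_wpM2l ?nc_ge0//.
rewrite (le_trans (cexp_sub1_le _))// ler_pM ?nc_ge0 ?expR_ge0 ?nc_ray_le//.
by rewrite ler_expR nc_ray_le.
Qed.

Lemma cexp_sub3_le z :
  nc (cexp z - 1 - z - z ^+ 2 / 2) <= nc z ^+ 3 * expR (nc z).
Proof.
have := @cderiv_mean_value
  (fun s => cexp (s%:C%C * z) - s%:C%C * z - (s%:C%C * z) ^+ 2 / 2)
  (fun s => z * (cexp (s%:C%C * z) - 1 - s%:C%C * z))
  (nc z ^+ 3 * expR (nc z)).
rewrite mul1r mul0r cexp0 subr0 expr0n/= mul0r subr0.
have -> : cexp z - z - z ^+ 2 / 2 - 1 = cexp z - 1 - z - z ^+ 2 / 2 by ring.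
apply=> s s01.
  have h := cderivM (cderivX 2 (cderiv_ray z s)) (cderiv_cst 2^-1 s).
  apply: cderiv_eq (cderivB (cderivB (cderiv_cexp (cderiv_ray z s))
    (cderiv_ray z s)) h) _.
  by rewrite /=; field.
rewrite Normc.normcM exprS -mulrA ler_wpM2l ?nc_ge0//.
rewrite (le_trans (cexp_sub2_le _))// ler_pM ?exprn_ge0 ?nc_ge0 ?expR_ge0//.
- by rewrite lerXn2r ?nnegrE ?nc_ge0 ?nc_ray_le.
- by rewrite ler_expR nc_ray_le.
Qed.

End cexp.

(** * The maximum modulus principle *)

Section expand2.
Context {R : realType}.
Implicit Types (f g : R[i] -> R[i]) (rho : R[i] -> R[i]).

Definition locally_bounded rho :=
  forall K : R, exists C : R, forall h, nc h <= K -> nc (rho h) <= C.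

Lemma locally_bounded_cst c : locally_bounded (fun=> c).
Proof. by move=> K; exists (nc c). Qed.

Lemma locally_bounded_id : locally_bounded id.
Proof. by move=> K; exists K. Qed.

Lemma locally_boundedD rho1 rho2 : locally_bounded rho1 ->
  locally_bounded rho2 -> locally_bounded (fun h => rho1 h + rho2 h).
Proof.
move=> b1 b2 K; have [C1 h1] := b1 K; have [C2 h2] := b2 K.
by exists (C1 + C2) => h hK; rewrite (le_trans (ncD _ _))// lerD ?h1 ?h2.
Qed.

Lemma locally_boundedM rho1 rho2 : locally_bounded rho1 ->
  locally_bounded rho2 -> locally_bounded (fun h => rho1 h * rho2 h).
Proof.
move=> b1 b2 K; have [C1 h1] := b1 K; have [C2 h2] := b2 K.
by exists (C1 * C2) => h hK; rewrite Normc.normcM ler_pM ?nc_ge0 ?h1 ?h2.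
Qed.

Lemma locally_bounded_comp rho1 rho2 : locally_bounded rho1 ->
  locally_bounded rho2 -> locally_bounded (fun h => rho1 (rho2 h)).
Proof.
move=> b1 b2 K; have [C2 h2] := b2 K; have [C1 h1] := b1 C2.
by exists C1 => h /h2/h1.
Qed.

(** A quantitative form of holomorphy, stable under sums, products and the
    exponential. The third order is what the maximum principle needs: averaging
    over four directions cancels the first two. *)
Definition expand2 f := forall w, exists a0 a1 a2 rho, locally_bounded rho /\
  forall h, f (w + h) = a0 + a1 * h + a2 * h ^+ 2 + h ^+ 3 * rho h.

Lemma expand2_cst c : expand2 (fun=> c).
Proof.
move=> w; exists c, 0, 0, (fun=> 0); split; first exact: locally_bounded_cst.
by move=> h; ring.
Qed.

Lemma expand2_id : expand2 id.
Proof.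
move=> w; exists w, 1, 0, (fun=> 0); split; first exact: locally_bounded_cst.
by move=> h; ring.
Qed.

Lemma expand2D f g : expand2 f -> expand2 g -> expand2 (fun w => f w + g w).
Proof.
move=> ef eg w; have [a0 [a1 [a2 [r [br hr]]]]] := ef w.
have [b0 [b1 [b2 [q [bq hq]]]]] := eg w.
exists (a0 + b0), (a1 + b1), (a2 + b2), (fun h => r h + q h).
by split; [exact: locally_boundedD|move=> h; rewrite hr hq; ring].
Qed.

Lemma expand2M f g : expand2 f -> expand2 g -> expand2 (fun w => f w * g w).
Proof.
move=> ef eg w; have [a0 [a1 [a2 [r [br hr]]]]] := ef w.
have [b0 [b1 [b2 [q [bq hq]]]]] := eg w.
exists (a0 * b0), (a0 * b1 + a1 * b0), (a0 * b2 + a1 * b1 + a2 * b0).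
exists (fun h => (a0 + a1 * h + a2 * (h * h)) * q h
  + (b0 + b1 * h + b2 * (h * h)) * r h + (h * (h * h)) * (r h * q h)
  + (a1 * b2 + a2 * b1 + a2 * b2 * h)).
split; first by do ?[exact: br|exact: bq|exact: locally_bounded_cst
  |exact: locally_bounded_id|apply: locally_boundedD|apply: locally_boundedM].
by move=> h; rewrite hr hq; ring.
Qed.

Lemma expand2N f : expand2 f -> expand2 (fun w => - f w).
Proof.
move=> ef; have -> : (fun w => - f w) = (fun w => -1 * f w).
  by apply/funext => w; rewrite mulN1r.
exact: expand2M (expand2_cst (-1)) ef.
Qed.

Lemma expand2_sum I (r : seq I) (P : pred I) (F : I -> R[i] -> R[i]) :
  (forall i, expand2 (F i)) -> expand2 (fun w => \sum_(i <- r | P i) F i w).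
Proof.
move=> h; elim: r => [|i r ih].
  by under eq_fun do rewrite big_nil; exact: expand2_cst.
under eq_fun do rewrite big_cons.
by case: (P i) => //; exact: expand2D (h i) ih.
Qed.

Lemma expand2_prod I (r : seq I) (P : pred I) (F : I -> R[i] -> R[i]) :
  (forall i, expand2 (F i)) -> expand2 (fun w => \prod_(i <- r | P i) F i w).
Proof.
move=> h; elim: r => [|i r ih].
  by under eq_fun do rewrite big_nil; exact: expand2_cst.
under eq_fun do rewrite big_cons.
by case: (P i) => //; exact: expand2M (h i) ih.
Qed.

Lemma expand2X f n : expand2 f -> expand2 (fun w => f w ^+ n).
Proof.
move=> h; elim: n => [|n ih].
  by under eq_fun do rewrite expr0; exact: expand2_cst.
by under eq_fun do rewrite exprS; exact: expand2M h ih.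
Qed.

Lemma expand2_cexp f : expand2 f -> expand2 (fun w => cexp (f w)).
Proof.
(* the value at [0] is [0], division by zero being total *)
pose e (h : R[i]) := (cexp h - 1 - h - h ^+ 2 / 2) / h ^+ 3.
have eE h : cexp h = 1 + h + h ^+ 2 / 2 + h ^+ 3 * e h.
  have [->|h0] := eqVneq h 0; first by rewrite cexp0 !expr0n/=; ring.
  by rewrite /e; field.
have be : locally_bounded e.
  move=> K; exists (expR K) => h hK.
  have [->|h0] := eqVneq h 0.
    have -> : e 0 = 0 by rewrite /e cexp0 subrr subr0 expr0n/= mul0r subr0 mul0r.
    by rewrite Normc.normc0 expR_ge0.
  have nh0 : 0 < nc h.
    by rewrite lt_def nc_ge0 andbT; apply: contra h0 => /eqP/Normc.eq0_normc ->.
  rewrite Normc.normcM ncV ncX ler_pdivrMr ?exprn_gt0// [leRHS]mulrC.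
  rewrite (le_trans (cexp_sub3_le h))// ler_wpM2l ?exprn_ge0 ?nc_ge0//.
  by rewrite ler_expR.
move=> ef w; have [b0 [b1 [b2 [r [br hr]]]]] := ef w.
pose k h := b1 + b2 * h + h * h * r h.
have bk : locally_bounded k.
  by rewrite /k; do ?[exact: br|exact: locally_bounded_cst
  |exact: locally_bounded_id|apply: locally_boundedD|apply: locally_boundedM].
exists (cexp b0), (cexp b0 * b1), (cexp b0 * (b2 + b1 ^+ 2 / 2)).
exists (fun h => cexp b0 * (r h + 2^-1 * ((b2 + h * r h) * (b1 + k h))
   + k h * (k h * k h) * e (h * k h))).
split.
  have bek := locally_bounded_comp be (locally_boundedM locally_bounded_id bk).
  by do ?[exact: br|exact: bk|exact: bek|exact: locally_bounded_cst
  |exact: locally_bounded_id|apply: locally_boundedD|apply: locally_boundedM].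
move=> h; rewrite hr.
have -> : b0 + b1 * h + b2 * h ^+ 2 + h ^+ 3 * r h = b0 + h * k h.
  by rewrite /k; ring.
cbv beta; rewrite cexpD (eE (h * k h)); move: (e (h * k h)) => E; rewrite /k.
by field.
Qed.

Lemma expand2_continuous f : expand2 f ->
  continuous (fun p : R * R => nc (f (Complex p.1 p.2))).
Proof.
move=> ef p; have [a0 [a1 [a2 [r [br hr]]]]] := ef (Complex p.1 p.2).
have [C hC] : exists C : R, forall h, nc h <= 2 ->
    nc (a1 + a2 * h + h * h * r h) <= C.
  by apply: (_ : locally_bounded _);
    do ?[exact: br|exact: locally_bounded_cst
  |exact: locally_bounded_id|apply: locally_boundedD|apply: locally_boundedM].
have C0 : 0 <= C by rewrite (le_trans (nc_ge0 _) (hC 0 _))// Normc.normc0.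
apply/cvgrPdist_le => /= e e0.
pose dl := Num.min 1 (e / (2 * (C + 1))).
have dl0 : 0 < dl by rewrite lt_min ltr01 divr_gt0// mulr_gt0// ltr_wpDl.
exists (ball p.1 dl, ball p.2 dl) => /=; first by split; exact: nbhsx_ballx.
move=> [x y] /= []; rewrite /ball/= => px py.
pose h := Complex (x - p.1) (y - p.2).
have -> : Complex x y = Complex p.1 p.2 + h :> R[i].
  by apply/eqP; rewrite eq_complex/= !subrKC !eqxx.
have hdl : nc h <= 2 * dl.
  rewrite (complexE h) (le_trans (ncD _ _))// Normc.normcM nc_real.
  rewrite [nc 'i%C]/= expr0n add0r expr1n sqrtr1 mul1r nc_real/=.
  by rewrite mulr_natl mulr2n lerD// distrC ltW.
have h2 : nc h <= 2.
  by rewrite (le_trans hdl)// ler_piMr// ge_min lexx.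
have f0 : f (Complex p.1 p.2) = a0.
  by have := hr 0; rewrite addr0 => ->; ring.
have -> : f (Complex p.1 p.2 + h) = a0 + h * (a1 + a2 * h + h * h * r h).
  by rewrite hr; ring.
rewrite f0; set v := h * _.
have nv : nc v <= e.
  rewrite /v Normc.normcM.
  apply: (@le_trans _ _ (2 * dl * (C + 1))).
    rewrite ler_pM ?nc_ge0// (le_trans (hC _ h2))// lerDl//.
  have : dl <= e / (2 * (C + 1)) by rewrite ge_min lexx orbT.
  rewrite ler_pdivlMr ?mulr_gt0 ?ltr_wpDl//; apply: le_trans.
  by rewrite mulrA [2 * dl]mulrC.
apply: le_trans nv; rewrite ler_norml; apply/andP; split.
  rewrite lerNl opprB lerBlDl; exact: ncD.
rewrite lerBlDr addrC -{1}[a0](addrK v); exact: ncB.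
Qed.

(** If [|f|^2 + e |.|^2] had an interior maximum at [w], comparing it with
    its mean over the four points [w + t i^k] would give a contradiction:
    to third order in [t], the expansion of [f] averages to [f w], so that
    [|f|^2] does not decrease on average, while [e |.|^2] gains [e t^2]. *)
Lemma expand2_no_interior_max f (e dl : R) w : expand2 f -> 0 < e -> 0 < dl ->
  ~ (forall h, nc h <= dl ->
      nc (f (w + h)) ^+ 2 + e * nc (w + h) ^+ 2
      <= nc (f w) ^+ 2 + e * nc w ^+ 2).
Proof.
move=> ef e0 dl0 hmax; have [a0 [a1 [a2 [r [br hr]]]]] := ef w.
have [C hC] := br 1.
have C0 : 0 <= C by rewrite (le_trans (nc_ge0 _) (hC 0 _))// Normc.normc0 ler01.
have f0 : f w = a0 by have := hr 0; rewrite addr0 => ->; ring.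
pose B := nc a0 * C.
have B0 : 0 <= B by rewrite mulr_ge0// nc_ge0.
pose t := Num.min (Num.min 1 dl) (e / (4 * (B + 1))).
have t0 : 0 < t by rewrite !lt_min ltr01 dl0 divr_gt0// mulr_gt0// ltr_wpDl.
have t1 : t <= 1 by rewrite !ge_min lexx.
have tdl : t <= dl by rewrite !ge_min lexx orbT.
have te : t * (4 * (B + 1)) <= e.
  by rewrite -ler_pdivlMr ?mulr_gt0 ?ltr_wpDl// !ge_min lexx !orbT.
pose T : R[i] := t%:C%C.
have key (u : R[i]) : nc u = 1 ->
    nc a0 ^+ 2 + 2 * complex.Re (conjc a0 * (a1 * (T * u) + a2 * (T * u) ^+ 2))
    - 2 * (B * t ^+ 3)
    + e * (nc w ^+ 2 + 2 * complex.Re (conjc w * (T * u)) + t ^+ 2)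
    <= nc a0 ^+ 2 + e * nc w ^+ 2.
  move=> u1; have nTu : nc (T * u) = t.
    by rewrite Normc.normcM u1 mulr1 nc_real ger0_norm// ltW.
  have := hmax (T * u); rewrite nTu => /(_ tdl).
  rewrite (sqr_ncD w) nTu f0; apply: le_trans; rewrite lerD2r.
  have -> : f (w + T * u) = a0 + ((a1 * (T * u) + a2 * (T * u) ^+ 2)
      + (T * u) ^+ 3 * r (T * u)) by rewrite hr; ring.
  set Z := a1 * _ + _; set Y := _ ^+ 3 * _; rewrite sqr_ncD.
  have -> : complex.Re (a0^*%C * (Z + Y)) =
      complex.Re (a0^*%C * Z) + complex.Re (a0^*%C * Y) by rewrite mulrDr ReD.
  have hY : - (B * t ^+ 3) <= complex.Re (a0^*%C * Y).
    rewrite lerNl -ReN (le_trans (ler_norm _))// (le_trans (Re_le_nc _))//.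
    rewrite ncN Normc.normcM /Y Normc.normcM nc_conj ncX nTu /B -mulrA ler_wpM2l ?nc_ge0//.
    by rewrite mulrC ler_wpM2r ?exprn_ge0 ?(ltW t0)// hC// nTu.
  have := sqr_ge0 (nc (Z + Y)); move: hY; lra.
have n1 : nc (1 : R[i]) = 1 by exact: Normc.normc1.
have nN1 : nc (-1 : R[i]) = 1 by rewrite ncN.
have ni : nc ('i%C : R[i]) = 1 by rewrite /= expr0n add0r expr1n sqrtr1.
have nNi : nc (- 'i%C : R[i]) = 1 by rewrite ncN.
have := lerD (lerD (key 1 n1) (key _ nN1)) (lerD (key _ ni) (key _ nNi)).
have E (c b1 b2 : R[i]) : complex.Re (c * (b1 * (T * 1) + b2 * (T * 1) ^+ 2))
  + complex.Re (c * (b1 * (T * -1) + b2 * (T * -1) ^+ 2))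
  + (complex.Re (c * (b1 * (T * 'i%C) + b2 * (T * 'i%C) ^+ 2))
    + complex.Re (c * (b1 * (T * - 'i%C) + b2 * (T * - 'i%C) ^+ 2))) = 0.
  rewrite -!ReD [X in complex.Re X](_ : _ =
    c * b2 * T ^+ 2 * 2 * (1 + 'i%C ^+ 2)); last by ring.
  by rewrite sqr_i subrr mulr0.
have E1 := E (conjc a0) a1 a2; have E2 := E (conjc w) 1 0.
rewrite !mul1r !mul0r !addr0 in E2.
have : 0 < e * t ^+ 2 * 2 - 4 * (B * t ^+ 3) * 1.
  rewrite subr_gt0 mulr1.
  have -> : 4 * (B * t ^+ 3) = (t * (4 * B)) * t ^+ 2 by ring.
  have -> : e * t ^+ 2 * 2 = (2 * e) * t ^+ 2 by ring.
  rewrite ltr_pM2r ?exprn_gt0//; nra.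
move: E1 E2; set A := nc a0 ^+ 2; set W := nc w ^+ 2.
set r1 := complex.Re _; set r2 := complex.Re _; set r3 := complex.Re _.
set r4 := complex.Re _ => E1.
set s1 := complex.Re _; set s2 := complex.Re _; set s3 := complex.Re _.
set s4 := complex.Re _ => E2.
move=> H1 H2.
have : e * (s1 + s2 + (s3 + s4)) = 0 by rewrite E2 mulr0.
have hB : 0 <= B * t ^+ 3 by rewrite mulr_ge0// exprn_ge0// ltW.
lra.
Qed.

(** The perturbation [|f|^2 + e |.|^2] attains its maximum over the rectangle, and
    does so on the boundary; then let [e] tend to [0]. *)
Lemma maximum_modulus f (a b c d' A : R) (x y : R) : expand2 f ->
  a <= x <= b -> c <= y <= d' ->
  (forall x y, a <= x <= b -> c <= y <= d' ->
     [\/ x = a, x = b, y = c | y = d'] -> nc (f (Complex x y)) <= A) ->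
  nc (f (Complex x y)) <= A.
Proof.
move=> ef xab ycd hA.
pose K := `[a, b] `*` `[c, d'].
have [axb cyd] : a <= b /\ c <= d'.
  by split; [case/andP: xab|case/andP: ycd]; exact: le_trans.
have A0 : 0 <= A.
  rewrite (le_trans (nc_ge0 _) (hA a c _ _ _))// ?lexx ?axb ?cyd//.
  by constructor 1.
have [M hM] : exists M, forall p : R * R, K p -> p.1 ^+ 2 + p.2 ^+ 2 <= M.
  exists ((`|a| + `|b|) ^+ 2 + (`|c| + `|d'|) ^+ 2) => -[p q].
  rewrite /K/= !in_itv/= => -[/andP[pa pb] /andP[qc qd]].
  rewrite lerD// -[leLHS]real_normK ?num_real// lerXn2r ?nnegrE ?addr_ge0//.
    rewrite ler_norml; apply/andP; split.
      by rewrite (le_trans _ pa)// lerNl -[- a]addr0 lerD// -normrN ler_norm.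
    by rewrite (le_trans pb)// -[b]add0r lerD// add0r ler_norm.
  rewrite ler_norml; apply/andP; split.
    by rewrite (le_trans _ qc)// lerNl -[- c]addr0 lerD// -normrN ler_norm.
  by rewrite (le_trans qd)// -[d']add0r lerD// add0r ler_norm.
suff H (e : R) : 0 < e -> nc (f (Complex x y)) ^+ 2 <= A ^+ 2 + e * M.
  rewrite -(@ler_pXn2r _ 2)// ?nnegrE ?nc_ge0//.
  have M0 : 0 <= M.
    by rewrite (le_trans _ (hM (x, y) _))//= addr_ge0 ?sqr_ge0.
  apply/ler_addgt0Pr => e e0.
  rewrite (le_trans (H (e / (M + 1)) _))// ?divr_gt0 ?ltr_wpDl// lerD2l.
  by rewrite mulrAC -mulrA ler_piMr ?(ltW e0)// ler_pdivrMr ?ltr_wpDl// mul1r lerDl.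
move=> e0.
pose Phi (p : R * R) := nc (f (Complex p.1 p.2)) ^+ 2 + e * (p.1 ^+ 2 + p.2 ^+ 2).
have cPhi : continuous Phi.
  move=> p; rewrite /Phi; apply: cvgD.
    by apply: cvgM; exact: expand2_continuous.
  apply: cvgMr; apply: cvgD; apply: cvgM.
  - exact: cvg_fst.
  - exact: cvg_fst.
  - exact: cvg_snd.
  - exact: cvg_snd.
have [||| [p q] pK hmax] := @compact_EVT_max _ _ Phi K.
- by exists (x, y); split; rewrite /= in_itv.
- by apply: compact_setX; exact: segment_compact.
- exact: continuous_subspaceT.
have pK' := pK; rewrite inE /K/= !in_itv/= in pK'.
case: pK' => pab qcd.
have hxy : Phi (x, y) <= Phi (p, q).
  by apply: hmax; rewrite inE; split; rewrite /= in_itv.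
apply: (@le_trans _ _ (Phi (x, y))).
  by rewrite /Phi/= lerDl mulr_ge0 ?(ltW e0)// addr_ge0 ?sqr_ge0.
apply: (le_trans hxy).
have [bd|nbd] := pselect [\/ p = a, p = b, q = c | q = d'].
  rewrite /Phi lerD//=.
    by rewrite lerXn2r ?nnegrE ?nc_ge0// hA.
  by rewrite ler_pM2l//; apply: (hM (p, q)); move: pK; rewrite inE.
exfalso.
have {}pab : a < p < b.
  case/andP: pab => pa pb; rewrite !lt_def pa pb !andbT; apply/andP.
  by split; apply/eqP => h; apply: nbd; [constructor 1|constructor 2].
have {}qcd : c < q < d'.
  case/andP: qcd => pa pb; rewrite !lt_def pa pb !andbT; apply/andP.
  by split; apply/eqP => h; apply: nbd; [constructor 3|constructor 4].
pose dl := Num.min (Num.min (p - a) (b - p)) (Num.min (q - c) (d' - q)).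
have dl0 : 0 < dl by rewrite !lt_min !subr_gt0 pab qcd.
apply: (@expand2_no_interior_max f e dl (Complex p q) ef e0 dl0) => h hdl.
have hRe := le_trans (Re_le_nc h) hdl; have hIm := le_trans (Im_le_nc h) hdl.
have := hmax (p + complex.Re h, q + complex.Im h).
rewrite /Phi/=; case: h hdl hRe hIm => h1 h2 hdl /= hRe hIm.
have sqE (x1 x2 : R) : nc (Complex x1 x2) ^+ 2 = x1 ^+ 2 + x2 ^+ 2.
  by rewrite sqr_nc.
have -> : (Complex p q + Complex h1 h2 : R[i]) = Complex (p + h1) (q + h2) by [].
rewrite !sqE; apply; rewrite inE /K/= !in_itv/=.
move: hRe hIm; rewrite !le_min !ler_norml.
move=> /andP[/andP[/andP[? ?] /andP[? ?]] /andP[? ?]].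
by move=> /andP[? ?]; split; apply/andP; split; lra.
Qed.

End expand2.

(** * A Phragmen-Lindelof principle *)

Section phragmen_lindelof.
Context {R : realType} {d : nat}.

Definition update (w : 'I_d -> R[i]) j (z : R[i]) : 'I_d -> R[i] :=
  fun i => if i == j then z else w i.

(** The maximum modulus principle, applied in one variable at a time, pushes
    every coordinate to the boundary of its rectangle. *)
Lemma maximum_modulus_polyrectangle (F : ('I_d -> R[i]) -> R[i])
    (a b c e : 'I_d -> R) (A : R) :
  (forall w j, expand2 (fun z => F (update w j z))) ->
  (forall x y : 'I_d -> R,
     (forall j, a j <= x j <= b j) -> (forall j, c j <= y j <= e j) ->
     (forall j, [\/ x j = a j, x j = b j, y j = c j | y j = e j]) ->
     nc (F (fun j => Complex (x j) (y j))) <= A) ->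
  forall x y : 'I_d -> R,
    (forall j, a j <= x j <= b j) -> (forall j, c j <= y j <= e j) ->
    nc (F (fun j => Complex (x j) (y j))) <= A.
Proof.
move=> eF hA.
suff H (k : nat) : forall x y : 'I_d -> R,
    (forall j, a j <= x j <= b j) -> (forall j, c j <= y j <= e j) ->
    (forall j : 'I_d, (k <= j)%N ->
      [\/ x j = a j, x j = b j, y j = c j | y j = e j]) ->
    nc (F (fun j => Complex (x j) (y j))) <= A.
  by move=> x y hx hy; apply: (H d) => // j; rewrite leqNgt ltn_ord.
elim: k => [|k ih] x y hx hy bd; first by apply: hA => // j; exact: bd.
have [dk|kd] := leqP d k.
  by apply: ih => // j kj; move: (ltn_ord j); rewrite ltnNge (leq_trans dk kj).
pose j0 := Ordinal kd.
have upd (x1 y1 : R) : update (fun j => Complex (x j) (y j)) j0 (Complex x1 y1)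
    = (fun j => Complex (if j == j0 then x1 else x j)
                        (if j == j0 then y1 else y j)).
  by apply/funext => j; rewrite /update; case: ifP.
have -> : (fun j => Complex (x j) (y j)) =
    update (fun j => Complex (x j) (y j)) j0 (Complex (x j0) (y j0)).
  by rewrite upd; apply/funext => j; case: eqP => // ->.
apply: (maximum_modulus (eF _ _) (hx j0) (hy j0)) => x1 y1 hx1 hy1 bd1.
rewrite upd; apply: ih => [j|j|j kj]; [by case: eqP => // ->|
  by case: eqP => // ->|].
case: eqP => [-> //|jj0]; apply: bd; rewrite ltn_neqAle kj andbT.
by apply/eqP => kj'; apply: jj0; exact: val_inj.
Qed.

Definition mpol N (C : {ffun 'I_d -> 'I_N} -> R[i]) (z : 'I_d -> R[i]) : R[i] :=
  \sum_a C a * \prod_j z j ^+ a j.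

Definition coshr (x : R) : R := (expR x + expR (- x)) / 2.

Lemma coshr_ge1 x : 1 <= coshr x.
Proof.
rewrite /coshr ler_pdivlMr// mul1r.
have := expR_ge1Dx x; have := expR_ge1Dx (- x); lra.
Qed.

Lemma coshr_ge_expR x : expR `|x| <= 2 * coshr x.
Proof.
rewrite /coshr mulrC divfK ?pnatr_eq0//.
by case: ger0P => _; rewrite ?lerDl ?lerDr expR_ge0.
Qed.

Definition ccosh (z : R[i]) : R[i] := (cexp z + cexp (- z)) / 2.

Lemma Re_ccosh (z : R[i]) :
  complex.Re (ccosh z) = coshr (complex.Re z) * cos (complex.Im z).
Proof.
rewrite /ccosh /coshr ReM.
have -> : (2^-1 : R[i]) = (2^-1 : R)%:C%C by rewrite fmorphV rmorph_nat.
rewrite ReD ImD /= ReN ImN cosN mulr0 subr0; ring.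
Qed.

(** Multiplying by the [exp (- M ccosh (beta (w_j - c_j)))], where [c_j] has real
    part [X_j] and imaginary part [(a_j + b_j) / 2], turns the double exponential
    growth allowed on the distinguished boundary into a constant bound there.
    At the real parts [X_j] these factors are at least [exp (- M)]. *)
Lemma phragmen_lindelof N (C : {ffun 'I_d -> 'I_N} -> R[i])
    (X a b tau : 'I_d -> R) (beta M kappa A L : R) :
  0 <= L -> 0 <= M -> 0 <= A ->
  (forall j, a j <= tau j <= b j) ->
  (forall j y, a j <= y <= b j ->
     kappa <= cos (beta * (y - (a j + b j) / 2))) ->
  (forall x y : 'I_d -> R,
     (forall j, `|x j - X j| <= L) -> (forall j, a j <= y j <= b j) ->
     (forall j, [\/ y j = a j, y j = b j | `|x j - X j| = L]) ->
     nc (mpol C (fun j => cexp (Complex (x j) (y j))))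
     <= A * expR (M * kappa * \sum_j coshr (beta * (x j - X j)))) ->
  nc (mpol C (fun j => cexp (Complex (X j) (tau j)))) <= A * expR (M * d%:R).
Proof.
move=> L0 M0 A0 tauab hk hbd.
pose psi j : R := (a j + b j) / 2.
pose W (w : R[i]) j := ccosh (beta%:C%C * (w - Complex (X j) (psi j))).
pose F (w : 'I_d -> R[i]) := mpol C (fun j => cexp (w j)) *
  \prod_j cexp (- (M%:C%C * W (w j) j)).
have ReW x y j : complex.Re (- (M%:C%C * W (Complex x y) j)) =
    - (M * (coshr (beta * (x - X j)) * cos (beta * (y - psi j)))).
  by rewrite ReN ReZ /W Re_ccosh ReZ ImZ.
have eF w j : expand2 (fun z => F (update w j z)).
  rewrite /F /mpol /W /update /ccosh; apply: expand2M.
    apply: expand2_sum => al; apply: expand2M; first exact: expand2_cst.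
    apply: expand2_prod => i; apply: expand2X.
    case: (i == j); last exact: expand2_cst.
    exact: expand2_cexp expand2_id.
  apply: expand2_prod => i; case: (i == j); last exact: expand2_cst.
  apply: expand2_cexp; apply: expand2N.
  apply: expand2M; first exact: expand2_cst.
  have eL : expand2 (fun z : R[i] => beta%:C%C * (z - Complex (X i) (psi i))).
    apply: expand2M; first exact: expand2_cst.
    by apply: expand2D; [exact: expand2_id|exact: expand2_cst].
  apply: expand2M; last exact: expand2_cst.
  apply: expand2D; first exact: expand2_cexp.
  by apply: expand2_cexp; exact: expand2N.
have hF : nc (F (fun j => Complex (X j) (tau j))) <= A.
  apply: (@maximum_modulus_polyrectangle F (fun j => X j - L) (fun j => X j + L)
    a b A eF _ X tau) => //; last first.
    by move=> j; rewrite lerBlDr !lerDl L0.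
  move=> x y hx hy hb; rewrite /F Normc.normcM nc_prod.
  have xXL j : `|x j - X j| <= L by rewrite ler_distl; exact: hx.
  have {}hb j : [\/ y j = a j, y j = b j | `|x j - X j| = L].
    case: (hb j) => [xX|xX|yX|yX]; [constructor 3|constructor 3|
      by constructor 1|by constructor 2].
    - by rewrite xX addrAC subrr add0r normrN ger0_norm.
    - by rewrite xX addrAC subrr add0r ger0_norm.
  apply: (le_trans (ler_wpM2r _ (hbd x y xXL hy hb))).
    by apply: prodr_ge0 => j _; exact: nc_ge0.
  rewrite -[leLHS]mulrA ler_piMr//.
  under eq_bigr do rewrite nc_cexp ReW.
  rewrite -expR_sum -expRD -[leRHS]expR0 ler_expR mulr_sumr -big_split/=.
  apply: sumr_le0 => j _; rewrite subr_le0 -mulrA ler_wpM2l//.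
  by rewrite mulrC ler_wpM2l ?(le_trans ler01) ?coshr_ge1// hk.
move: hF; rewrite /F Normc.normcM nc_prod.
under eq_bigr do rewrite nc_cexp ReW subrr mulr0 {1}/coshr oppr0 expR0.
rewrite -expR_sum sumrN expRN ler_pdivrMr ?expR_gt0// => /le_trans; apply.
have -> : d%:R = \sum_(j < d) 1 :> R by rewrite sumr_const card_ord.
rewrite ler_wpM2l// ler_expR mulr_sumr.
apply: ler_sum => j _; rewrite ler_wpM2l//.
by rewrite divff ?pnatr_eq0// mul1r cos_le1.
Qed.

End phragmen_lindelof.

(** * Cauchy's estimates *)

Section cauchy_estimate.
Context {R : realType} {d : nat}.

Lemma cexp_imagD (x y : R) :
  cexp (Complex 0 (x + y)) = cexp (Complex 0 x) * cexp (Complex 0 y) :> R[i].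
Proof.
rewrite -cexpD; congr cexp; apply/eqP.
by rewrite eq_complex ReD ImD/= addr0 !eqxx.
Qed.

Lemma cexp_imagX (x : R) n :
  cexp (Complex 0 x) ^+ n = cexp (Complex 0 (x * n%:R)) :> R[i].
Proof.
elim: n => [|n ih]; first by rewrite mulr0 expr0 cexp0.
by rewrite exprS ih -cexp_imagD -natr1 mulrDr mulr1 addrC.
Qed.

Lemma cexp_imag_neq1 (x : R) : 0 < `|x| < 2 * pi -> cexp (Complex 0 x) != 1.
Proof.
move=> /andP[x0 x2]; rewrite eq_complex negb_and/= expR0 mul1r.
apply/orP; left; rewrite -cos_norm.
have -> : `|x| = (`|x| / 2) *+ 2 by rewrite -mulr_natr divfK// pnatr_eq0.
rewrite cos_mulr2n cos2sin2.
have : 0 < sin (`|x| / 2).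
  by apply: sin_gt0_pi; rewrite divr_gt0//= ltr_pdivrMr// mulrC.
move=> s0; rewrite lt_eqF//.
have : 0 < sin (`|x| / 2) ^+ 2 by rewrite exprn_gt0.
lra.
Qed.

Lemma sum_root_of_unity N (m n : 'I_N) :
  \sum_(k < N) cexp (Complex 0 (2 * pi / N%:R * k%:R * (m%:R - n%:R))) =
  (m == n)%:R * N%:R :> R[i].
Proof.
have N0 : (0 < N)%N by rewrite (leq_ltn_trans _ (ltn_ord m)).
have NR0 : 0 < N%:R :> R by rewrite ltr0n.
pose q : R := 2 * pi / N%:R.
have q0 : 0 < q by rewrite divr_gt0 ?mulr_gt0 ?pi_gt0.
have [->|mn] := eqVneq m n.
  under eq_bigr do rewrite subrr mulr0 cexp0.
  by rewrite sumr_const card_ord mul1r.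
rewrite mul0r; pose r : R[i] := cexp (Complex 0 (q * (m%:R - n%:R))).
under eq_bigr do rewrite mulrAC -cexp_imagX -/r.
have r1 : r != 1.
  apply: cexp_imag_neq1; rewrite normrM (ger0_norm (ltW q0)).
  have mn0 : (m%:R - n%:R : R) != 0.
    by rewrite subr_eq0 eqr_nat; apply: contra mn => /eqP mn; apply/eqP/val_inj.
  rewrite mulr_gt0 ?normr_gt0//= /q mulrAC ltr_pdivrMr//.
  rewrite ltr_pM2l ?mulr_gt0 ?pi_gt0//.
  have := ltn_ord m; have := ltn_ord n; rewrite -!(@ltr_nat R) => nN mN.
  have := ler0n R m; have := ler0n R n => n0 m0.
  by rewrite ltr_norml; apply/andP; split; lra.
have rN : r ^+ N = 1.
  have c1 (e : R) : e = 1 \/ e = -1 -> cexp (Complex 0 (e * (2 * pi))) = 1 :> R[i].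
    rewrite /cexp/= expR0 !mul1r mulr_natl => -[] ->.
      by rewrite !mul1r cos2pi sin2pi.
    by rewrite !mulN1r cosN sinN cos2pi sin2pi oppr0.
  rewrite cexp_imagX; have -> : q * (m%:R - n%:R) * N%:R =
    1 * (2 * pi) * m%:R + (-1) * (2 * pi) * n%:R.
    by rewrite /q; field; rewrite gt_eqF.
  by rewrite cexp_imagD -!cexp_imagX !c1 ?expr1n ?mulr1//; [right|left].
have := subrX1 r N; rewrite rN subrr => /esym/eqP.
by rewrite mulf_eq0 subr_eq0 (negbTE r1) => /eqP.
Qed.

(** The coefficients of a polynomial are recovered by averaging over the
    products of [N]-th roots of unity. *)
Lemma mpol_coef_le N (C : {ffun 'I_d -> 'I_N} -> R[i]) (X : 'I_d -> R) (B : R) :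
  (forall tau : 'I_d -> R,
     nc (mpol C (fun j => cexp (Complex (X j) (tau j)))) <= B) ->
  forall a, nc (C a) * \prod_j expR (X j) ^+ a j <= B.
Proof.
move=> hB a.
pose tau (k : {ffun 'I_d -> 'I_N}) j : R := 2 * pi / N%:R * (k j)%:R.
pose ch k : R[i] := \prod_j cexp (Complex 0 (- (tau k j * (a j)%:R))).
have avg (b : {ffun 'I_d -> 'I_N}) :
    \sum_k (\prod_j cexp (Complex (X j) (tau k j)) ^+ b j) * ch k =
    (\prod_j cexp (Complex (X j) 0) ^+ b j)
      * \prod_j ((b j == a j)%:R * N%:R).
  under [X in _ * X]eq_bigr do rewrite -sum_root_of_unity.
  rewrite bigA_distr_bigA mulr_sumr; apply: eq_bigr => k _.
  rewrite /ch -!big_split/=; apply: eq_bigr => j _.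
  have -> : Complex (X j) (tau k j) = Complex (X j) 0 + Complex 0 (tau k j).
    by apply/eqP; rewrite eq_complex ReD ImD/= addr0 add0r !eqxx.
  rewrite cexpD exprMn (cexp_imagX (tau k j)) -mulrA -cexp_imagD mulrBr.
  by rewrite -/(tau k j).
have E : \sum_k mpol C (fun j => cexp (Complex (X j) (tau k j))) * ch k =
    C a * (\prod_j cexp (Complex (X j) 0) ^+ a j) * (N ^ d)%:R.
  under [LHS]eq_bigr do rewrite /mpol mulr_suml.
  rewrite exchange_big/=.
  under eq_bigr => b _.
    under eq_bigr do rewrite -mulrA.
    rewrite -mulr_sumr avg.
    over.
  rewrite (bigD1 a)//= [X in _ + X]big1 ?addr0 => [|b ba].
    under [\prod_j (_ * _)]eq_bigr do rewrite eqxx mul1r.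
    by rewrite prodr_const card_ord natrX mulrA.
  have [j baj] : exists j, b j != a j.
    apply/existsP; apply: contraR ba => /existsPn h.
    by apply/eqP/ffunP => j; apply/eqP; have := h j; rewrite negbK.
  by rewrite [X in _ * (_ * X)](bigD1 j)//= (negbTE baj) !mul0r !mulr0.
have Nd0 : (0 < N ^ d)%N.
  case: (posnP d) => [d0|d0]; first by rewrite d0.
  by rewrite expn_gt0 (leq_ltn_trans _ (ltn_ord (a (Ordinal d0)))).
have : nc (\sum_k mpol C (fun j => cexp (Complex (X j) (tau k j))) * ch k)
    <= B * (N ^ d)%:R.
  apply: (le_trans (nc_sum _ _ _)).
  have -> : B * (N ^ d)%:R = \sum_(k : {ffun 'I_d -> 'I_N}) B.
    by rewrite sumr_const card_ffun !card_ord mulr_natr.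
  apply: ler_sum => k _; rewrite Normc.normcM /ch nc_prod.
  by rewrite big1 ?mulr1// => j _; rewrite nc_cexp expR0.
rewrite E !Normc.normcM nc_nat nc_prod ler_pM2r ?ltr0n//.
by under eq_bigr do rewrite ncX nc_cexp.
Qed.

End cauchy_estimate.

(** * Hermite polynomials *)

Section hermite_poly.
Context {R : realType}.
Implicit Types (y : R) (n : nat).

Fixpoint herm n : {poly R} :=
  if n is n'.+1 then (2 *: 'X) * herm n' - (herm n')^`() else 1.

Lemma herm1E : herm 1 = 2 *: 'X.
Proof. by rewrite [herm 1]/= mulr1 -polyC1 derivC subr0. Qed.

Lemma deriv_herm n : (herm n)^`() = (2 * n%:R) *: herm n.-1.
Proof.
elim: n => [|n ih]; first by rewrite /= -polyC1 derivC mulr0 scale0r.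
case: n ih => [|n] ih.
  by rewrite herm1E derivZ derivX mulr1.
rewrite [herm n.+2]/= derivB derivM derivZ derivX ih derivZ.
rewrite -scalerAl mul1r -scalerAr -addrA -scalerBr.
rewrite (_ : _ - _ = herm n.+1)// -scalerDl; congr (_ *: _).
by rewrite -[in RHS]natr1; ring.
Qed.

Lemma hermSS n y :
  (herm n.+2).[y] = 2 * y * (herm n.+1).[y] - 2 * n.+1%:R * (herm n).[y].
Proof.
rewrite [herm n.+2]/= hornerD hornerN -/(herm n.+1) deriv_herm hornerM.
by rewrite !hornerZ hornerX.
Qed.

Lemma herm1 y : (herm 1).[y] = 2 * y.
Proof. by rewrite herm1E hornerZ hornerX. Qed.

(** The norm of [herm n] in the Gaussian-weighted [L^2], up to the constant
    [pi ^ (1/4)]. *)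
Definition hnorm n : R := Num.sqrt (2 ^+ n * n`!%:R).

Lemma hnorm_gt0 n : 0 < hnorm n.
Proof. by rewrite sqrtr_gt0 mulr_gt0 ?exprn_gt0// ltr0n fact_gt0. Qed.

Lemma sqr_hnorm n : hnorm n ^+ 2 = 2 ^+ n * n`!%:R.
Proof. by rewrite sqr_sqrtr// mulr_ge0 ?exprn_ge0. Qed.

Lemma hnormS n : hnorm n.+1 = Num.sqrt 2 * Num.sqrt n.+1%:R * hnorm n.
Proof.
rewrite /hnorm factS natrM exprS -!sqrtrM ?mulr_ge0//; congr Num.sqrt; ring.
Qed.

Let pwf (a : R) k : R := a ^+ k / Num.sqrt k`!%:R.

Let pwf_ge0 a k : 0 <= a -> 0 <= pwf a k.
Proof. by move=> a0; rewrite divr_ge0 ?exprn_ge0// sqrtr_ge0. Qed.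

Let pwfS a k m : 0 <= a -> (k <= m)%N ->
  a / Num.sqrt m.+1%:R * pwf a k <= pwf a k.+1.
Proof.
move=> a0 km; rewrite /pwf exprS factS natrM sqrtrM// invfM.
rewrite mulrAC mulrA [leRHS]mulrCA [leRHS]mulrC.
rewrite ler_wpM2l ?mulr_ge0 ?invr_ge0 ?sqrtr_ge0 ?exprn_ge0//.
by rewrite lef_pV2 ?posrE ?sqrtr_gt0 ?ltr0n// ler_sqrt ?ler_nat.
Qed.

(** By the three-term recurrence. The factor [2 ^ n] absorbs the loss of
    replacing a sum by twice a maximum at each step. *)
Lemma herm_le n y : exists2 k, (k <= n)%N &
  `|(herm n).[y]| <= hnorm n * 2 ^+ n
    * ((Num.sqrt 2 * `|y|) ^+ k / Num.sqrt k`!%:R).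
Proof.
set a := Num.sqrt 2 * `|y|; rewrite -/(pwf a _).
have a0 : 0 <= a by rewrite mulr_ge0// sqrtr_ge0.
have s22 : Num.sqrt 2 * Num.sqrt 2 = 2 :> R by rewrite -expr2 sqr_sqrtr.
suff : (exists2 k, (k <= n)%N & `|(herm n).[y]| <= hnorm n * 2 ^+ n * pwf a k)
  /\ (exists2 k, (k <= n.+1)%N &
       `|(herm n.+1).[y]| <= hnorm n.+1 * 2 ^+ n.+1 * pwf a k) by case.
elim: n => [|n [[k kn hk] [l ln hl]]].
  split.
    by exists 0%N; rewrite // /pwf /hnorm /= hornerC normr1 !expr0 !mulr1 fact0
      sqrtr1 divr1 mulr1.
  exists 1%N => //; rewrite herm1 normrM ger0_norm// hnormS /hnorm /pwf fact0.
  rewrite expr0 !expr1 (_ : 1`! = 1)%N// !mulr1 !sqrtr1 !mulr1 divr1.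
  rewrite /a; have := normr_ge0 y; set z := `|y|.
  have -> : Num.sqrt 2 * 2 * (Num.sqrt 2 * z) =
    2 * (Num.sqrt 2 * Num.sqrt 2) * z :> R by ring.
  rewrite s22; lra.
split; first by exists l.
pose m := if pwf a k <= pwf a l.+1 then l.+1 else k.
have [mk ml] : pwf a k <= pwf a m /\ pwf a l.+1 <= pwf a m.
  by rewrite /m; have [h|/ltW h] := leP (pwf a k) (pwf a l.+1).
exists m; first by rewrite /m; case: ifP => _; rewrite ?ltnS// !leqW.
rewrite hermSS (le_trans (ler_normB _ _))// !normrM (@ger0_norm _ n.+1%:R)//.
rewrite (@ger0_norm _ 2)//.
have h2 : hnorm n.+2 = Num.sqrt 2 * Num.sqrt n.+2%:R * hnorm n.+1 by rewrite hnormS.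
have h3 : 2 * n.+1%:R * hnorm n <= hnorm n.+2.
  rewrite hnormS hnormS mulrA ler_wpM2r ?(ltW (hnorm_gt0 _))//.
  have -> : Num.sqrt 2 * Num.sqrt n.+2%:R * (Num.sqrt 2 * Num.sqrt n.+1%:R) =
    (Num.sqrt 2 * Num.sqrt 2) * (Num.sqrt n.+2%:R * Num.sqrt n.+1%:R) :> R by ring.
  rewrite s22 ler_wpM2l//.
  rewrite -{1}[n.+1%:R]sqr_sqrtr// expr2 ler_wpM2r ?sqrtr_ge0//.
  by rewrite ler_sqrt// ler_nat.
have p1 : 2 * `|y| * `|(herm n.+1).[y]| <= hnorm n.+2 * 2 ^+ n.+1 * pwf a m.
  apply: (@le_trans _ _ (2 * `|y| * (hnorm n.+1 * 2 ^+ n.+1 * pwf a l))).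
    by rewrite ler_wpM2l// mulr_ge0.
  apply: (@le_trans _ _ (hnorm n.+2 * 2 ^+ n.+1 *
    (a / Num.sqrt n.+2%:R * pwf a l))); last first.
    rewrite ler_wpM2l ?(le_trans (pwfS _ _) ml)//.
    by rewrite mulr_ge0 ?exprn_ge0// ltW// hnorm_gt0.
  rewrite h2 /a le_eqVlt; apply/orP; left; apply/eqP.
  have sn0 : Num.sqrt n.+2%:R != 0 :> R by rewrite gt_eqF// sqrtr_gt0 ltr0n.
  rewrite -{1}s22; field.
  exact: sn0.
have p2 : 2 * n.+1%:R * `|(herm n).[y]| <= hnorm n.+2 * 2 ^+ n * pwf a m.
  apply: (@le_trans _ _ (2 * n.+1%:R * (hnorm n * 2 ^+ n * pwf a k))).
    by rewrite ler_wpM2l// mulr_ge0.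
  have -> : 2 * n.+1%:R * (hnorm n * 2 ^+ n * pwf a k) =
    2 * n.+1%:R * hnorm n * (2 ^+ n * pwf a k) by ring.
  rewrite -[leRHS]mulrA.
  rewrite ler_pM ?mulr_ge0 ?exprn_ge0 ?pwf_ge0 ?(ltW (hnorm_gt0 _))//.
  by rewrite ler_wpM2l// exprn_ge0.
apply: (le_trans (lerD p1 p2)); rewrite -mulrDl ler_wpM2r ?pwf_ge0//.
rewrite -mulrDr ler_wpM2l ?(ltW (hnorm_gt0 _))// !exprS.
have : 0 <= 2 ^+ n :> R by rewrite exprn_ge0.
lra.
Qed.

Lemma expr_div_fact_le (x : R) n : 0 <= x -> x ^+ n / n`!%:R <= expR x.
Proof.
move=> x0; case: n => [|n].
  by rewrite expr0 fact0 divr1 (le_trans _ (expR_ge1Dx x))// lerDl.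
by rewrite (le_trans _ (expR_ge1Dxn n x0))// lerDr.
Qed.

Lemma expr_div_sqrt_fact_le (e b : R) n : 0 < e -> 0 <= b ->
  b ^+ n / Num.sqrt n`!%:R <= e ^- n * expR ((e * b) ^+ 2 / 2).
Proof.
move=> e0 b0; rewrite mulrC ler_pdivlMl ?exprn_gt0//.
have f0 : 0 < n`!%:R :> R by rewrite ltr0n fact_gt0.
have E : e ^+ n * (b ^+ n / Num.sqrt n`!%:R) =
    Num.sqrt (((e * b) ^+ 2) ^+ n / n`!%:R).
  rewrite (sqrtrM (n`!%:R)^-1) ?(exprn_ge0 _ (sqr_ge0 _))//.
  rewrite sqrtrV ?(ltW f0)// exprAC sqrtr_sqr.
  by rewrite ger0_norm ?exprn_ge0 ?mulr_ge0 ?(ltW e0)// exprMn mulrA.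
rewrite [X in X <= _](_ : _ = Num.sqrt (((e * b) ^+ 2) ^+ n / n`!%:R)); last first.
  by rewrite -E; ring.
have -> : expR ((e * b) ^+ 2 / 2) = Num.sqrt (expR ((e * b) ^+ 2)).
  rewrite {2}(_ : (e * b) ^+ 2 = (e * b) ^+ 2 / 2 *+ 2).
    by rewrite mulr2n expRD -expr2 sqrtr_sqr ger0_norm// expR_ge0.
  by rewrite -mulr_natr divfK// pnatr_eq0.
by rewrite ler_sqrt ?expR_gt0// expr_div_fact_le// sqr_ge0.
Qed.

(** The terms of the generating function decay geometrically, at the price of
    an arbitrarily small Gaussian factor. *)
Lemma herm_term_le (e c rho : R) : 0 < e <= 1 -> 0 < c -> 0 <= rho ->
  exists2 D, 0 <= D & forall n y t, 0 <= t <= rho ->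
  `|(herm n).[y]| * t ^+ n / n`!%:R <= c ^+ n * D * expR (e * y ^+ 2).
Proof.
move=> /andP[e0 e1] c0 rho0.
have se0 : 0 < Num.sqrt e by rewrite sqrtr_gt0.
have se1 : Num.sqrt e <= 1 by rewrite -sqrtr1 ler_sqrt.
have sse : Num.sqrt e ^+ 2 = e by rewrite sqr_sqrtr// ltW.
pose q := 2 * Num.sqrt 2 / Num.sqrt e * rho.
have q0 : 0 <= q.
  by rewrite /q mulr_ge0// divr_ge0 ?sqrtr_ge0// mulr_ge0// sqrtr_ge0.
exists (expR ((c^-1 * q) ^+ 2 / 2)); first exact: expR_ge0.
move=> n y t /andP[t0 trho].
have [k kn hk] := herm_le n y.
have f0 : 0 < n`!%:R :> R by rewrite ltr0n fact_gt0.
have s2y0 : 0 <= Num.sqrt 2 * `|y| by rewrite mulr_ge0// sqrtr_ge0.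
have h1 : (Num.sqrt 2 * `|y|) ^+ k / Num.sqrt k`!%:R <=
    Num.sqrt e ^- n * expR (e * y ^+ 2).
  apply: (le_trans (expr_div_sqrt_fact_le k se0 s2y0)).
  have -> : (Num.sqrt e * (Num.sqrt 2 * `|y|)) ^+ 2 / 2 = e * y ^+ 2.
    by rewrite !exprMn sse sqr_sqrtr// real_normK ?num_real//; field.
  rewrite ler_wpM2r ?expR_ge0// lef_pV2 ?posrE ?exprn_gt0//.
  by rewrite ler_wiXn2l// ltW.
have h2 : hnorm n / n`!%:R = Num.sqrt 2 ^+ n / Num.sqrt n`!%:R.
  have s2n : Num.sqrt (2 ^+ n) = Num.sqrt 2 ^+ n :> R.
    by rewrite -[in LHS](@sqr_sqrtr _ 2)// exprAC sqrtr_sqr ger0_norm.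
  rewrite /hnorm sqrtrM ?exprn_ge0// s2n -mulrA; congr (_ * _).
  rewrite -{2}[n`!%:R](@sqr_sqrtr _ n`!%:R) ?(ltW f0)//.
  by field; rewrite gt_eqF// sqrtr_gt0.
apply: (@le_trans _ _ (hnorm n * 2 ^+ n *
    (Num.sqrt e ^- n * expR (e * y ^+ 2)) * rho ^+ n / n`!%:R)).
  rewrite ler_wpM2r ?invr_ge0 ?(ltW f0)//.
  rewrite ler_pM ?exprn_ge0//; last by rewrite lerXn2r ?nnegrE.
  by apply: (le_trans hk); rewrite ler_wpM2l// mulr_ge0 ?exprn_ge0// ltW// hnorm_gt0.
have -> : hnorm n * 2 ^+ n * (Num.sqrt e ^- n * expR (e * y ^+ 2)) * rho ^+ n
    / n`!%:R = (q ^+ n / Num.sqrt n`!%:R) * expR (e * y ^+ 2).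
  rewrite /q !exprMn exprVn.
  have -> : forall x y z v w s : R, x * y * (z * v) * w * s =
    (x * s) * y * z * w * v by move=> *; ring.
  by rewrite h2; ring.
rewrite ler_wpM2r ?expR_ge0//.
have := @expr_div_sqrt_fact_le c^-1 q n; rewrite invr_gt0 c0 => /(_ isT q0).
by rewrite exprVn invrK.
Qed.

End hermite_poly.

(** * The generating function of the Hermite polynomials *)

Section hermite_generating.
Context {R : realType}.
Implicit Types (y : R) (n N : nat) (t : R[i]).

Let hc n y : R[i] := ((herm n).[y] / n`!%:R)%:C%C.

Definition hgen N y t : R[i] :=
  \sum_(n < N) ((herm n).[y] / n`!%:R)%:C%C * t ^+ n.

Let hgen' N y t : R[i] := \sum_(n < N) hc n y * (n%:R * t ^+ n.-1).

(** The full series solves [G' = 2 (y - t) G]; truncating it leaves only two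
    terms of top degree, by the three-term recurrence. *)
Lemma hgen_ode N y t : hgen' N.+1 y t + (2 * t - 2 * y%:C%C) * hgen N.+1 y t =
  - (N.+1%:R * hc N.+1 y * t ^+ N) + 2 * hc N y * t ^+ N.+1.
Proof.
rewrite /hgen' /hgen; elim: N => [|N ih].
  rewrite !big_ord_recl !big_ord0 /hc herm1 /= hornerC fact0 (_ : 1`! = 1)%N//.
  by rewrite !divr1 rmorphM rmorph1 rmorph_nat; ring.
rewrite big_ord_recr [X in _ + _ * X]big_ord_recr/= mulrDr addrACA ih.
rewrite -/(hc N.+1 y).
have -> : N.+2%:R * hc N.+2 y = 2 * y%:C%C * hc N.+1 y - 2 * hc N y.
  rewrite /hc -!(rmorph_nat (real_complex R)) -!rmorphM -rmorphB; congr (_%:C%C).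
  rewrite hermSS !factS !natrM; field.
  by rewrite !gt_eqF ?ltr0n ?fact_gt0 ?ltr_wpDr.
by rewrite !exprS; ring.
Qed.

Let hgen_deriv N y t (s : R) :
  cderiv (fun s => hgen N y (s%:C%C * t)) s (t * hgen' N y (s%:C%C * t)).
Proof.
have := cderiv_sum (fun n : 'I_N => cderivZ (hc n y) (cderivX n (cderiv_ray t s))).
by move/cderiv_eq; apply; rewrite /hgen' mulr_sumr; apply: eq_bigr => n _; ring.
Qed.

(** Integrate the derivative of [G exp(t^2 - 2 y t)] along the ray from [0] to
    [t]; it would vanish for the full series, whose sum is therefore
    [exp (2 y t - t^2)]. *)
Lemma hgen_le (rho : R) : 0 <= rho -> exists2 D, 0 <= D & forall N y t,
  nc t <= rho -> nc (hgen N.+1 y t) <=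
    expR (complex.Re (2 * y%:C%C * t - t ^+ 2))
    + 2 ^- N * D * expR (y ^+ 2 / 8).
Proof.
move=> rho0.
have [||E E0 hE] := @herm_term_le R (16^-1) (4^-1) rho _ _ rho0.
- by rewrite invr_gt0 invf_le1//= ltr0n ler1n.
- by rewrite invr_gt0.
exists ((1 + 8 * rho ^+ 2) * E * expR (66 * rho ^+ 2)).
  by rewrite !mulr_ge0 ?expR_ge0// addr_ge0 ?mulr_ge0 ?sqr_ge0.
move=> N y t ht.
have nt0 := nc_ge0 t.
pose Q (s : R) := hgen N.+1 y (s%:C%C * t)
  * cexp ((s%:C%C * t) * (s%:C%C * t) - 2 * y%:C%C * (s%:C%C * t)).
pose ur n := `|(herm n).[y]| * nc t ^+ n / n`!%:R.
have hu n : ur n <= 4^-1 ^+ n * E * expR (16^-1 * y ^+ 2).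
  by apply: hE; rewrite nt0.
pose e2 := expR (nc t ^+ 2 + 2 * `|y| * nc t).
pose dQ (s : R) := t * ((- (N.+1%:R * hc N.+1 y * (s%:C%C * t) ^+ N)
    + 2 * hc N y * (s%:C%C * t) ^+ N.+1)
  * cexp ((s%:C%C * t) * (s%:C%C * t) - 2 * y%:C%C * (s%:C%C * t))).
have hQ : nc (Q 1 - Q 0) <= (N.+1%:R * ur N.+1 + 2 * nc t ^+ 2 * ur N) * e2.
  apply: (@cderiv_mean_value _ _ dQ) => s s01.
    have h := cderiv_ray t s.
    apply: cderiv_eq (cderivM (hgen_deriv N.+1 y t s)
      (cderiv_cexp (cderivB (cderivM h h) (cderivZ (2 * y%:C%C) h)))) _.
    by rewrite /dQ -hgen_ode; ring.
  have nhc n : nc (hc n y) = `|(herm n).[y]| / n`!%:R.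
    by rewrite nc_real normrM normfV (@ger0_norm _ n`!%:R).
  have nst := nc_ray_le t s01.
  have nst0 := nc_ge0 (s%:C%C * t).
  rewrite /dQ Normc.normcM [X in _ * X]Normc.normcM mulrA.
  rewrite ler_pM ?mulr_ge0 ?nc_ge0//.
    apply: (le_trans (ler_wpM2l nt0 (ncD _ _))); rewrite mulrDr ncN lerD//.
      rewrite 2!Normc.normcM ncX nhc nc_nat /ur.
      apply: (@le_trans _ _ (nc t * (N.+1%:R *
          (`|(herm N.+1).[y]| / N.+1`!%:R) * nc t ^+ N))).
        by rewrite ler_wpM2l// ler_wpM2l ?lerXn2r ?nnegrE// mulr_ge0// divr_ge0.
      by rewrite le_eqVlt exprS; apply/orP; left; apply/eqP; ring.
    rewrite 2!Normc.normcM ncX nhc nc_nat /ur.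
    apply: (@le_trans _ _ (nc t * (2 *
        (`|(herm N).[y]| / N`!%:R) * nc t ^+ N.+1))).
      by rewrite ler_wpM2l// ler_wpM2l ?lerXn2r ?nnegrE// mulr_ge0// divr_ge0.
    by rewrite le_eqVlt exprS; apply/orP; left; apply/eqP; ring.
  rewrite nc_cexp ler_expR (le_trans (ler_norm _))// (le_trans (Re_le_nc _))//.
  rewrite (le_trans (ncB _ _))// lerD//.
    by rewrite Normc.normcM expr2 ler_pM.
  rewrite 2!Normc.normcM nc_real nc_nat ler_wpM2l// mulr_ge0//.
pose z := 2 * y%:C%C * t - t ^+ 2.
have Q0 : Q 0 = 1.
  rewrite /Q mul0r mul0r mulr0 subr0 cexp0 mulr1 /hgen big_ord_recl.
  rewrite big1 => [|n _]; last by rewrite expr0n mulr0.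
  by rewrite /= hornerC fact0 divr1 mulr1 addr0.
have GE : hgen N.+1 y t = Q 1 * cexp z.
  rewrite /Q mul1r -mulrA -cexpD /z.
  rewrite (_ : _ + _ = 0) ?cexp0 ?mulr1//; ring.
rewrite GE Normc.normcM nc_cexp -[X in X * _](_ : nc (1 + (Q 1 - Q 0)) = _);
  last by rewrite Q0 subrKC.
apply: (le_trans (ler_wpM2r (expR_ge0 _) (ncD _ _))).
rewrite Normc.normc1 mulrDl mul1r lerD2l.
have hz : complex.Re z <= nc t ^+ 2 + 2 * `|y| * nc t.
  rewrite (le_trans (ler_norm _))// (le_trans (Re_le_nc _))// /z.
  by rewrite (le_trans (ncB _ _))// ncX 2!Normc.normcM nc_real nc_nat addrC.
have hez : expR (complex.Re z) <= e2 by rewrite ler_expR.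
apply: (le_trans (ler_pM (nc_ge0 _) (expR_ge0 _) hQ hez)).
set X := _ + _ * ur N.
have hX : X <= 2 ^- N * (1 + 8 * rho ^+ 2) * (E * expR (16^-1 * y ^+ 2)).
  set W := E * _; have W0 : 0 <= W by rewrite mulr_ge0 ?expR_ge0.
  have hu' n : ur n <= 4^-1 ^+ n * W by rewrite /W mulrA.
  have p2 : 0 < 2 ^- N :> R by rewrite invr_gt0 exprn_gt0.
  have hN : N.+1%:R * (4^-1 : R) ^+ N.+1 <= 2 ^- N.
    have -> : (4 : R) = 2 ^+ 2 by rewrite -natrX.
    rewrite exprVn -exprM mul2n -addnn exprD invfM mulrA.
    rewrite -[leRHS]mul1r; apply: ler_pM.
    - by rewrite divr_ge0 ?exprn_ge0.
    - by rewrite invr_ge0 exprn_ge0.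
    - by rewrite ler_pdivrMr ?exprn_gt0// mul1r -natrX ler_nat ltnW// ltn_expl.
    - by rewrite lef_pV2 ?posrE ?exprn_gt0// ler_weXn2l// ?ler1n// leqnSn.
  have h4 : (4^-1 : R) ^+ N <= 2 ^- N.
    by rewrite exprVn lef_pV2 ?posrE ?exprn_gt0// lerXn2r ?nnegrE// ler_nat.
  have ht2 : nc t ^+ 2 <= rho ^+ 2 by rewrite lerXn2r ?nnegrE.
  rewrite mulrDr mulr1 mulrDl; apply: lerD.
    apply: (le_trans (ler_wpM2l _ (hu' _))) => //.
    by rewrite mulrA ler_wpM2r.
  apply: (@le_trans _ _ ((2 * rho ^+ 2) * (2 ^- N * W))).
    rewrite ler_pM ?mulr_ge0 ?sqr_ge0 ?divr_ge0 ?exprn_ge0//.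
      by rewrite ler_wpM2l.
    by apply: (le_trans (hu' _)); rewrite ler_wpM2r.
  have -> : 2 ^- N * (8 * rho ^+ 2) * W = 8 * rho ^+ 2 * (2 ^- N * W) by ring.
  rewrite ler_wpM2r ?mulr_ge0 ?(ltW p2)// ler_wpM2r ?sqr_ge0// ler_nat//.
have he : e2 * e2 <= expR (66 * rho ^+ 2) * expR (y ^+ 2 / 16).
  rewrite -!expRD ler_expR.
  have : nc t ^+ 2 <= rho ^+ 2 by rewrite lerXn2r ?nnegrE.
  have : `|y| * nc t <= `|y| * rho by rewrite ler_wpM2l.
  have : y ^+ 2 = `|y| ^+ 2 by rewrite real_normK ?num_real.
  have := sqr_ge0 (`|y| / 4 - 8 * rho).
  rewrite sqrrB; nra.
rewrite -[leLHS]mulrA; apply: (le_trans (ler_wpM2l _ he)).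
  by rewrite addr_ge0 ?mulr_ge0 ?sqr_ge0 ?divr_ge0 ?mulr_ge0 ?exprn_ge0.
have -> : expR (y ^+ 2 / 8) = expR (16^-1 * y ^+ 2) * expR (y ^+ 2 / 16).
  by rewrite -expRD; congr expR; field.
rewrite mulrA; apply: (le_trans (ler_wpM2r (expR_ge0 _) (ler_wpM2r (expR_ge0 _) hX))).
by rewrite le_eqVlt; apply/orP; left; apply/eqP; ring.
Qed.

End hermite_generating.

(** * Integration of products over [R^n] *)

Section integral_rV.
Context {R : realType}.
Local Notation leb := (@lebesgue_measure R).

Lemma measurable_rV_prod n (f : 'I_n -> R -> R) :
  (forall j, measurable_fun setT (f j)) ->
  measurable_fun setT (fun x : 'rV[R]_n => \prod_j f j (x ord0 j)).
Proof.
move=> mf; apply: measurable_prod => j _.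
exact: (measurableT_comp (mf j) (measurable_coord j)).
Qed.

(** Fubini's theorem along [rV_cons], one coordinate at a time. *)
Lemma integral_rV_prod n (f : 'I_n -> R -> R) :
  (forall j, leb.-integrable setT (EFin \o f j)) ->
  (lebesgue_rV n).-integrable setT
    (fun x : 'rV[R]_n => (\prod_j f j (x ord0 j))%:E) /\
  (\int[lebesgue_rV n]_x (\prod_j f j (x ord0 j))%:E)%E =
    (\prod_j \int[leb]_x f j x)%:E.
Proof.
elim: n f => [|n ih] f fi.
  under eq_integral do rewrite big_ord0.
  rewrite (_ : (fun x : 'rV[R]_0 => _) = cst 1%:E); last first.
    by apply/funext => x; rewrite big_ord0.
  rewrite big_ord0 /= integral_dirac//= ?diracE ?mem_set// ?mul1e; split => //.
  by apply/integrableP; split => //; rewrite integral_dirac//= diracE mem_set//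
    mul1e normr1 ltry.
have [gi gE] := ih (fun j => f (lift ord0 j)) (fun j => fi _).
set g := (fun y : 'rV[R]_n => _) in gi gE.
pose F (x : 'rV[R]_n.+1) : \bar R := (\prod_j f j (x ord0 j))%:E.
pose m := lebesgue_rV n : {sigma_finite_measure set 'rV[R]_n -> \bar R}.
have FE (p : measurableTypeR R * 'rV[R]_n) :
    F (rV_cons p) = ((f ord0 p.1)%:E * g p.2)%E.
  rewrite /F /g big_ord_recl rV_cons0 -EFinM.
  by congr (_ * _)%:E; apply: eq_bigr => j _; rewrite rV_consS.
have FcE x y : (F \o (@rV_cons R n)) (x, y) = ((f ord0 x)%:E * g y)%E.
  exact: FE (x, y).
have mf j : measurable_fun setT (f j).
  by apply/measurable_EFinP; exact: (measurable_int leb (fi j)).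
have mF : measurable_fun setT F.
  by apply/measurable_EFinP; exact: measurable_rV_prod.
have mFc : measurable_fun setT (F \o (@rV_cons R n)).
  by apply: measurableT_comp => //; exact: measurable_rV_cons.
have iFc : (leb \x m)%E.-integrable setT (F \o (@rV_cons R n)).
  apply/integrable12ltyP => //.
  under eq_integral => x _.
    under eq_integral do rewrite FcE abseM.
    rewrite integralZl//; last exact: integrable_abse.
    over.
  pose K := fine (\int[m]_y `|g y|)%E.
  have KE : (\int[m]_y `|g y|)%E = K%:E.
    by rewrite /K fineK// integrable_fin_num// integrable_abse.
  rewrite KE integralZr//; last exact: (integrable_abse (fi ord0)).
  have := integrable_fin_num measurableT (integrable_abse (fi ord0)).
  by move/fineK => <-; rewrite -EFinM ltry.
have E : (\int[leb \x m]_p (F \o (@rV_cons R n)) p)%E =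
    (\prod_j \int[leb]_x f j x)%:E.
  rewrite -integral12_prod_meas1// /fubini_F.
  under eq_integral => x _.
    under eq_integral do rewrite FcE.
    rewrite integralZl// gE.
    over.
  rewrite integralZr//; last exact: (fi ord0).
  rewrite big_ord_recl EFinM; congr (_ * _)%E.
  rewrite /Rintegral fineK//.
  exact: (integrable_fin_num measurableT (fi ord0)).
split.
  exact: (integrable_pushforward (@measurable_rV_cons R n) mF iFc).
by rewrite -E; exact: (integral_pushforward (@measurable_rV_cons R n) mF iFc).
Qed.

Lemma gauss_integrable (m c : R) : 0 < c ->
  leb.-integrable setT (EFin \o (fun x => expR (- (x - m) ^+ 2 / c))) /\
  \int[leb]_x expR (- (x - m) ^+ 2 / c) = Num.sqrt (c * pi).
Proof.
move=> c0; pose s : R := Num.sqrt (c / 2).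
have s0 : s != 0 by rewrite gt_eqF// sqrtr_gt0 divr_gt0.
have s2 : s ^+ 2 = c / 2 by rewrite sqr_sqrtr// divr_ge0// ltW.
have p0 : normal_peak s != 0 by rewrite gt_eqF// normal_peak_gt0.
have E x : expR (- (x - m) ^+ 2 / c) = (normal_peak s)^-1 * normal_pdf m s x.
  rewrite normal_pdfE// mulKf// /normal_fun s2 -mulr_natr divfK// pnatr_eq0.
have i := integrable_normal_pdf m s.
have -> : (fun x => expR (- (x - m) ^+ 2 / c)) =
    (fun x => (normal_peak s)^-1 * normal_pdf m s x) by apply/funext.
split; first exact: (integrableZl measurableT (normal_peak s)^-1 i).
rewrite RintegralZl// /Rintegral integral_normal_pdf/= mulr1.
by rewrite /normal_peak invrK s2; congr Num.sqrt; field.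
Qed.

End integral_rV.

(** * Orthogonality of the Hermite polynomials *)

Section hermite_orthogonality.
Context {R : realType}.
Local Notation leb := (@lebesgue_measure R).
Implicit Types p q : {poly R}.

Lemma horner_le p : exists2 C : R, 0 <= C &
  forall y, `|p.[y]| <= C * expR (y ^+ 2 / 2).
Proof.
exists (\sum_(i < size p) `|p`_i| * Num.sqrt i`!%:R) => [|y].
  by apply: sumr_ge0 => i _; rewrite mulr_ge0// sqrtr_ge0.
rewrite horner_coef (le_trans (ler_norm_sum _ _ _))// mulr_suml.
apply: ler_sum => i _; rewrite normrM -mulrA ler_wpM2l// normrX.
have := @expr_div_sqrt_fact_le R 1 `|y| i ltr01 (normr_ge0 y).
rewrite ler_pdivrMr ?sqrtr_gt0 ?ltr0n ?fact_gt0//.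
by rewrite expr1n invr1 !mul1r real_normK ?num_real// mulrC.
Qed.

Lemma integrable_poly_gauss p :
  leb.-integrable setT (EFin \o (fun y => p.[y] * expR (- y ^+ 2))).
Proof.
have [C C0 hC] := horner_le p.
have c4 : 0 < 4 :> R by [].
  have [gi _] := gauss_integrable 0 c4.
have mE : measurable_fun setT (fun y : R => p.[y] * expR (- y ^+ 2)).
  apply: measurable_funM.
    by apply: continuous_measurable_fun => y; exact: continuous_horner.
  by apply: measurableT_comp => //; exact: measurableT_comp.
apply: (le_integrable measurableT _ _ (integrableZl measurableT C gi)).
  by apply/measurable_EFinP; exact: mE.
move=> y _; rewrite /= lee_fin subr0.
rewrite normrM [leRHS]ger0_norm ?mulr_ge0 ?expR_ge0//.
rewrite (@ger0_norm _ (expR _)) ?expR_ge0//.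
apply: (le_trans (ler_wpM2r (expR_ge0 _) (hC y))).
rewrite -mulrA -expRD ler_wpM2l// ler_expR; have := sqr_ge0 y; lra.
Qed.

Lemma is_derive_poly_gauss p (y : R) :
  is_derive y 1 (fun y => p.[y] * expR (- y ^+ 2))
    ((p^`() - (2 *: 'X) * p).[y] * expR (- y ^+ 2)).
Proof.
have h1 : is_derive y 1 (fun y : R => - y ^+ 2) (- (2 * y)).
  apply: is_derive1N; have := is_derive1M (is_derive_id y (1 : R)) (is_derive_id y (1 : R)).
  by rewrite mulr1 mul1r -mulr2n mulr_natl.
have h2 := @is_derive1_comp R expR (fun y => - y ^+ 2) y _ _
  (is_derive_expR (- y ^+ 2)) h1.
apply: (is_derive_eq (is_derive1M (is_derive_poly p y) h2)).
by rewrite hornerD hornerN hornerM hornerZ hornerX /=; ring.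
Qed.

Let F p y : R := p.[y] * expR (- y ^+ 2).

Let dF p (y : R) : is_derive y 1 (F p) ((p^`() - (2 *: 'X) * p).[y] * expR (- y ^+ 2)).
Proof. exact: is_derive_poly_gauss. Qed.

(** Integrate the derivative of [p exp(- y^2)], which vanishes at infinity. *)
Lemma integral_deriv_poly_gauss p :
  \int[leb]_y ((p^`() - (2 *: 'X) * p).[y] * expR (- y ^+ 2)) = 0.
Proof.
set q := _ - _; pose f (y : R) := q.[y] * expR (- y ^+ 2).
have fi : leb.-integrable setT (EFin \o f) := integrable_poly_gauss q.
have cf : continuous f.
  move=> y; apply: cvgM; first exact: continuous_horner.
  apply: continuous_comp; last exact: continuous_expR.
  by apply: cvgN; exact: exprn_continuous.
have [C C0 hC] := horner_le p.
pose A (n : nat) : set R := `[- n.+1%:R, n.+1%:R]%classic.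
have hA n : (\int[leb]_(y in A n) (f y)%:E = (F p n.+1%:R - F p (- n.+1%:R))%:E)%E.
  rewrite (@continuous_FTC2 _ f (F p))//.
  - by rewrite -subr_gt0 opprK addr_gt0.
  - exact: continuous_subspaceT.
  - split.
    + by move=> y _; have [] := dF p y.
    + apply: cvg_at_right_filter; apply: differentiable_continuous.
      by apply/derivable1_diffP; have [] := dF p (- n.+1%:R).
    + apply: cvg_at_left_filter; apply: differentiable_continuous.
      by apply/derivable1_diffP; have [] := dF p n.+1%:R.
  - by move=> y _; rewrite derive1E; exact: derive_val.
have lim1 : (\int[leb]_(y in A n) (f y)%:E)%E @[n --> \oo] -->
    (\int[leb]_y (f y)%:E)%E.
  have -> : (fun n => (\int[leb]_(y in A n) (f y)%:E)%E) =
      (fun n => (\int[leb]_y ((EFin \o f) \_ (A n)) y)%E).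
    by apply/funext => n; rewrite -integral_mkcond.
  apply: (@dominated_cvg _ _ _ leb setT measurableT _ _ (abse \o (EFin \o f))).
  - move=> n; apply/(measurable_restrictT _ _).1; first exact: measurable_itv.
    by apply: measurable_funTS; exact: (measurable_int leb fi).
  - move=> y _; apply: cvg_near_cst.
    exists (Num.trunc `|y|).+1 => // n /= yn.
    rewrite patchE ifT// inE /A/= in_itv/= -ler_norml ltW//.
    rewrite (lt_le_trans (truncnS_gt _))// ler_nat.
    by rewrite (leq_trans yn)// leqnSn.
  - by [].
  - exact: integrable_abse.
  - move=> n y _ /=; rewrite patchE; case: ifP => // _.
    by rewrite ?abse0 ?normr0 lee_fin normr_ge0.
have lim2 : (F p n.+1%:R - F p (- n.+1%:R))%:E @[n --> \oo] --> (0%:E : \bar R).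
  apply: cvg_EFin; first exact: nearW.
  apply/norm_cvg0P; apply: (@squeeze_cvgr _ _ _ _ (cst 0)
      (fun n => 2 * (2 * C) * n.+1%:R^-1)) => /=; last 2 first.
  - exact: cvg_cst.
  - rewrite -[X in _ --> X](mulr0 (2 * (2 * C))); apply: cvgMr.
    exact: cvg_harmonic.
  apply: nearW => n; rewrite normr_ge0/=.
  have hF (y : R) : y ^+ 2 = n.+1%:R ^+ 2 -> `|F p y| <= 2 * C * n.+1%:R^-1.
    move=> y2; rewrite /F normrM (@ger0_norm _ (expR _)) ?expR_ge0//.
    apply: (le_trans (ler_wpM2r (expR_ge0 _) (hC y))).
    rewrite -[leLHS]mulrA -expRD [2 * C]mulrC -[leRHS]mulrA ler_wpM2l//.
    have -> : y ^+ 2 / 2 - y ^+ 2 = - (y ^+ 2 / 2) by field.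
    rewrite expRN y2 -[leLHS]mul1r ler_pdivrMr ?expR_gt0//.
    rewrite mulrAC ler_pdivlMr ?ltr0n// mul1r.
    apply: (@le_trans _ _ (2 * (1 + n.+1%:R ^+ 2 / 2))); last first.
      by rewrite ler_wpM2l// expR_ge1Dx.
    have : 1 <= n.+1%:R :> R by rewrite ler1n.
    nra.
  rewrite (le_trans (ler_normB _ _))//.
  rewrite (le_trans (lerD (hF _ erefl) (hF _ (sqrrN _))))//.
  by rewrite le_eqVlt; apply/orP; left; apply/eqP; ring.
have {}lim1 : (F p n.+1%:R - F p (- n.+1%:R))%:E @[n --> \oo] -->
    (\int[leb]_y (f y)%:E)%E.
  by apply: cvg_trans lim1; under eq_fun do rewrite -hA.
by rewrite /Rintegral (cvg_unique _ lim1 lim2).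
Qed.

Let I p : R := \int[leb]_y (p.[y] * expR (- y ^+ 2)).

Let ID p q : I (p + q) = I p + I q.
Proof.
rewrite /I -RintegralD//; try exact: integrable_poly_gauss.
by apply: eq_Rintegral => y _; rewrite hornerD mulrDl.
Qed.

Let IZ c p : I (c *: p) = c * I p.
Proof.
rewrite /I -RintegralZl//; last exact: integrable_poly_gauss.
by apply: eq_Rintegral => y _; rewrite hornerZ mulrA.
Qed.

Let I_hermS m q : I (herm m.+1 * q) = I (herm m * q^`()).
Proof.
have := integral_deriv_poly_gauss (herm m * q); rewrite -/(I _).
have -> : (herm m * q)^`() - (2 *: 'X) * (herm m * q) =
    herm m * q^`() + (-1) *: (herm m.+1 * q).
  by rewrite derivM [herm m.+1]/= scaleN1r; ring.
by rewrite ID IZ mulN1r => /subr0_eq.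
Qed.

(** Each integration by parts turns one factor [2 y - d/dy] of [herm m] into a
    derivative of [herm n]. *)
Lemma integral_herm_herm m n :
  \int[leb]_y (((herm m).[y] * (herm n).[y]) * expR (- y ^+ 2)) =
  (m == n)%:R * (2 ^+ n * n`!%:R * Num.sqrt pi).
Proof.
have -> : \int[leb]_y (((herm m).[y] * (herm n).[y]) * expR (- y ^+ 2)) =
    I (herm m * herm n).
  by apply: eq_Rintegral => y _; rewrite hornerM.
have I0 : I 0 = 0 by rewrite -(scale0r 0) IZ mul0r.
elim: m n => [|m ih] [|n].
- have [_] := @gauss_integrable R 0 1 ltr01; rewrite mul1r => E.
  rewrite eqxx expr0 fact0 !mul1r -E.
  by apply: eq_Rintegral => y _; rewrite /= ?mulr1 hornerC mul1r subr0 divr1.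
- by rewrite mulrC I_hermS /= -polyC1 derivC mulr0 I0 mul0r.
- by rewrite I_hermS /= -polyC1 derivC mulr0 I0 mul0r.
- rewrite I_hermS deriv_herm -scalerAr IZ ih eqSS exprS factS natrM.
  by rewrite mulrCA; congr (_ * _); ring.
Qed.

End hermite_orthogonality.

(** * Hermite functions on [R^d] as products *)

Section hermite_fun.
Context {R : realType} {d : nat}.
Implicit Types (x : 'rV[R]_d) (a : {ffun 'I_d -> nat}) (p : 'I_d -> {poly R}).

Let gp p x : R := \prod_j (p j).[x ord0 j] * expR (- sqnorm x).

Lemma derive_separated (F : 'rV[R]_d -> R) (phi : R -> R) x v (y A D : R) :
  (forall h : R, F (h *: v + x) = A * phi (h + y)) -> is_derive y 1 phi D ->
  'D_v F x = A * D.
Proof.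
move=> FE [dphi <-]; rewrite /derive.
have F0 : F x = A * phi y by have := FE 0; rewrite scale0r !add0r.
have -> : (fun h => h^-1 *: ((F \o shift x) (h *: v) - F x)) =
    (fun h => A * (h^-1 *: ((phi \o shift y) (h *: 1) - phi y))).
  apply/funext => h /=; rewrite FE F0 /GRing.scale/= mulr1; ring.
by apply/cvg_lim => //; apply: cvgMr; exact: dphi.
Qed.

Let polyD (p : {poly R}) : {poly R} := p^`() - (2 *: 'X) * p.

Let is_derive_poly_gauss (p : {poly R}) (y : R) :
  is_derive y 1 (fun y => p.[y] * expR (- y ^+ 2)) ((polyD p).[y] * expR (- y ^+ 2)).
Proof. exact: is_derive_poly_gauss. Qed.

Let partial_gp i p :
  partial i (gp p) = gp (fun j => if j == i then polyD (p j) else p j).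
Proof.
apply/funext => x; rewrite /partial.
pose A := \prod_(j | j != i) (p j).[x ord0 j]
  * expR (- \sum_(j | j != i) x ord0 j ^+ 2).
have E (q : {poly R}) (y : 'rV[R]_d) :
    (forall j, j != i -> y ord0 j = x ord0 j) ->
    gp (fun j => if j == i then q else p j) y =
    A * (q.[y ord0 i] * expR (- y ord0 i ^+ 2)).
  move=> yx; rewrite /gp /sqnorm /A (bigD1 i)//= eqxx [in expR _](bigD1 i)//=.
  rewrite opprD expRD mulrACA mulrC; congr (_ * _).
  rewrite (eq_bigr (fun j => (p j).[x ord0 j])); last first.
    by move=> j ji; rewrite (negbTE ji) yx.
  by congr (_ * expR (- _)); apply: eq_bigr => j ji; rewrite yx.
have -> : gp p = gp (fun j => if j == i then p i else p j).
  by congr gp; apply/funext => j; case: eqP => // ->.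
rewrite (@derive_separated _ (fun y => (p i).[y] * expR (- y ^+ 2)) _ _
  (x ord0 i) A _ _ (is_derive_poly_gauss (p i) (x ord0 i))).
  rewrite -E//; congr gp; apply/funext => j; by case: eqP => // ->.
move=> h; rewrite E.
  by rewrite !mxE !eqxx mulr1.
by move=> j ji; rewrite !mxE eqxx (negbTE ji) mulr0 add0r.
Qed.

Lemma mpartial_gauss a x :
  mpartial a (fun y => expR (- sqnorm y)) x =
  (-1) ^+ mlength a * (\prod_j (herm (a j)).[x ord0 j]) * expR (- sqnorm x).
Proof.
pose hs n : {poly R} := (-1) ^+ n *: herm n.
have hsS n : polyD (hs n) = hs n.+1.
  rewrite /polyD /hs derivZ -scalerAr -scalerBr exprSr -scalerA; congr (_ *: _).
  by rewrite [herm n.+1]/= scaleN1r opprB.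
have it i p n : p i = 1 -> iter n (partial i) (gp p) =
    gp (fun j => if j == i then hs n else p j).
  move=> pi1; elim: n => [|n ih].
    by congr gp; apply/funext => j; case: eqP => // ->; rewrite /hs scale1r pi1.
  rewrite iterS ih partial_gp; congr gp; apply/funext => j.
  by case: eqP => // _; rewrite hsS.
have st (s : seq 'I_d) : uniq s ->
    foldr (fun i G => iter (a i) (partial i) G) (gp (fun=> 1)) s =
    gp (fun j => if j \in s then hs (a j) else 1).
  elim: s => [_|i s ih /= /andP[is_ us]]; first by [].
  rewrite ih// it ?(negbTE is_)//; congr gp; apply/funext => j.
  by rewrite inE; case: eqP => // ->.
have g1 : (fun y => expR (- sqnorm y)) = gp (fun=> 1).
  apply/funext => y; rewrite /gp big1 ?mul1r// => j _.
  by rewrite -polyC1 hornerC.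
rewrite /mpartial g1 st ?enum_uniq// /gp; congr (_ * _).
under eq_bigr do rewrite mem_enum /= /hs hornerZ.
by rewrite big_split/= expr_sum.
Qed.

Definition hfun n (y : R) : R :=
  pi `^ (- 4^-1) * (hnorm n)^-1 * expR (- (y ^+ 2 / 2)) * (herm n).[y].

Lemma hermite_funE a x : hermite_fun a x = \prod_j hfun (a j) (x ord0 j).
Proof.
rewrite /hermite_fun mpartial_gauss /hfun !big_split/=.
have -> : pi `^ (- (d%:R / 4)) = \prod_(j < d) pi `^ (- 4^-1) :> R.
  rewrite prodr_const card_ord -powR_mulrn ?powR_ge0// -powRrM; congr (_ `^ _).
  by rewrite mulNr mulrC.
have -> : (2 ^+ mlength a * (mfact a)%:R) `^ (- 2^-1) =
    \prod_j (hnorm (a j))^-1 :> R.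
  rewrite powRN powR12_sqrt ?mulr_ge0 ?exprn_ge0//.
  rewrite /mlength /mfact prodfV; congr (_^-1).
  have -> : 2 ^+ (\sum_j a j) * (\prod_j (a j)`!)%:R =
      \prod_j hnorm (a j) ^+ 2 :> R.
    rewrite natr_prod expr_sum -big_split/=.
    by apply: eq_bigr => j _; rewrite sqr_hnorm.
  rewrite prodrXl sqrtr_sqr ger0_norm//; apply: prodr_ge0 => j _.
  by rewrite ltW// hnorm_gt0.
have -> : \prod_j expR (- (x ord0 j ^+ 2 / 2)) =
    expR (sqnorm x / 2) * expR (- sqnorm x) :> R.
  by rewrite -expR_sum -expRD sumrN -mulr_suml -/(sqnorm x); congr expR; field.
have s1 : (-1) ^+ mlength a * (-1) ^+ mlength a = 1 :> R.
  by rewrite -exprMn mulrNN mulr1 expr1n.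
have aux (P S H E1 Q E2 : R) : S * S = 1 ->
    P * S * H * E1 * (S * Q * E2) = P * H * (E1 * E2) * Q.
  move=> SS; transitivity (S * S * (P * H * (E1 * E2) * Q)); first by ring.
  by rewrite SS mul1r.
exact: aux s1.
Qed.

End hermite_fun.

(** * Pairing a function with finitely many Hermite functions *)

Section pairing.
Context {R : realType}.

Lemma Rintegral_sum disp (T : measurableType disp)
    (mu : {measure set T -> \bar R}) (I : Type) (s : seq I) (F : I -> T -> R) :
  (forall i, mu.-integrable setT (EFin \o F i)) ->
  mu.-integrable setT (EFin \o (fun y => \sum_(i <- s) F i y)) /\
  \int[mu]_y (\sum_(i <- s) F i y) = \sum_(i <- s) \int[mu]_y F i y.
Proof.
move=> Fi; elim: s => [|i s [ih1 ih2]].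
  have -> : (fun y => \sum_(i <- [::]) F i y) = cst 0.
    by apply/funext => y; rewrite big_nil.
  by rewrite big_nil /Rintegral integral0; split => //; exact: integrable0.
have -> : (fun y => \sum_(i <- i :: s) F i y) =
    (fun y => F i y + \sum_(i <- s) F i y).
  by apply/funext => y; rewrite big_cons.
split; first exact: (integrableD measurableT (Fi i) ih1).
by rewrite RintegralD// big_cons ih2.
Qed.

Context {d : nat}.
Local Notation mu := (@lebesgue_rV R d).

(** With [S] the sum on the left, [nc S ^+ 2] is the integral of the real part of
    [conj S * g] times the kernel: this reduces the estimate to real integrals. *)
Lemma given_by_pairing_le (f : hermite_series R d) g (I : finType)
    (m : I -> {ffun 'I_d -> nat}) (kappa : I -> R[i]) (bnd : 'rV[R]_d -> R) :
  given_by f g ->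
  mu.-integrable setT (EFin \o bnd) ->
  (forall x, 0 <= bnd x) ->
  (\forall x \ae mu,
     nc (g x) * nc (\sum_i (hermite_fun (m i) x)%:C%C * kappa i) <= bnd x) ->
  nc (\sum_i f (m i) * kappa i) <= \int[mu]_x bnd x.
Proof.
move=> [_ _ gi] bi b0 hb; set S := \sum_i _; set V := Rintegral _ _ _.
pose u i := complex.Re (conjc S * kappa i).
pose v i := complex.Im (conjc S * kappa i).
pose F i x := u i * (complex.Re (g x) * hermite_fun (m i) x)
  + - v i * (complex.Im (g x) * hermite_fun (m i) x).
have iF i : mu.-integrable setT (EFin \o F i).
  have [i1 i2 _] := gi (m i).
  exact: (integrableD measurableT (integrableZl measurableT (u i) i1)
    (integrableZl measurableT (- v i) i2)).
have [iG GE] := Rintegral_sum (index_enum I) iF.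
pose G x := \sum_i F i x.
have GRe x : G x = complex.Re (conjc S *
    (g x * \sum_i (hermite_fun (m i) x)%:C%C * kappa i)).
  rewrite /G 2!mulr_sumr Re_sum; apply: eq_bigr => i _.
  rewrite (_ : conjc S * _ = (hermite_fun (m i) x)%:C%C *
    ((conjc S * kappa i) * g x)); last by ring.
  rewrite ReZ ReM /F /u /v; ring.
have S2 : nc S ^+ 2 = \int[mu]_x G x.
  rewrite /G GE -nc_mul_conj {2}/S mulr_sumr Re_sum; apply: eq_bigr => i _.
  have [i1 i2 fE] := gi (m i).
  rewrite RintegralD//; last 2 first.
  - exact: (integrableZl measurableT (u i) i1).
  - exact: (integrableZl measurableT (- v i) i2).
  rewrite RintegralZl// RintegralZl// fE /u /v !(ReM, ImM)/=; ring.
have V0 : 0 <= V by apply: Rintegral_ge0.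
have : nc S ^+ 2 <= nc S * V.
  rewrite S2 (le_trans (ler_norm _))// (le_trans (le_normr_Rintegral _ iG))//.
  rewrite /V -RintegralZl// /Rintegral fine_le//.
  - exact: (integrable_fin_num measurableT (integrable_abse iG)).
  - exact: (integrable_fin_num measurableT (integrableZl measurableT (nc S) bi)).
  apply: ae_ge0_le_integral => //.
  - exact: (measurable_int mu (integrable_abse iG)).
  - by move=> x _; rewrite lee_fin mulr_ge0 ?nc_ge0.
  - exact: (measurable_int mu (integrableZl measurableT (nc S) bi)).
  apply: filterS hb => x hx _; rewrite lee_fin -/(G x) GRe.
  rewrite (le_trans (Re_le_nc _))// Normc.normcM nc_conj ler_wpM2l ?nc_ge0//.
  by rewrite Normc.normcM.
have [->//|n0] := eqVneq (nc S) 0.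
by rewrite expr2 ler_pM2l// lt_def n0 nc_ge0.
Qed.

End pairing.

(** * The Bargmann transform *)

Section bargmann.
Context {R : realType}.

(** At most quadratic growth, in the uniform sense that rescaling the argument by
    [l] costs a factor [l ^ 2]. This is what the logarithmic and the power weights
    have in common. *)
Definition subquadratic (phi : R -> R) :=
  [/\ forall x, 0 <= x -> 0 <= phi x,
      forall x y, 0 <= x -> x <= y -> phi x <= phi y
    & exists2 C, 0 <= C & forall l x, 1 <= l -> 0 <= x ->
        phi (l * x) <= C * l ^+ 2 * (phi x + 1)].

(** If [w] is small compared with [X], then [Y <= 2 X]; otherwise [Y] is a multiple
    of [w], and [phi Y] is compared with [phi 1]. *)
Lemma subquadratic_split (phi : R -> R) : subquadratic phi ->
  exists2 K, 0 <= K & forall X Y w, 0 <= X -> 0 <= Y -> 0 <= w ->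
    Y ^+ 2 <= X ^+ 2 + 2 * w ^+ 2 -> phi Y <= K * (phi X + 1) + K * w ^+ 2.
Proof.
move=> [phi0 phim [C C0 hC]].
have p1 : 0 <= phi 1 by exact: phi0.
exists (4 * C * (phi 1 + 1)); first by rewrite !mulr_ge0// addr_ge0.
move=> X Y w X0 Y0 w0 hY; have pX := phi0 X X0.
have [wX|Xw] := leP (2 * w ^+ 2) (X ^+ 2).
  have YX : Y <= 2 * X.
    rewrite -(@ler_pXn2r _ 2)// ?nnegrE ?mulr_ge0// exprMn.
    have := sqr_ge0 X; lra.
  have h2 : (1 : R) <= 2 by lra.
  apply: (le_trans (phim _ _ Y0 YX)); apply: (le_trans (hC _ _ h2 X0)).
  have : 0 <= C * phi 1 by rewrite mulr_ge0.
  have : 0 <= C * phi 1 * (phi X + 1) by rewrite mulr_ge0 ?mulr_ge0 ?addr_ge0.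
  have : 0 <= C * (phi 1 + 1) * w ^+ 2 by rewrite !mulr_ge0 ?sqr_ge0 ?addr_ge0.
  nra.
pose l := Num.max 1 (2 * w).
have l1 : 1 <= l by rewrite le_max lexx.
have Yl : Y <= l * 1.
  rewrite mulr1 le_max; apply/orP; right.
  rewrite -(@ler_pXn2r _ 2)// ?nnegrE ?mulr_ge0// exprMn.
  have := sqr_ge0 w; lra.
apply: (le_trans (phim _ _ Y0 Yl)); apply: (le_trans (hC _ _ l1 ler01)).
have hl : l ^+ 2 <= 1 + 4 * w ^+ 2.
  have := sqr_ge0 w; rewrite /l; have [h|h] := leP 1 (2 * w); last lra.
  by rewrite exprMn; lra.
apply: (@le_trans _ _ (C * (1 + 4 * w ^+ 2) * (phi 1 + 1))).
  by rewrite ler_wpM2r ?addr_ge0// ler_wpM2l.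
have : 0 <= C * (phi 1 + 1) by rewrite mulr_ge0 ?addr_ge0.
have : 0 <= C * (phi 1 + 1) * phi X by rewrite !mulr_ge0 ?addr_ge0.
nra.
Qed.

(** As a function of [e], a product of affine functions with nonnegative
    coefficients is convex, hence lies below its chord over [0, 1]. *)
Lemma prod_perturb_le (I : Type) (s : seq I) (A B : I -> R) (e : R) :
  0 <= e <= 1 -> (forall i, 0 <= A i) -> (forall i, 0 <= B i) ->
  \prod_(i <- s) (A i + e * B i) <=
    \prod_(i <- s) A i + e * \prod_(i <- s) (A i + B i).
Proof.
move=> /andP[e0 e1] A0 B0.
suff H : \prod_(i <- s) A i <= \prod_(i <- s) (A i + B i) /\
    \prod_(i <- s) (A i + e * B i) <= \prod_(i <- s) A i +
      e * (\prod_(i <- s) (A i + B i) - \prod_(i <- s) A i).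
  apply: (le_trans H.2); rewrite lerD2l ler_wpM2l// lerBlDr lerDl.
  exact: prodr_ge0.
elim: s => [|i s [ih1 ih2]]; first by rewrite !big_nil subrr mulr0 addr0.
rewrite !big_cons; have P0 : 0 <= \prod_(i <- s) A i by exact: prodr_ge0.
set P := \prod_(i <- s) A i in ih1 ih2 P0 *.
set Q := \prod_(i <- s) (A i + B i) in ih1 ih2 *.
have a0 := A0 i; have b0 := B0 i; split.
  by rewrite ler_pM// lerDl.
apply: (le_trans (ler_wpM2l _ ih2)); first by rewrite addr_ge0 ?mulr_ge0.
have : 0 <= e * (1 - e) * (B i * (Q - P)).
  by rewrite !mulr_ge0 ?subr_ge0.
nra.
Qed.

Context {d : nat}.
Local Notation mu := (@lebesgue_rV R d).

Definition multi_index N (a : {ffun 'I_d -> 'I_N}) : {ffun 'I_d -> nat} :=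
  [ffun j => a j : nat].

(** Truncations of the power series [\sum_a f a z^a / sqrt a!]. *)
Definition bargmann_coef (f : hermite_series R d) N
    (a : {ffun 'I_d -> 'I_N}) : R[i] :=
  f (multi_index a) * (\prod_j (Num.sqrt (a j)`!%:R)^-1)%:C%C.

Definition bargmann f N (z : 'I_d -> R[i]) : R[i] :=
  mpol (@bargmann_coef f N) z.

Let kappa N (z : 'I_d -> R[i]) (a : {ffun 'I_d -> 'I_N}) : R[i] :=
  \prod_j (z j ^+ a j * ((Num.sqrt (a j)`!%:R)^-1)%:C%C).

Lemma bargmannE f N z :
  bargmann f N z = \sum_a f (multi_index a) * @kappa N z a.
Proof.
apply: eq_bigr => a _; rewrite /bargmann_coef -mulrA; congr (_ * _).
by rewrite rmorph_prod -big_split/=; apply: eq_bigr => j _; rewrite mulrC.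
Qed.

Let kern1 N (y : R) (z : R[i]) : R[i] :=
  \sum_(n < N) (hfun n y)%:C%C * (z ^+ n * ((Num.sqrt n`!%:R)^-1)%:C%C).

(** The Bargmann kernel is the generating function of the Hermite polynomials. *)
Lemma kern1E N y z : kern1 N y z = (pi `^ (- 4^-1) * expR (- (y ^+ 2 / 2)))%:C%C
  * hgen N y (((Num.sqrt 2)^-1)%:C%C * z).
Proof.
rewrite /kern1 /hgen mulr_sumr; apply: eq_bigr => n _.
rewrite exprMn -rmorphXn/=.
have aux (a b c h t : R) (w : R[i]) : a * b = c * h * t ->
    a%:C%C * (w * b%:C%C) = c%:C%C * (h%:C%C * (t%:C%C * w)).
  by move=> E; transitivity ((a * b)%:C%C * w);
    [rewrite rmorphM; ring|rewrite E !rmorphM; ring].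
apply: aux; rewrite /hfun.
have f0 : 0 < n`!%:R :> R by rewrite ltr0n fact_gt0.
have s2n : Num.sqrt (2 ^+ n) = Num.sqrt 2 ^+ n :> R.
  by rewrite -[in LHS](@sqr_sqrtr _ 2)// exprAC sqrtr_sqr ger0_norm.
have fE : n`!%:R = Num.sqrt n`!%:R * Num.sqrt n`!%:R :> R.
  by rewrite -expr2 sqr_sqrtr// ltW.
rewrite {2}fE /hnorm sqrtrM ?exprn_ge0// s2n exprVn.
field; rewrite gt_eqF ?sqrtr_gt0//= expf_neq0// gt_eqF// sqrtr_gt0//.
Qed.

Lemma kernelE N (y : 'rV[R]_d) z :
  \sum_a (hermite_fun (@multi_index N a) y)%:C%C * kappa z a =
  \prod_j kern1 N (y ord0 j) (z j).
Proof.
rewrite /kern1 bigA_distr_bigA; apply: eq_bigr => a _.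
rewrite hermite_funE rmorph_prod -big_split/=.
by apply: eq_bigr => j _; rewrite ffunE.
Qed.

Lemma pi_powRN_le1 : pi `^ (- 4^-1) <= 1 :> R.
Proof.
rewrite powRN invf_le1 ?powR_gt0 ?pi_gt0//.
rewrite -[leLHS](powRr0 pi) ler_powR//.
by rewrite (le_trans _ (pi_ge2 R))// ler1n.
Qed.

Lemma kern1_le (rho : R) : 0 <= rho -> exists2 D, 0 <= D & forall N y z,
  nc z <= rho -> nc (kern1 N.+1 y z) <=
    expR (- (y ^+ 2 / 2)) *
    (expR (Num.sqrt 2 * y * complex.Re z
           - (complex.Re z ^+ 2 - complex.Im z ^+ 2) / 2)
     + 2 ^- N * (D * expR (y ^+ 2 / 8))).
Proof.
move=> rho0; have [D D0 hD] := @hgen_le R rho rho0.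
exists D => // N y z hz; rewrite kern1E Normc.normcM nc_real.
have s0 : 0 < Num.sqrt 2 :> R by rewrite sqrtr_gt0.
rewrite ger0_norm ?mulr_ge0 ?powR_ge0 ?expR_ge0//.
apply: ler_pM; rewrite ?mulr_ge0 ?powR_ge0 ?expR_ge0 ?nc_ge0//.
  by rewrite ler_piMl ?expR_ge0 ?pi_powRN_le1.
have ht : nc (((Num.sqrt 2)^-1)%:C%C * z) <= rho.
  rewrite Normc.normcM nc_real ger0_norm ?invr_ge0 ?(ltW s0)//.
  apply: le_trans hz; rewrite ler_piMl ?nc_ge0// invf_le1//.
  by rewrite -[leLHS]sqrtr1 ler_sqrt// ler1n.
apply: (le_trans (hD N y _ ht)).
rewrite -[_ * D * _]mulrA lerD2r ler_expR.
have -> : complex.Re (2 * y%:C%C * (((Num.sqrt 2)^-1)%:C%C * z) -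
    (((Num.sqrt 2)^-1)%:C%C * z) ^+ 2) =
    Num.sqrt 2 * y * complex.Re z
    - (complex.Re z ^+ 2 - complex.Im z ^+ 2) / 2 => //.
have s2 : (Num.sqrt 2)^-1 ^+ 2 = 2^-1 :> R by rewrite exprVn sqr_sqrtr.
have s1 : 2 * (Num.sqrt 2)^-1 = Num.sqrt 2 :> R.
  by rewrite -{1}(@sqr_sqrtr R 2)// expr2 mulfK// gt_eqF.
set t := (Num.sqrt 2)^-1 in s1 s2 *.
have -> : 2 * y%:C%C * (t%:C%C * z) - (t%:C%C * z) ^+ 2 =
    (2 * t * y)%:C%C * z - (t ^+ 2)%:C%C * (z * z).
  by rewrite !rmorphM rmorph_nat; ring.
by rewrite ReD ReN !ReZ ReM s1 s2; field.
Qed.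

(** Pairing [g] with the Bargmann kernel, of modulus
    [exp (- |y|^2 / 2 + sqrt 2 <y, Re z> - (|Re z|^2 - |Im z|^2) / 2)],
    leaves a Gaussian in [y] centered at [Re z / sqrt 2], times
    [exp (|Im z|^2 / 2)]. The cost of the weight at [y] is split between this
    center and the Gaussian. *)
Lemma bargmann_le (phi : R -> R) : subquadratic phi ->
  exists2 K, 0 <= K & exists2 r0, 0 < r0 & forall r B, 0 < r <= r0 -> 0 <= B ->
  exists2 C, 0 <= C & forall rho, 0 <= rho -> exists2 D, 0 <= D &
  forall f g N z, given_by f g ->
    (\forall y \ae mu, nc (g y) <=
       B * expR (- (sqnorm y / 2)) * expR (r * phi (enorm y))) ->
    (forall j, nc (z j) <= rho) ->
    nc (bargmann f N.+1 z) <=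
      C * expR ((\sum_j complex.Im (z j) ^+ 2) / 2
        + r * K * (phi (Num.sqrt (\sum_j complex.Re (z j) ^+ 2)) + 1))
      + 2 ^- N * D.
Proof.
move=> phiq; have [K K0 hK] := subquadratic_split phiq.
have K1 : 0 < 2 * (K + 1) by rewrite mulr_gt0// ltr_wpDl.
exists K => //; exists (2 * (K + 1))^-1; first by rewrite invr_gt0.
move=> r B /andP[r0 rr0] B0.
have rK : r * K <= 2^-1.
  have : r * (2 * (K + 1)) <= 1 by rewrite -ler_pdivlMr// mul1r.
  have : 0 <= r * K by rewrite mulr_ge0// ltW.
  nra.
pose G c := \prod_(j < d) Num.sqrt (c * pi) : R.
have G0 c : 0 <= G c by apply: prodr_ge0 => j _; exact: sqrtr_ge0.
have Gi (m : 'I_d -> R) c : 0 < c ->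
    mu.-integrable setT (EFin \o (fun y : 'rV[R]_d =>
      \prod_j expR (- (y ord0 j - m j) ^+ 2 / c))) /\
    \int[mu]_y (\prod_j expR (- (y ord0 j - m j) ^+ 2 / c)) = G c.
  move=> c0; have := @integral_rV_prod R d
    (fun j y => expR (- (y - m j) ^+ 2 / c)) (fun j => (gauss_integrable (m j) c0).1).
  move=> [i E]; split; first exact: i.
  rewrite /Rintegral E/=; apply: eq_bigr => j _.
  exact: (gauss_integrable (m j) c0).2.
exists (B * G 2); first by rewrite mulr_ge0.
move=> rho rho0; have [D1 D10 hD] := kern1_le rho0.
pose D2 := \prod_(j < d) (D1 + expR (5 * rho ^+ 2)).
have D20 : 0 <= D2 by apply: prodr_ge0 => j _; rewrite addr_ge0// expR_ge0.
exists (B * D2 * expR (r * K * (phi 0 + 1)) * G 4).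
  by rewrite !mulr_ge0// expR_ge0.
move=> f g N z fg hg hz.
have two_pos : 0 < 2 :> R by [].
have four_pos : 0 < 4 :> R by [].
pose m j := complex.Re (z j) / Num.sqrt 2.
set X := Num.sqrt (\sum_j complex.Re (z j) ^+ 2).
have s0 : 0 < Num.sqrt 2 :> R by rewrite sqrtr_gt0.
have ss : Num.sqrt 2 * Num.sqrt 2 = 2 :> R by rewrite -expr2 sqr_sqrtr.
have mE j : Num.sqrt 2 * m j = complex.Re (z j).
  by rewrite /m mulrC divfK// gt_eqF.
have sqm j : complex.Re (z j) ^+ 2 = 2 * m j ^+ 2.
  by rewrite -mE exprMn expr2 ss.
have sum0 (F : 'I_d -> R) : 0 <= \sum_j F j ^+ 2.
  by apply: sumr_ge0 => j _; exact: sqr_ge0.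
have hphi (y : 'rV[R]_d) (c : 'I_d -> R) (X' : R) : 0 <= X' ->
    X' ^+ 2 = \sum_j 2 * c j ^+ 2 ->
    r * phi (enorm y) <= r * K * (phi X' + 1) + (\sum_j (y ord0 j - c j) ^+ 2) / 2.
  move=> X'0 X'E.
  have hw := sqr_sqrtr (sum0 (fun j => y ord0 j - c j)).
  have h : enorm y ^+ 2 <=
      X' ^+ 2 + 2 * Num.sqrt (\sum_j (y ord0 j - c j) ^+ 2) ^+ 2.
    rewrite hw /enorm sqr_sqrtr ?sum0// X'E mulr_sumr -big_split/=.
    apply: ler_sum => j _; have := sqr_ge0 (y ord0 j - 2 * c j); nra.
  have := hK X' (enorm y) _ X'0 (sqrtr_ge0 _) (sqrtr_ge0 _) h; rewrite hw.
  move=> /(ler_wpM2l (ltW r0)); move/le_trans; apply.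
  have := sum0 (fun j => y ord0 j - c j); nra.
pose e1 := expR ((\sum_j complex.Im (z j) ^+ 2) / 2 + r * K * (phi X + 1)).
pose bnd (y : 'rV[R]_d) :=
  B * e1 * \prod_j expR (- (y ord0 j - m j) ^+ 2 / 2) +
  2 ^- N * (B * D2 * expR (r * K * (phi 0 + 1))) *
    \prod_j expR (- (y ord0 j - 0) ^+ 2 / 4).
have pN0 : 0 < 2 ^- N :> R by rewrite invr_gt0 exprn_gt0.
have [i1 I1] := Gi m 2 two_pos.
have [i2 I2] := Gi (fun=> 0) 4 four_pos.
have -> : B * G 2 * e1 + 2 ^- N * (B * D2 * expR (r * K * (phi 0 + 1)) * G 4) =
    \int[mu]_y bnd y.
  rewrite RintegralD//.
  - rewrite RintegralZl// RintegralZl// I1 I2; ring.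
  - exact: (integrableZl measurableT _ i1).
  - exact: (integrableZl measurableT _ i2).
rewrite bargmannE.
apply: (given_by_pairing_le fg).
- exact: (integrableD measurableT (integrableZl measurableT (B * e1) i1)
    (integrableZl measurableT _ i2)).
- move=> y; rewrite addr_ge0// !mulr_ge0 ?expR_ge0 ?(ltW pN0)//;
    by apply: prodr_ge0 => j _; exact: expR_ge0.
apply: filterS hg => y hy; rewrite kernelE nc_prod.
pose A j := expR (- (y ord0 j ^+ 2 / 2)) * expR (Num.sqrt 2 * y ord0 j * complex.Re (z j)
   - (complex.Re (z j) ^+ 2 - complex.Im (z j) ^+ 2) / 2).
pose Bf j := expR (- (y ord0 j ^+ 2 / 2)) * (D1 * expR (y ord0 j ^+ 2 / 8)).
have A0 j : 0 <= A j by rewrite mulr_ge0 ?expR_ge0.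
have Bf0 j : 0 <= Bf j by rewrite !mulr_ge0 ?expR_ge0.
have pN1 : 0 <= (2 ^- N : R) <= 1.
  by rewrite (ltW pN0)/= invf_le1 ?exprn_gt0// exprn_ege1// ler1n.
have hprod : \prod_j nc (kern1 N.+1 (y ord0 j) (z j)) <=
    \prod_j A j + 2 ^- N * \prod_j (A j + Bf j).
  apply: le_trans (prod_perturb_le (index_enum 'I_d) pN1 A0 Bf0).
  apply: ler_prod => j _; rewrite nc_ge0/=.
  apply: (le_trans (hD N (y ord0 j) (z j) (hz j))).
  by rewrite mulrDr lerD2l mulrCA.
apply: (le_trans (ler_pM (nc_ge0 _) _ hy hprod)).
  by apply: prodr_ge0 => j _; exact: nc_ge0.
rewrite mulrDr /bnd; apply: lerD.
  rewrite -!(mulrA B) ler_wpM2l// /A /e1 /sqnorm.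
  rewrite big_split/= -!expR_sum -!expRD ler_expR.
  have XE : X ^+ 2 = \sum_j 2 * m j ^+ 2.
    by rewrite sqr_sqrtr ?sum0//; apply: eq_bigr => j _; rewrite sqm.
  have := hphi y m X (sqrtr_ge0 _) XE.
  rewrite !mulr_suml -!sumrN => h.
  have E : \sum_j - (y ord0 j ^+ 2 / 2) + (\sum_j - (y ord0 j ^+ 2 / 2) +
      \sum_j (Num.sqrt 2 * y ord0 j * complex.Re (z j) -
        (complex.Re (z j) ^+ 2 - complex.Im (z j) ^+ 2) / 2)) +
      \sum_j (y ord0 j - m j) ^+ 2 / 2 =
      \sum_j complex.Im (z j) ^+ 2 / 2 + \sum_j - (y ord0 j - m j) ^+ 2 / 2.
    rewrite -!big_split/=; apply: eq_bigr => j _.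
    rewrite (sqm j) -(mE j).
    have -> : Num.sqrt 2 * y ord0 j * (Num.sqrt 2 * m j) =
      (Num.sqrt 2 * Num.sqrt 2) * y ord0 j * m j by ring.
    by rewrite ss; field.
  by move: h E; clear; lra.
have hAB : \prod_j (A j + Bf j) <= D2 * expR (- (\sum_j y ord0 j ^+ 2 * (3 / 8))).
  rewrite -sumrN expR_sum -big_split/=; apply: ler_prod => j _.
  rewrite addr_ge0//= /A /Bf -mulrDr.
  have -> : - (y ord0 j ^+ 2 * (3 / 8)) = - (y ord0 j ^+ 2 / 2) + y ord0 j ^+ 2 / 8.
    by field.
  rewrite (expRD (- (y ord0 j ^+ 2 / 2))) [leRHS]mulrCA ler_wpM2l ?expR_ge0//.
  rewrite [leRHS]mulrDl [leRHS]addrC lerD2r -expRD ler_expR.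
  have /andP[z1 z2] : (- rho <= complex.Re (z j) <= rho).
    by rewrite -ler_norml (le_trans (Re_le_nc _)).
  have hI : complex.Im (z j) ^+ 2 <= rho ^+ 2.
    rewrite -[leLHS]real_normK ?num_real// lerXn2r ?nnegrE//.
    by rewrite (le_trans (Im_le_nc _)).
  have hR : complex.Re (z j) ^+ 2 <= rho ^+ 2.
    rewrite -[leLHS]real_normK ?num_real// lerXn2r ?nnegrE//.
    by rewrite (le_trans (Re_le_nc _)).
  have E : Num.sqrt 2 * y ord0 j * complex.Re (z j) =
      2 * y ord0 j * m j by rewrite -(mE j) -{3}ss; ring.
  have := sqr_ge0 (y ord0 j - 8 * m j).
  have := sqm j; rewrite E.
  have := sqr_ge0 (complex.Re (z j)); clear -z1 z2 hI hR; nra.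
rewrite mulrCA -[leRHS]mulrA ler_wpM2l ?(ltW pN0)//.
apply: (le_trans (ler_wpM2l _ hAB)); first by rewrite !mulr_ge0 ?expR_ge0.
have -> : B * expR (- (sqnorm y / 2)) * expR (r * phi (enorm y)) *
    (D2 * expR (- (\sum_j y ord0 j ^+ 2 * (3 / 8)))) =
    (B * D2) * (expR (- (sqnorm y / 2)) * expR (r * phi (enorm y)) *
      expR (- (\sum_j y ord0 j ^+ 2 * (3 / 8)))) by ring.
rewrite -[leRHS]mulrA ler_wpM2l ?mulr_ge0// -expR_sum -!expRD ler_expR.
have := hphi y (fun=> 0) 0 (lexx _).
rewrite expr0n/= big1 => [/(_ erefl)|j _]; last by rewrite mulr0.
rewrite -sumrN /sqnorm !mulr_suml.
have E : \sum_j (y ord0 j - 0) ^+ 2 / 2 = \sum_j y ord0 j ^+ 2 / 2.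
  by apply: eq_bigr => j _; rewrite subr0.
have E2 : \sum_j - (y ord0 j ^+ 2 * (3 / 8)) <= \sum_j - (y ord0 j - 0) ^+ 2 / 4.
  apply: ler_sum => j _; rewrite subr0; have := sqr_ge0 (y ord0 j); clear; lra.
by rewrite E; move: E2; clear; lra.
Qed.

End bargmann.

(** * From the rays to the coefficients *)

Section rays.
Context {R : realType}.

Lemma sin_le (x : R) : `|sin x| <= `|x|.
Proof.
have := @cderiv_mean_value R (fun s => cexp (s%:C%C * Complex 0 x))
  (fun s => Complex 0 x * cexp (s%:C%C * Complex 0 x)) `|x|.
rewrite mul1r mul0r cexp0 => h.
have {}h : nc (cexp (Complex 0 x) - 1) <= `|x|.
  apply: h => s _; first exact: cderiv_cexp (cderiv_ray _ s).
  rewrite Normc.normcM nc_cexp ReZ/= mulr0 expR0 mulr1 expr0n add0r.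
  by rewrite sqrtr_sqr.
apply: le_trans h; apply: le_trans (Im_le_nc _).
by rewrite ImD ImN /cexp/= expR0 mul1r subr0.
Qed.

Lemma sin_int_pi (m : int) : sin (m%:~R * pi) = 0 :> R.
Proof.
have h n : sin (n%:R * pi) = 0 :> R.
  by rewrite mulr_natl -[X in sin X]add0r (alternatingn (@sinDpi R)) sin0 mulr0.
by case: m => n; rewrite ?NegzE ?mulrNz ?mulNr ?sinN -pmulrn h ?oppr0.
Qed.

Lemma norm_sin_sub_int_pi (x : R) (m : int) :
  `|sin (x - m%:~R * pi)| <= `|sin x|.
Proof.
rewrite sinB sin_int_pi mulr0 subr0 normrM ler_piMr//; exact: cos_max.
Qed.

(** Multiplying a point of argument [y] by [exp (i pi / 2 (t0 + k u))] makes its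
    imaginary part at most [delta] times its modulus. *)
Definition near_ray (t0 u delta y : R) (k : int) :=
  0 <= k%:~R * u < 2 /\ `|sin (y + pi / 2 * (t0 + k%:~R * u))| <= delta.

(** The rays of argument [- pi / 2 (t0 + k u)] cut the plane into sectors of
    opening at most [pi / 2 u]. An angle either is [delta]-close to a ray, or
    lies in such a sector shrunk by [delta] on each side. *)
Lemma between_rays (t0 u delta tau : R) : 0 < u -> 0 <= delta ->
  exists a b ka kb, [/\ a <= tau <= b, near_ray t0 u delta a ka,
    near_ray t0 u delta b kb & b - a <= Num.max 0 (pi / 2 * u - 2 * delta)].
Proof.
move=> u0 d0; pose v := pi / 2 * u.
have pi0 := pi_gt0 R.
have v0 : 0 < v by rewrite mulr_gt0// divr_gt0.
pose th := - (tau + pi / 2 * t0).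
pose m := Num.floor (th / pi).
pose th' := th - m%:~R * pi.
have th'0 : 0 <= th' by rewrite subr_ge0 -ler_pdivlMr// floor_le.
have th'pi : th' < pi.
  rewrite ltrBlDl -[X in _ + X]mul1r -mulrDl -ltr_pdivrMr//.
  by have := floorD1_gt (th / pi); rewrite intrD.
pose k := Num.floor (th' / v).
have k0 : 0 <= k by rewrite floor_ge0 divr_ge0// ltW.
have kth : k%:~R * v <= th' by rewrite -ler_pdivlMr// floor_le.
have thk : th' < (k%:~R + 1) * v.
  by rewrite -ltr_pdivrMr//; have := floorD1_gt (th' / v); rewrite intrD.
have kR0 : 0 <= k%:~R :> R by rewrite ler0z.
have kin : 0 <= k%:~R * u < 2.
  rewrite mulr_ge0 ?(ltW u0)//=.
  rewrite -(@ltr_pM2l _ (pi / 2)) ?divr_gt0// mulrCA -/v.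
  by rewrite [X in _ < X]divfK// (le_lt_trans kth).
(* the angles around [tau] are the [y phi] with [phi] around [th'] *)
pose y phi := - phi - m%:~R * pi - pi / 2 * t0.
have ytau : y th' = tau by rewrite /y /th' /th; ring.
have hlow phi : `|phi - k%:~R * v| <= delta -> near_ray t0 u delta (y phi) k.
  move=> h; split=> //; rewrite /y.
  have -> : - phi - m%:~R * pi - pi / 2 * t0 + pi / 2 * (t0 + k%:~R * u) =
    (k%:~R * v - phi) - m%:~R * pi by rewrite /v; ring.
  by rewrite (le_trans (norm_sin_sub_int_pi _ _))// (le_trans (sin_le _))// distrC.
have [b'' [k2 [thb hb hk2]]] : exists b'' k2, [/\ th' <= b'',
    b'' - k%:~R * v <= v & forall phi, `|phi - b''| <= delta ->
      near_ray t0 u delta (y phi) k2].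
  have [hk|hk] := ltP ((k + 1)%:~R * u) 2.
    exists ((k%:~R + 1) * v), (k + 1); split; first exact: ltW.
      by rewrite mulrDl mul1r addrAC subrr add0r.
    move=> phi h; split; first by rewrite hk andbT mulr_ge0 ?(ltW u0)// ler0z addr_ge0.
    rewrite /y; have -> : - phi - m%:~R * pi - pi / 2 * t0 +
        pi / 2 * (t0 + (k + 1)%:~R * u) =
      ((k%:~R + 1) * v - phi) - m%:~R * pi by rewrite /v intrD; ring.
    by rewrite (le_trans (norm_sin_sub_int_pi _ _))// (le_trans (sin_le _))// distrC.
  exists pi, 0; split; first exact: ltW.
    rewrite lerBlDl -{2}[v]mul1r -mulrDl.
    rewrite /v mulrCA -[leLHS](@divfK _ 2)// ler_wpM2l ?divr_ge0 ?(ltW pi0)//.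
    by move: hk; rewrite intrD.
  move=> phi h; split; first by rewrite mul0r lexx/=.
  rewrite /y mul0r addr0.
  have -> : - phi - m%:~R * pi - pi / 2 * t0 + pi / 2 * t0 =
    (pi - phi) - (m + 1)%:~R * pi by rewrite intrD; ring.
  by rewrite (le_trans (norm_sin_sub_int_pi _ _))// (le_trans (sin_le _))// distrC.
have [c1|c1] := leP (th' - k%:~R * v) delta.
  exists (y th'), (y th'), k, k; rewrite {1 2}ytau lexx subrr le_max lexx.
  have h : near_ray t0 u delta (y th') k by apply: hlow; rewrite ger0_norm ?subr_ge0.
  by split.
have [c2|c2] := leP (b'' - th') delta.
  exists (y th'), (y th'), k2, k2; rewrite {1 2}ytau lexx subrr le_max lexx.
  have h : near_ray t0 u delta (y th') k2.
    by apply: hk2; rewrite distrC ger0_norm ?subr_ge0.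
  by split.
exists (y (b'' - delta)), (y (k%:~R * v + delta)), k2, k; split.
- rewrite -{1 2}ytau /y; apply/andP; split; lra.
- by apply: hk2; rewrite addrAC subrr add0r normrN ger0_norm.
- by apply: hlow; rewrite addrAC subrr add0r ger0_norm.
- by rewrite le_max; apply/orP; right; rewrite /y -/v; lra.
Qed.

End rays.

Section coefficient_bound.
Context {R : realType} {d : nat}.
Local Notation mu := (@lebesgue_rV R d).

(** The half-plane openings allowed by [u], after shrinking by [delta], leave
    room for an exponent [beta > 2]; [delta] may be positive only if
    [delta^2 rho^2] is negligible in front of [phi rho]. *)
Definition sector_gap (phi : R -> R) (u : 'rV[R]_d) :=
  forall e, 0 < e -> exists delta beta kappa, [/\ 0 <= delta, 2 < beta, 0 < kappa,
    forall j y, `|y| <= Num.max 0 (pi / 2 * u ord0 j - 2 * delta) / 2 ->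
      kappa <= cos (beta * y)
    & forall rho, 0 <= rho -> delta ^+ 2 * rho ^+ 2 <= e * kappa * phi rho].

(** The Bargmann transform turns [frac_fourier t] into a rotation of the variables,
    because the monomials are eigenvectors of both. *)
Lemma bargmann_frac_fourier (f : hermite_series R d) (t : 'rV[R]_d) N (x y : 'I_d -> R) :
  bargmann f N (fun j => cexp (Complex (x j) (y j))) =
  bargmann (frac_fourier t f) N
    (fun j => cexp (Complex (x j) (y j + pi / 2 * t ord0 j))).
Proof.
apply: eq_bigr => a _; rewrite /bargmann_coef /frac_fourier.
have -> : \prod_j cexp (Complex (x j) (y j + pi / 2 * t ord0 j)) ^+ a j =
    (\prod_j cexp (Complex (x j) (y j)) ^+ a j) *
    cexp (Complex 0 (pi / 2 * \sum_j t ord0 j * (multi_index a j)%:R)).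
  have -> : cexp (Complex 0 (pi / 2 * \sum_j t ord0 j * (multi_index a j)%:R)) =
      \prod_j cexp (Complex 0 (pi / 2 * (t ord0 j * (a j)%:R))) :> R[i].
    rewrite -cexp_sum; congr cexp; apply/eqP; rewrite eq_complex Re_sum Im_sum/=.
    rewrite big1// eqxx/= mulr_sumr.
    by apply/eqP/eq_bigr => j _; rewrite ffunE.
  rewrite -big_split/=; apply: eq_bigr => j _.
  rewrite [_ * (_ * (a j)%:R)]mulrA -cexp_imagX -exprMn -cexpD.
  by congr (cexp _ ^+ _); apply/eqP; rewrite eq_complex ReD ImD/= addr0 !eqxx.
set P := \prod_j cexp _ ^+ _; set c := (\prod_j _)%:C%C; set v := pi / 2 * _.
have -> : expi (- v) = cexp (Complex 0 (- v)) by rewrite /cexp/= expR0 !mul1r.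
have := cexp_imagD (- v) v; rewrite addNr => h.
have {}h : cexp (Complex 0 (- v)) * cexp (Complex 0 v) = 1 :> R[i].
  by rewrite -h cexp0.
transitivity ((cexp (Complex 0 (- v)) * cexp (Complex 0 v)) *
  (f (multi_index a) * c * P)); first by rewrite h mul1r.
by ring.
Qed.

(** In logarithmic coordinates [z_j = exp w_j] the rays become horizontal lines.
    Near a ray, [bargmann_le] applied to the fractional Fourier transform that
    turns this ray to the real axis gives the growth [exp (r phi)]; elsewhere it
    only gives Gaussian growth in [z], that is, growth of the order of
    [exp (exp (2 |Re w_j|))]. Since the strips between the lines admit some
    [beta > 2],
    [phragmen_lindelof] extends the first bound to all arguments, and Cauchy's
    estimate on the torus of radii [exp X_j] isolates a coefficient. *)
Lemma coef_bound (phi : R -> R) (t0 u : 'rV[R]_d) (f : hermite_series R d) :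
  (0 < d)%N -> subquadratic phi -> (forall j, 0 < u ord0 j) ->
  sector_gap phi u ->
  (forall r, 0 < r -> exists2 B, 0 <= B & forall t, Lambda t0 u t ->
     exists2 g, given_by (frac_fourier t f) g &
     \forall y \ae mu, nc (g y) <=
       B * expR (- (sqnorm y / 2)) * expR (r * phi (enorm y))) ->
  forall e, 0 < e -> exists2 C, 0 <= C & forall (X : 'I_d -> R) a,
    nc (f a) * (\prod_j (Num.sqrt (a j)`!%:R)^-1 * \prod_j expR (X j) ^+ a j)
    <= C * expR (e * phi (Num.sqrt (\sum_j expR (X j) ^+ 2))).
Proof.
move=> d0 phiq u0 gap hf e e0; have [phi0 phim [Cp Cp0 hCp]] := phiq.
have dR0 : 0 < d%:R :> R by rewrite ltr0n.
have e10 : 0 < e / (2 * d%:R) by rewrite divr_gt0// mulr_gt0.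
have [delta [beta [kappa [de0 be2 ka0 hcos hde]]]] := gap _ e10.
have [K K0 [r0 r00 hK]] := @bargmann_le R d phi phiq.
pose q := 2 * Cp * K * d%:R + K * d%:R + 1.
have q0 : 0 < q by rewrite ltr_wpDl// addr_ge0 ?mulr_ge0// ltW.
pose r := Num.min r0 (e * kappa / (2 * q)).
have rpos : 0 < r by rewrite lt_min r00 divr_gt0 ?mulr_gt0.
have rr0 : 0 < r <= r0 by rewrite rpos ge_min lexx.
have rq : r * q <= e * kappa / 2.
  have : r <= e * kappa / (2 * q) by rewrite ge_min lexx orbT.
  rewrite ler_pdivlMr ?mulr_gt0//; lra.
have [B B0 hB] := hf r rpos.
have [C C0 hC] := hK r B rr0 B0.
exists ((C + 1) * expR (e / 2 + d%:R / kappa)).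
  by rewrite mulr_ge0 ?expR_ge0// addr_ge0.
move=> X a.
pose rho := Num.sqrt (\sum_j expR (X j) ^+ 2).
have rho0 : 0 <= rho := sqrtr_ge0 _.
have s0 : 0 <= \sum_j expR (X j) ^+ 2.
  by apply: sumr_ge0 => j _; exact: sqr_ge0.
have rho2 : rho ^+ 2 = \sum_j expR (X j) ^+ 2 by rewrite sqr_sqrtr.
have Xrho j : expR (X j) <= rho.
  rewrite -(@ler_pXn2r _ 2)// ?nnegrE ?expR_ge0// rho2 (bigD1 j)//= lerDl.
  by apply: sumr_ge0 => i _; exact: sqr_ge0.
have prho := phi0 _ rho0.
pose b2 := beta - 2; have b20 : 0 < b2 by rewrite subr_gt0.
(* at distance [L] from [X], the cost [exp (beta L)] dominates the Gaussian growth *)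
pose L := rho ^+ 2 / b2.
have L0 : 0 <= L by rewrite divr_ge0 ?sqr_ge0// ltW.
have hL : rho ^+ 2 * expR (2 * L) <= expR (beta * L).
  have -> : beta * L = rho ^+ 2 + 2 * L by rewrite /L /b2; field; rewrite gt_eqF.
  rewrite expRD ler_wpM2r ?expR_ge0// (le_trans _ (expR_ge1Dx _))//.
  by rewrite lerDr.
have R0 : 0 <= expR L * rho by rewrite mulr_ge0 ?expR_ge0.
have [D D0 hD] := hC _ R0.
(* the three terms pay for the [delta]-deviation from the rays, for the ends of
   the strips and for the weight *)
pose M := (delta ^+ 2 * rho ^+ 2 + 1 + r * K * (2 * Cp * (phi rho + 1) + 1)) / kappa.
have M0 : 0 <= M.
  rewrite divr_ge0 ?(ltW ka0)// addr_ge0 ?addr_ge0 ?mulr_ge0 ?sqr_ge0 ?addr_ge0//;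
    by rewrite ?mulr_ge0 ?addr_ge0 ?(ltW rpos).
have MK : M * kappa = delta ^+ 2 * rho ^+ 2 + 1 + r * K * (2 * Cp * (phi rho + 1) + 1).
  by rewrite /M divfK// gt_eqF.
have hM : M * d%:R <= e / 2 + d%:R / kappa + e * phi rho.
  have h1 := hde _ rho0.
  have h2 : delta ^+ 2 * rho ^+ 2 * d%:R <= e * kappa * phi rho / 2.
    rewrite -ler_pdivlMr//; apply: (le_trans h1).
    by rewrite le_eqVlt; apply/orP; left; apply/eqP; field; rewrite gt_eqF.
  have h3 : r * K * (2 * Cp * (phi rho + 1) + 1) * d%:R <= r * q * (phi rho + 1).
    have : 0 <= r * (K * d%:R * phi rho + phi rho + 1).
      by rewrite mulr_ge0 ?(ltW rpos)// !addr_ge0 ?mulr_ge0 ?(ltW dR0).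
    rewrite /q; nra.
  have h4 := ler_wpM2r (addr_ge0 prho ler01) rq.
  rewrite /M mulrAC ler_pdivrMr//.
  have -> : (e / 2 + d%:R / kappa + e * phi rho) * kappa =
    e * kappa / 2 + d%:R + e * kappa * phi rho by field; rewrite gt_eqF.
  by move: h2 h3 h4; clear; lra.
have key N tau : nc (bargmann f N.+1 (fun j => cexp (Complex (X j) (tau j)))) <=
    (C + 2 ^- N * D) * expR (M * d%:R).
  have A0 : 0 <= C + 2 ^- N * D.
    by rewrite addr_ge0// mulr_ge0// invr_ge0 exprn_ge0.
  have /fin_all_exists [p hp] j : exists p : R * R * int * int,
      [/\ p.1.1.1 <= tau j <= p.1.1.2,
        near_ray (t0 ord0 j) (u ord0 j) delta p.1.1.1 p.1.2,
        near_ray (t0 ord0 j) (u ord0 j) delta p.1.1.2 p.2 &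
        p.1.1.2 - p.1.1.1 <= Num.max 0 (pi / 2 * u ord0 j - 2 * delta)].
    have [a1 [b1 [k1 [k2 h]]]] := between_rays (t0 ord0 j) (tau j) (u0 j) de0.
    by exists (a1, b1, k1, k2).
  apply: (@phragmen_lindelof _ _ _ _ X (fun j => (p j).1.1.1) (fun j => (p j).1.1.2)
    tau beta M kappa _ L) => //.
  - by move=> j; case: (hp j).
  - move=> j y /andP[ay yb]; apply: hcos; have [_ _ _ hw] := hp j.
    apply: (@le_trans _ _ (((p j).1.1.2 - (p j).1.1.1) / 2)); last first.
      by rewrite ler_wpM2r ?invr_ge0//; exact: hw.
    by rewrite ler_norml; move: ay yb; clear; move=> ay yb; apply/andP; split; lra.
  move=> x y hx hy hb.
  pose k j := if y j == (p j).1.1.1 then (p j).1.2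
    else if y j == (p j).1.1.2 then (p j).2 else (p j).1.2.
  pose t := t0 + \row_j ((k j)%:~R * u ord0 j).
  have tE j : t ord0 j = t0 ord0 j + (k j)%:~R * u ord0 j by rewrite !mxE.
  have tL : Lambda t0 u t.
    exists k => //= j; have [_ [ha _] [hb' _] _] := hp j.
    by rewrite /k; case: ifP => // _; case: ifP.
  have ray j : `|x j - X j| = L \/ `|sin (y j + pi / 2 * t ord0 j)| <= delta.
    have [_ [_ ha] [_ hb'] _] := hp j; rewrite tE /k.
    case: (hb j) => [E|E|E]; [right|right|by left].
    - by rewrite E eqxx.
    - by rewrite E; case: eqP => [->//|_]; rewrite eqxx.
  have [g fg hg] := hB t tL.
  rewrite -/(bargmann f N.+1 _) (bargmann_frac_fourier f t).
  have zle j : nc (cexp (Complex (x j) (y j + pi / 2 * t ord0 j))) <= expR L * rho.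
    rewrite nc_cexp/=; have : x j <= X j + L.
      by have := hx j; rewrite ler_distl => /andP[].
    by rewrite -ler_expR expRD mulrC => /le_trans; apply; rewrite ler_wpM2l ?expR_ge0.
  apply: (le_trans (hD _ g N _ fg hg zle)).
  set E := _ / 2 + _.
  have E0 : 0 <= E.
    rewrite addr_ge0//.
      by rewrite divr_ge0//; apply: sumr_ge0 => j _; exact: sqr_ge0.
    by rewrite !mulr_ge0 ?(ltW rpos)// addr_ge0// phi0// sqrtr_ge0.
  apply: (@le_trans _ _ ((C + 2 ^- N * D) * expR E)).
    rewrite mulrDl lerD2l ler_peMr ?mulr_ge0 ?invr_ge0 ?exprn_ge0//.
    by rewrite -[leLHS]expR0 ler_expR.
  rewrite ler_wpM2l// ler_expR MK /E.
  pose ch j := coshr (beta * (x j - X j)).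
  have ch1 j : 1 <= ch j by exact: coshr_ge1.
  have beta0 : 0 < beta by exact: lt_trans be2.
  have ech j c : 0 <= c <= beta -> expR (c * `|x j - X j|) <= 2 * ch j.
    move=> /andP[c0 cb]; apply: le_trans (coshr_ge_expR _).
    by rewrite ler_expR normrM (gtr0_norm beta0) ler_wpM2r.
  have xX j : expR (x j) <= expR (X j) * expR `|x j - X j|.
    by rewrite -expRD ler_expR -lerBlDl ler_norm.
  have two2 : 0 <= (2 : R) <= beta by rewrite (ltW be2) andbT.
  have x2 j : expR (x j) ^+ 2 <= expR (X j) ^+ 2 * (2 * ch j).
    apply: (@le_trans _ _ ((expR (X j) * expR `|x j - X j|) ^+ 2)).
      by rewrite lerXn2r ?nnegrE ?mulr_ge0 ?expR_ge0.
    rewrite exprMn ler_wpM2l ?sqr_ge0// -expRM_natl.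
    exact: ech.
  have X2 j : expR (X j) ^+ 2 <= rho ^+ 2 by rewrite lerXn2r ?nnegrE ?expR_ge0.
  have sch1 : 1 <= \sum_j ch j.
    rewrite (bigD1 (Ordinal d0))//=; apply: (le_trans (ch1 (Ordinal d0))).
    by rewrite lerDl; apply: sumr_ge0 => j _; rewrite (le_trans ler01).
  have him : (\sum_j complex.Im (cexp (Complex (x j) (y j + pi / 2 * t ord0 j))) ^+ 2) / 2
      <= (delta ^+ 2 * rho ^+ 2 + 1) * \sum_j ch j.
    rewrite mulr_suml mulr_sumr; apply: ler_sum => j _ /=.
    have := ch1 j; have := sqr_ge0 (expR (x j)); have := sqr_ge0 delta.
    have := sqr_ge0 rho; rewrite exprMn.
    set sn := sin _ => r2 d2 ex2 c1.
    have dr : 0 <= delta ^+ 2 * rho ^+ 2 * ch j by rewrite !mulr_ge0// (le_trans ler01).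
    case: (ray j) => [xL|hs].
      have sn1 : sn ^+ 2 <= 1.
        by rewrite -[leLHS]real_normK ?num_real// expr_le1// sin_max.
      have h1 : expR (x j) ^+ 2 <= 2 * ch j.
        apply: (@le_trans _ _ (rho ^+ 2 * expR (2 * L))).
          apply: (@le_trans _ _ ((expR (X j) * expR `|x j - X j|) ^+ 2)).
            by rewrite lerXn2r ?nnegrE ?mulr_ge0 ?expR_ge0.
          by rewrite exprMn xL -(expRM_natl 2 L) ler_wpM2r ?expR_ge0.
        apply: (le_trans hL); rewrite -xL; apply: ech.
        by rewrite lexx ltW.
      have : expR (x j) ^+ 2 * sn ^+ 2 <= expR (x j) ^+ 2 * 1 by rewrite ler_wpM2l.
      by move: dr h1; clear; lra.
    have sn2 : sn ^+ 2 <= delta ^+ 2.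
      by rewrite -[leLHS]real_normK ?num_real// lerXn2r ?nnegrE.
    have h1 : expR (x j) ^+ 2 * sn ^+ 2 <= (rho ^+ 2 * (2 * ch j)) * delta ^+ 2.
      rewrite ler_pM ?sqr_ge0// (le_trans (x2 j))// ler_wpM2r// mulr_ge0//.
      exact: le_trans ler01 c1.
    by move: dr h1 c1; clear; lra.
  have hphi : phi (Num.sqrt (\sum_j complex.Re
        (cexp (Complex (x j) (y j + pi / 2 * t ord0 j))) ^+ 2))
      <= 2 * Cp * (phi rho + 1) * \sum_j ch j.
    pose l := Num.sqrt (\sum_j 2 * ch j).
    have sl0 : 0 <= \sum_j 2 * ch j.
      by apply: sumr_ge0 => j _; rewrite mulr_ge0// (le_trans ler01).
    have l2 : l ^+ 2 = 2 * \sum_j ch j by rewrite sqr_sqrtr// mulr_sumr.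
    have l1 : 1 <= l.
      rewrite -(@ler_pXn2r _ 2)// ?nnegrE ?sqrtr_ge0// expr1n l2.
      by move: sch1; clear; lra.
    have hle : Num.sqrt (\sum_j complex.Re
        (cexp (Complex (x j) (y j + pi / 2 * t ord0 j))) ^+ 2) <= l * rho.
      rewrite -(@ler_pXn2r _ 2)// ?nnegrE ?mulr_ge0 ?sqrtr_ge0//.
      rewrite sqr_sqrtr; last by apply: sumr_ge0 => j _; exact: sqr_ge0.
      rewrite exprMn l2 [leRHS]mulrC 2!mulr_sumr; apply: ler_sum => j _ /=.
      rewrite exprMn (@le_trans _ _ (expR (x j) ^+ 2))//.
        by rewrite ler_piMr ?sqr_ge0.
      by rewrite (le_trans (x2 j))// ler_wpM2r// mulr_ge0// (le_trans ler01).
    apply: (le_trans (phim _ _ (sqrtr_ge0 _) hle)).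
    apply: (le_trans (hCp _ _ l1 rho0)); rewrite l2.
    by rewrite le_eqVlt; apply/orP; left; apply/eqP; ring.
  rewrite [leRHS]mulrDl; apply: lerD => //.
  rewrite -[leRHS]mulrA ler_wpM2l ?mulr_ge0 ?(ltW rpos)//.
  by rewrite [leRHS]mulrDl mul1r lerD.
(* a truncation containing [a], for which the error [2 ^- N * D] is at most [1] *)
pose N := ((Num.trunc D).+1 + \sum_j a j)%N.
have aN j : (a j < (N.+1))%N.
  by rewrite ltnS /N (bigD1 j)//= addnCA leq_addr.
pose al : {ffun 'I_d -> 'I_N.+1} := [ffun j => Ordinal (aN j)].
have := mpol_coef_le (key N) al.
have amE : multi_index al = a by apply/ffunP => j; rewrite !ffunE.
rewrite /bargmann_coef amE Normc.normcM nc_real ger0_norm; last first.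
  by apply: prodr_ge0 => j _; rewrite invr_ge0 sqrtr_ge0.
rewrite -mulrA.
have -> : \prod_j (Num.sqrt (al j)`!%:R)^-1 = \prod_j (Num.sqrt (a j)`!%:R)^-1 :> R.
  by apply: eq_bigr => j _; rewrite ffunE.
have -> : \prod_j expR (X j) ^+ al j = \prod_j expR (X j) ^+ a j.
  by apply: eq_bigr => j _; rewrite ffunE.
move=> /le_trans; apply; rewrite -[leRHS]mulrA -expRD.
apply: ler_pM; rewrite ?expR_ge0 ?ler_expR//.
  by rewrite addr_ge0// mulr_ge0// invr_ge0 exprn_ge0.
rewrite lerD2l mulrC ler_pdivrMr ?exprn_gt0// mul1r.
rewrite (le_trans (ltW (truncnS_gt D)))// -natrX ler_nat.
by rewrite (leq_trans _ (ltnW (ltn_expl N (ltnSn 1))))// leq_addr.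
Qed.

End coefficient_bound.

(** * Synthesis: the sum of a Hermite series *)

Section synthesis.
Context {R : realType} {d : nat}.
Local Notation mu := (@lebesgue_rV R d).
Local Notation multi := {ffun 'I_d -> nat}.
Implicit Types (x : 'rV[R]_d) (a : multi).

Lemma sum_geometric_multi (s : seq multi) : uniq s ->
  \sum_(a <- s) (2^-1 : R) ^+ mlength a <= 2 ^+ d.
Proof.
move=> us; pose N := (\sum_(a <- s) mlength a)%N.
pose b (a : multi) : {ffun 'I_d -> 'I_N.+1} := [ffun j => inord (a j)].
have bK a : a \in s -> multi_index (b a) = a.
  move=> as_; apply/ffunP => j; rewrite !ffunE inordK// ltnS.
  by rewrite /N (bigD1_seq a)//= /mlength (bigD1 j)//= -addnA leq_addr.
have ub : uniq (map b s).
  rewrite map_inj_in_uniq// => a1 a2 s1 s2 /(congr1 (@multi_index d N.+1)).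
  by rewrite !bK.
have -> : \sum_(a <- s) (2^-1 : R) ^+ mlength a =
    \sum_(c <- map b s) (2^-1 : R) ^+ mlength (multi_index c).
  by rewrite big_map big_seq [RHS]big_seq; apply: eq_bigr => a /bK ->.
rewrite big_uniq//=.
apply: (@le_trans _ _ (\sum_(c : {ffun 'I_d -> 'I_N.+1}) (2^-1 : R) ^+ mlength (multi_index c))).
  rewrite [leRHS](bigID (mem (map b s)))/= lerDl.
  by apply: sumr_ge0 => c _; rewrite exprn_ge0.
under eq_bigr => c _.
  rewrite /mlength expr_sum.
  under eq_bigr do rewrite ffunE.
  over.
rewrite -(bigA_distr_bigA (fun (j : 'I_d) (n : 'I_N.+1) => (2^-1 : R) ^+ n)).
have -> : 2 ^+ d = \prod_(j < d) 2 :> R by rewrite prodr_const card_ord.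
apply: ler_prod => j _; rewrite sumr_ge0 => [/=|n _]; last by rewrite exprn_ge0.
have := subrX1 (2^-1 : R) N.+1; have : 0 <= (2^-1 : R) ^+ N.+1 by rewrite exprn_ge0.
lra.
Qed.

Lemma hfun_bounded n : exists2 C : R, 0 <= C & forall y, `|hfun n y| <= C.
Proof.
have [C C0 hC] := @horner_le R (herm n).
have p0 : 0 <= pi `^ (- 4^-1) * (hnorm n)^-1 :> R.
  by rewrite mulr_ge0 ?powR_ge0// invr_ge0 ltW// hnorm_gt0.
exists (pi `^ (- 4^-1) * (hnorm n)^-1 * C); first by rewrite mulr_ge0.
move=> y; rewrite /hfun -mulrA normrM (ger0_norm p0) ler_wpM2l// normrM.
rewrite (@ger0_norm _ (expR _)) ?expR_ge0//.
apply: (le_trans (ler_wpM2l (expR_ge0 _) (hC y))).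
by rewrite mulrCA -expRD addNr expR0 mulr1.
Qed.

Lemma hfun_orthonormal m n :
  lebesgue_measure.-integrable setT (EFin \o (fun y : R => hfun m y * hfun n y)) /\
  \int[@lebesgue_measure R]_y (hfun m y * hfun n y) = (m == n)%:R.
Proof.
pose c : R := pi `^ (- 4^-1) * (hnorm m)^-1 * (pi `^ (- 4^-1) * (hnorm n)^-1).
have E : (fun y : R => hfun m y * hfun n y) =
    (fun y => c * ((herm m * herm n).[y] * expR (- y ^+ 2))).
  apply/funext => y; rewrite /hfun /c hornerM.
  have -> : expR (- y ^+ 2) = expR (- (y ^+ 2 / 2)) * expR (- (y ^+ 2 / 2)).
    by rewrite -expRD; congr expR; field.
  by ring.
have i := @integrable_poly_gauss R (herm m * herm n).
rewrite E; split; first exact: (integrableZl measurableT c i).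
rewrite RintegralZl//.
have -> : \int[@lebesgue_measure R]_y ((herm m * herm n).[y] * expR (- y ^+ 2)) =
    (m == n)%:R * (2 ^+ n * n`!%:R * Num.sqrt pi).
  by rewrite -integral_herm_herm; apply: eq_Rintegral => y _; rewrite hornerM.
rewrite /c; have [->|mn] := eqVneq m n; last by rewrite mul0r mulr0.
have h0 := @hnorm_gt0 R n.
have hp : pi `^ (- 4^-1) * pi `^ (- 4^-1) * Num.sqrt pi = 1 :> R.
  rewrite -powRD; last by rewrite (gt_eqF (pi_gt0 R)) implybT.
  have -> : - 4^-1 - 4^-1 = - 2^-1 :> R by field.
  rewrite powRN powR12_sqrt ?pi_ge0// mulVf// gt_eqF// sqrtr_gt0 pi_gt0//.
rewrite -sqr_hnorm mul1r -[RHS]hp.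
by field; rewrite gt_eqF.
Qed.

Lemma hermite_orthonormal a b :
  mu.-integrable setT (EFin \o (fun x => hermite_fun a x * hermite_fun b x)) /\
  \int[mu]_x (hermite_fun a x * hermite_fun b x) = (a == b)%:R.
Proof.
have E : (fun x => hermite_fun a x * hermite_fun b x) =
    (fun x : 'rV[R]_d => \prod_j (hfun (a j) (x ord0 j) * hfun (b j) (x ord0 j))).
  by apply/funext => x; rewrite !hermite_funE -big_split.
have [i I] := @integral_rV_prod R d (fun j y => hfun (a j) y * hfun (b j) y)
  (fun j => (hfun_orthonormal (a j) (b j)).1).
rewrite E; split; first exact: i.
rewrite /Rintegral I/=.
under eq_bigr do rewrite (hfun_orthonormal _ _).2.
have [->|ab] := eqVneq a b; first by rewrite big1// => j _; rewrite eqxx.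
have [j abj] : exists j, a j != b j.
  apply/existsP; apply: contraR ab => /existsPn h.
  by apply/eqP/ffunP => j; apply/eqP; have := h j; rewrite negbK.
by rewrite (bigD1 j)//= (negbTE abj) mul0r.
Qed.

Lemma measurable_hermite_fun a : measurable_fun setT (hermite_fun (R := R) a).
Proof.
rewrite (_ : hermite_fun a = fun x : 'rV[R]_d => \prod_j hfun (a j) (x ord0 j)).
  apply: (measurable_rV_prod (f := fun j => hfun (a j))) => j; rewrite /hfun.
  apply: measurable_funM.
    apply: measurable_funM => //; apply: continuous_measurable_fun => y.
    apply: continuous_comp; last exact: continuous_expR.
    by apply: cvgN; apply: cvgMl; exact: exprn_continuous.
  by apply: continuous_measurable_fun => y; exact: continuous_horner.
by apply/funext => x; rewrite hermite_funE.
Qed.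

Local Notation cmulti := (multi : countType).

(** Families over the countable set of multi-indices are summed as series along
    the enumeration [pickle_inv], which takes the value [None] on the gaps. *)
Let term (F : multi -> R) n : R := oapp F 0 (pickle_inv n).

Let enum_multi M : seq multi := pmap (@pickle_inv cmulti) (iota 0 M).

Let series_enum (F : multi -> R) M :
  series (term F) M = \sum_(a <- enum_multi M) F a.
Proof.
rewrite /series/= /index_iota subn0 /enum_multi.
elim: (iota 0 M) => [|n s ih]; first by rewrite !big_nil.
rewrite big_cons ih /= {1}/term.
by case: (pickle_inv n) => [a|]/=; rewrite ?big_cons ?add0r.
Qed.

Let enum_multi_uniq M : uniq (enum_multi M).
Proof.
apply: (@pmap_uniq _ _ pickle_inv (@pickle cmulti)); first exact: pickle_invK.
exact: iota_uniq.
Qed.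

Let mem_enum_multi a M : (a \in enum_multi M) = (pickle (a : cmulti) < M)%N.
Proof.
rewrite /enum_multi mem_pmap; apply/mapP/idP => [[n]|aM].
  rewrite mem_iota add0n => nM E.
  by have := @pickle_invK cmulti n; rewrite -E /= => ->.
by exists (pickle (a : cmulti)); rewrite ?mem_iota// pickleK_inv.
Qed.

Let abs_cvg (F : multi -> R) B :
  (forall s, uniq s -> \sum_(a <- s) `|F a| <= B) -> cvgn (series (term F)).
Proof.
move=> hB; apply: normed_cvg; apply: nondecreasing_is_cvgn.
  by apply: nondecreasing_series => n _ _ /=; exact: normr_ge0.
exists B => _ [M _ <-]; apply: le_trans (hB _ (enum_multi_uniq M)).
rewrite -series_enum; apply: ler_sum => n _ /=; rewrite /term.
by case: (pickle_inv n) => //=; rewrite normr0.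
Qed.

(** If the terms of a Hermite series decay geometrically, locally uniformly in
    [x], its sum is a function with this Hermite series, by dominated
    convergence and orthonormality. *)
Lemma hermite_synthesis (phi : R -> R) (f : hermite_series R d) :
  subquadratic phi ->
  (forall e, 0 < e -> exists2 C, 0 <= C & forall x a,
     nc (f a) * `|hermite_fun a x| <=
     C * expR (- (sqnorm x / 2)) * expR (e * phi (enorm x)) * 2^-1 ^+ mlength a) ->
  exists2 g, given_by f g & forall e C, 0 <= C -> (forall x a,
     nc (f a) * `|hermite_fun a x| <=
     C * expR (- (sqnorm x / 2)) * expR (e * phi (enorm x)) * 2^-1 ^+ mlength a) ->
   forall x, nc (g x) <=
     2 ^+ d.+1 * C * expR (- (sqnorm x / 2)) * expR (e * phi (enorm x)).
Proof.
move=> phiq hf.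
pose w (C e : R) x : R := C * expR (- (sqnorm x / 2)) * expR (e * phi (enorm x)).
have w0 C e x : 0 <= C -> 0 <= w C e x by move=> C0; rewrite !mulr_ge0 ?expR_ge0.
(* the real and imaginary parts are treated alike, through [c] *)
pose part (c : multi -> R) := forall a, `|c a| <= nc (f a).
have partial_le c C e x s : part c -> 0 <= C -> (forall a,
    nc (f a) * `|hermite_fun a x| <= w C e x * 2^-1 ^+ mlength a) -> uniq s ->
    \sum_(a <- s) `|c a * hermite_fun a x| <= 2 ^+ d * w C e x.
  move=> pc C0 hC us.
  apply: (@le_trans _ _ (\sum_(a <- s) w C e x * 2^-1 ^+ mlength a)).
    apply: ler_sum => a _; apply: le_trans (hC a).
    by rewrite normrM ler_wpM2r.
  by rewrite -mulr_sumr mulrC ler_wpM2r ?w0// sum_geometric_multi.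
pose S c M x := series (term (fun a => c a * hermite_fun a x)) M.
have cvgS c x : part c -> cvgn (S c ^~ x).
  move=> pc; have [C C0 hC] := hf 1 ltr01.
  apply: (@abs_cvg _ (2 ^+ d * w C 1 x)) => s us.
  by apply: (partial_le c C 1 x s pc C0 _ us) => a; exact: hC.
have S_le c C e x M : part c -> 0 <= C -> (forall a,
    nc (f a) * `|hermite_fun a x| <= w C e x * 2^-1 ^+ mlength a) ->
    `|S c M x| <= 2 ^+ d * w C e x.
  move=> pc C0 hC; rewrite /S series_enum (le_trans (ler_norm_sum _ _ _))//.
  by apply: (partial_le c C e x) => //; exact: enum_multi_uniq.
pose lS c x := limn (S c ^~ x).
have lS_le c C e x : part c -> 0 <= C -> (forall a,
    nc (f a) * `|hermite_fun a x| <= w C e x * 2^-1 ^+ mlength a) ->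
    `|lS c x| <= 2 ^+ d * w C e x.
  move=> pc C0 hC; rewrite ler_norml; apply/andP; split.
    apply: limr_ge; first exact: cvgS.
    by apply: nearW => M; have := S_le c C e x M pc C0 hC; rewrite ler_norml => /andP[].
  apply: limr_le; first exact: cvgS.
  by apply: nearW => M; have := S_le c C e x M pc C0 hC; rewrite ler_norml => /andP[].
have mS c M : measurable_fun setT (S c M).
  rewrite (_ : S c M = fun x => \sum_(a <- enum_multi M) c a * hermite_fun a x); last first.
    by apply/funext => x; rewrite /S series_enum.
  apply: measurable_sum => a.
  by apply: measurable_funM => //; exact: measurable_hermite_fun.
have mlS c : part c -> measurable_fun setT (lS c).
  by move=> pc; apply: (measurable_fun_cvg (mS c)) => x _; exact: cvgS.
have [Kq Kq0 hKq] := subquadratic_split phiq.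
have lS_int c b : part c ->
    mu.-integrable setT (EFin \o (fun x => lS c x * hermite_fun b x)) /\
    \int[mu]_x (lS c x * hermite_fun b x) = c b.
  move=> pc.
  have e00 : 0 < (4 * (Kq + 1))^-1 by rewrite invr_gt0 mulr_gt0// ltr_wpDl.
  have [C C0 hC] := hf _ e00; set e := (4 * (Kq + 1))^-1 in e00 hC.
  have eK : e * Kq <= 4^-1.
    have : e * (4 * (Kq + 1)) = 1 by rewrite mulVf// gt_eqF// mulr_gt0// ltr_wpDl.
    lra.
  (* half of the Gaussian decay pays for the weight *)
  pose G x := \prod_j expR (- (x ord0 j - 0) ^+ 2 / 4).
  pose C' := 2 ^+ d * (C * expR (e * (Kq * (phi 0 + 1)))).
  have C'0 : 0 <= C' by rewrite !mulr_ge0 ?expR_ge0 ?exprn_ge0.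
  have wG x : 2 ^+ d * w C e x <= C' * G x.
    rewrite /C' /w -!mulrA ler_wpM2l ?exprn_ge0// ler_wpM2l//.
    rewrite /G -expR_sum -!expRD ler_expR.
    have sq0 : 0 <= sqnorm x by apply: sumr_ge0 => j _; exact: sqr_ge0.
    have := hKq 0 (enorm x) (enorm x) (lexx _) (sqrtr_ge0 _) (sqrtr_ge0 _).
    rewrite expr0n/= add0r ler_peMl ?sqr_ge0// => [/(_ isT)|]; last by lra.
    rewrite /enorm sqr_sqrtr// => /(ler_wpM2l (ltW e00)).
    have -> : \sum_j - (x ord0 j - 0) ^+ 2 / 4 = - (sqnorm x / 4).
      rewrite /sqnorm mulr_suml -sumrN.
      by apply: eq_bigr => j _; rewrite subr0 mulNr.
    have := ler_wpM2r sq0 eK; lra.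
  have [Cb Cb0 hb] := fin_all_exists2 (fun j => @hfun_bounded (b j)).
  pose CB := \prod_j Cb j.
  have hCB x : `|hermite_fun b x| <= CB.
    rewrite hermite_funE normr_prod; apply: ler_prod => j _.
    by rewrite normr_ge0 hb.
  have [iG _] : mu.-integrable setT (EFin \o G) /\ True.
    have c4 : 0 < 4 :> R by [].
    have [i _] := @integral_rV_prod R d (fun j y => expR (- (y - 0) ^+ 2 / 4))
      (fun j => (gauss_integrable 0 c4).1).
    by split; first exact: i.
  have f_le M x : `|S c M x * hermite_fun b x| <= C' * CB * G x.
    rewrite normrM mulrAC ler_pM//.
    by apply: le_trans (wG x); apply: S_le => // a; exact: hC.
  have mf M : measurable_fun setT (EFin \o (fun x => S c M x * hermite_fun b x)).
    apply/measurable_EFinP; apply: measurable_funM; first exact: mS.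
    exact: measurable_hermite_fun.
  have mlim : measurable_fun setT (EFin \o (fun x => lS c x * hermite_fun b x)).
    apply/measurable_EFinP; apply: measurable_funM; first exact: mlS.
    exact: measurable_hermite_fun.
  have [] := @dominated_convergence _ _ _ mu setT measurableT
    (fun M => EFin \o (fun x => S c M x * hermite_fun b x))
    (EFin \o (fun x => lS c x * hermite_fun b x))
    (EFin \o (fun x => C' * CB * G x)) mf mlim.
  - apply: aeW => x _; apply: cvg_EFin; first exact: nearW.
    by apply: cvgMl; exact: cvgS.
  - exact: (integrableZl measurableT (C' * CB) iG).
  - by apply: aeW => x M _ /=; rewrite lee_fin f_le.
  move=> iL _ limI; split; first exact: iL.
  have SE M : \int[mu]_x (S c M x * hermite_fun b x) =
      if b \in enum_multi M then c b else 0.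
    transitivity (\int[mu]_x \sum_(a <- enum_multi M)
        (c a * (hermite_fun a x * hermite_fun b x))).
      apply: eq_Rintegral => x _; rewrite /S series_enum mulr_suml.
      by apply: eq_bigr => a _; rewrite mulrA.
    have iab a : mu.-integrable setT
        (EFin \o (fun x => c a * (hermite_fun a x * hermite_fun b x))).
      exact: (integrableZl measurableT (c a) (hermite_orthonormal a b).1).
    rewrite (Rintegral_sum _ iab).2.
    under eq_bigr => a _.
      rewrite RintegralZl//; last exact: (hermite_orthonormal a b).1.
      rewrite (hermite_orthonormal a b).2.
      over.
    case: ifPn => bM.
      rewrite (bigD1_seq b)//= eqxx mulr1 big1 ?addr0// => a ab.
      by rewrite (negbTE ab) mulr0.
    rewrite big_seq big1// => a aM; rewrite (_ : a == b = false) ?mulr0//.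
    by apply: contraNF bM => /eqP <-.
  have lim2 : (\int[mu]_x (S c M x * hermite_fun b x)%:E)%E
      @[M --> \oo] --> (c b)%:E.
    apply: cvg_near_cst; exists (pickle (b : cmulti)).+1 => // M /= bM.
    have := SE M; rewrite mem_enum_multi bM => <-.
    rewrite /Rintegral fineK//; apply: (integrable_fin_num measurableT).
    apply: (le_integrable measurableT (mf M) _
      (integrableZl measurableT (C' * CB) iG)) => x _ /=.
    by rewrite lee_fin (le_trans (f_le M x))// ler_norm.
  by rewrite /Rintegral (cvg_unique _ limI lim2).
have pR : part (fun a => complex.Re (f a)) by move=> a; exact: Re_le_nc.
have pI : part (fun a => complex.Im (f a)) by move=> a; exact: Im_le_nc.
exists (fun x => Complex (lS (fun a => complex.Re (f a)) x)
  (lS (fun a => complex.Im (f a)) x)).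
  split=> [||a]; [exact: mlS|exact: mlS|] => /=.
  have [i1 I1] := lS_int _ a pR; have [i2 I2] := lS_int _ a pI.
  by split; [exact: i1|exact: i2|rewrite I1 I2; case: (f a)].
move=> e C C0 hC x.
apply: (le_trans (nc_le_ReIm _)) => /=.
apply: (le_trans (lerD (lS_le _ C e x pR C0 (hC x)) (lS_le _ C e x pI C0 (hC x)))).
by rewrite /w exprS le_eqVlt; apply/orP; left; apply/eqP; ring.
Qed.

End synthesis.

(** * The weights *)

Section weights.
Context {R : realType}.

Definition pow_weight (q x : R) : R := x `^ q.

Definition log_weight (p x : R) : R := ln (Num.sqrt (1 + x ^+ 2)) `^ p.

Lemma powR_add_le (p a b : R) : 0 <= p -> 0 <= a -> 0 <= b ->
  (a + b) `^ p <= 2 `^ p * (a `^ p + b `^ p).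
Proof.
move=> p0 a0 b0; have m0 : 0 <= Num.max a b by rewrite le_max a0.
apply: (@le_trans _ _ ((2 * Num.max a b) `^ p)).
  rewrite ge0_ler_powR ?nnegrE ?addr_ge0 ?mulr_ge0//.
  have : a <= Num.max a b by rewrite le_max lexx.
  have : b <= Num.max a b by rewrite le_max lexx orbT.
  lra.
rewrite powRM// ler_wpM2l ?powR_ge0//.
by have [_|_] := leP a b; rewrite ?lerDl ?lerDr powR_ge0.
Qed.

Lemma subquadratic_pow_weight q : 0 < q <= 2 -> subquadratic (pow_weight q).
Proof.
move=> /andP[q0 q2]; split=> [x _|x y x0 xy|]; first exact: powR_ge0.
  by rewrite ge0_ler_powR ?nnegrE ?(ltW q0) ?(le_trans x0).
exists 1 => // l x l1 x0; have l0 : 0 <= l by rewrite (le_trans ler01).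
rewrite mul1r /pow_weight powRM// ler_pM ?powR_ge0 ?lerDl//.
by rewrite -powR_mulrn// ler_powR.
Qed.

Lemma ln_bracket_ge0 (x : R) : 0 <= ln (Num.sqrt (1 + x ^+ 2)).
Proof.
by rewrite ln_ge0// -[leLHS]sqrtr1 ler_sqrt ?lerDl ?sqr_ge0// addr_ge0 ?sqr_ge0.
Qed.

Lemma ln_powR_le (p l : R) : 0 < p -> 1 <= l ->
  ln l `^ p <= (p / 2) `^ p * l ^+ 2.
Proof.
move=> p0 l1; have l0 : 0 < l by rewrite (lt_le_trans ltr01).
have pp : 0 < p / 2 by rewrite divr_gt0.
have h : ln l <= p / 2 * l `^ (2 / p).
  rewrite -ler_pdivrMl//.
  have -> : (p / 2)^-1 * ln l = ln (l `^ (2 / p)) by rewrite ln_powR invf_div.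
  rewrite (le_trans (ltW (ln_sublinear _)))// powR_gt0//.
have ->: l ^+ 2 = (l `^ (2 / p)) `^ p.
  by rewrite -powRrM divfK ?gt_eqF// powR_mulrn// ltW.
rewrite -powRM ?powR_ge0 ?(ltW pp)//.
have h0 : 0 <= p / 2 * l `^ (2 / p) by rewrite mulr_ge0 ?powR_ge0// ltW.
by rewrite ge0_ler_powR ?nnegrE ?ln_ge0// ltW.
Qed.

Lemma subquadratic_log_weight p : 0 < p -> subquadratic (log_weight p).
Proof.
move=> p0; split=> [x _|x y x0 xy|]; first exact: powR_ge0.
  rewrite ge0_ler_powR ?nnegrE ?ln_bracket_ge0 ?(ltW p0)//.
  have s0 (z : R) : 0 < 1 + z ^+ 2 by rewrite ltr_pwDl ?sqr_ge0.
  rewrite ler_ln ?posrE ?sqrtr_gt0// ler_sqrt// ?lerD2l//; last exact: ltW.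
  by rewrite lerXn2r ?nnegrE// (le_trans x0).
exists (2 `^ p * (1 + (p / 2) `^ p)); first by rewrite mulr_ge0 ?addr_ge0 ?powR_ge0.
move=> l x l1 x0; have l0 : 0 < l by rewrite (lt_le_trans ltr01).
have s0 (z : R) : 0 < 1 + z ^+ 2 by rewrite ltr_pwDl ?sqr_ge0.
have hl : ln (Num.sqrt (1 + (l * x) ^+ 2)) <= ln l + ln (Num.sqrt (1 + x ^+ 2)).
  rewrite -lnM ?posrE ?sqrtr_gt0// ler_ln ?posrE ?mulr_gt0 ?sqrtr_gt0//.
  have -> : l * Num.sqrt (1 + x ^+ 2) = Num.sqrt (l ^+ 2 * (1 + x ^+ 2)).
    by rewrite sqrtrM ?sqr_ge0// sqrtr_sqr gtr0_norm.
  rewrite ler_sqrt; last by rewrite mulr_ge0 ?sqr_ge0 ?(ltW (s0 _)).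
  by rewrite exprMn mulrDr mulr1 lerD2r exprn_ege1.
apply: (@le_trans _ _ ((ln l + ln (Num.sqrt (1 + x ^+ 2))) `^ p)).
  by rewrite /log_weight ge0_ler_powR ?nnegrE ?addr_ge0 ?ln_bracket_ge0 ?ln_ge0 ?(ltW p0).
apply: (le_trans (powR_add_le (ltW p0) (ln_ge0 l1) (ln_bracket_ge0 x))).
rewrite -!mulrA ler_wpM2l ?powR_ge0//.
have := ln_powR_le p0 l1; rewrite -/(log_weight p x).
have w0 : 0 <= log_weight p x by exact: powR_ge0.
have p20 : 0 <= (p / 2) `^ p by exact: powR_ge0.
have l2 : 1 <= l ^+ 2 by rewrite exprn_ege1.
have : 0 <= (p / 2) `^ p * l ^+ 2 * log_weight p x.
  by rewrite !mulr_ge0// (le_trans ler01).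
have : 0 <= (l ^+ 2 - 1) * log_weight p x by rewrite mulr_ge0// subr_ge0.
lra.
Qed.

Definition weight_exponent (s : Rflat R) : R -> R :=
  match s with
  | Rpos s => if s%:num < 2^-1 then log_weight (1 / (1 - 2 * s%:num))
              else pow_weight 2
  | Flat sigma => pow_weight (2 * sigma%:num / (sigma%:num + 1))
  end.

Lemma sqr_enorm d (x : 'rV[R]_d) : enorm x ^+ 2 = sqnorm x.
Proof. by rewrite sqr_sqrtr// sumr_ge0// => j _; exact: sqr_ge0. Qed.

Lemma weightE d r s (x : 'rV[R]_d) :
  weight r s x = expR (sqnorm x / 2) * expR (- (r * weight_exponent s (enorm x))).
Proof.
rewrite /weight sqr_enorm; congr (_ * _).
case: s => [s|sigma] //=; case: ifP => _.
  by rewrite /log_weight sqr_enorm.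
by rewrite /pow_weight powR_mulrn// sqrtr_ge0.
Qed.

(** The exponent of the logarithm in [omega] and that of [|a|] in [vartheta] are
    conjugate to each other. *)
Lemma log_exponents (sg : R) : 0 < sg < 2^-1 -> exists2 rho, 0 < rho &
  1 / (1 - 2 * sg) = 1 + rho^-1 /\ 1 / (2 * sg) = 1 + rho.
Proof.
move=> /andP[s0 s2]; have s20 : 0 < 1 - 2 * sg by lra.
exists ((1 - 2 * sg) / (2 * sg)); first by rewrite divr_gt0// mulr_gt0.
by rewrite invf_div; split; field; rewrite gt_eqF.
Qed.

Lemma flat_exponents (sg : R) : 0 < sg ->
  0 < 2 * sg / (sg + 1) <= 2 /\ (2 * sg / (sg + 1))^-1 - 2^-1 = 1 / (2 * sg).
Proof.
move=> s0; have s1 : 0 < sg + 1 by rewrite addr_gt0.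
split; last by rewrite invf_div; field; rewrite gt_eqF.
by rewrite divr_gt0 ?mulr_gt0//= ler_pdivrMr// ler_wpM2l// lerDl.
Qed.

Lemma subquadratic_weight_exponent s : subquadratic (weight_exponent s).
Proof.
case: s => [s|sigma] /=; last first.
  have s0 : 0 < sigma%:num by [].
  by apply: subquadratic_pow_weight; have [] := flat_exponents s0.
case: ifPn => s2; last by apply: subquadratic_pow_weight; rewrite ltr0n lexx.
apply: subquadratic_log_weight; rewrite divr_gt0// subr_gt0.
by rewrite mulrC -ltr_pdivlMr// mul1r.
Qed.

(** Strips of width at most [pi / 2 v] with [v < 1] need not be shrunk:
    [beta = 1 + 1 / v] is larger than [2], while [beta] times the half-width
    [pi / 4 v] is [(1 + v) pi / 4 < pi / 2]. *)
Lemma sector_gap_lt1 d (phi : R -> R) (u : 'rV[R]_d) :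
  (forall x, 0 <= x -> 0 <= phi x) -> (forall j, 0 < u ord0 j < 1) ->
  sector_gap phi u.
Proof.
move=> phi0 u01 e e0.
pose v := \big[Num.max/2^-1]_j u ord0 j.
have v1 : v < 1.
  rewrite /v; elim/big_ind : _ => [|x y x1 y1|j _]; first by rewrite invf_lt1// ltr1n.
    by rewrite gt_max x1.
  by case/andP: (u01 j).
have uv j : u ord0 j <= v by rewrite /v (bigD1 j)//= le_max lexx.
have v0 : 0 < v.
  rewrite /v; elim/big_ind : _ => [|x y x1 y1|j _]; first by rewrite invr_gt0.
    by rewrite lt_max x1.
  by case/andP: (u01 j).
have pi0 := pi_gt0 R.
exists 0, (1 + v^-1), (cos ((1 + v) * (pi / 4))).
have vv : v * v^-1 = 1 by rewrite divff// gt_eqF.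
have h1 : (1 + v) * (pi / 4) < pi / 2.
  have : v * (pi / 4) < 1 * (pi / 4) by rewrite ltr_pM2r// divr_gt0.
  lra.
have h0 : 0 < (1 + v) * (pi / 4) by rewrite mulr_gt0 ?addr_gt0 ?divr_gt0.
have k0 : 0 < cos ((1 + v) * (pi / 4)).
  apply: cos_gt0_pihalf; apply/andP; split => //; lra.
split=> //.
- by rewrite -[ltLHS]/(1 + 1) ltrD2l invf_gt1.
- move=> j y; rewrite mulr0 subr0 (_ : Num.max _ _ = pi / 2 * u ord0 j); last first.
    by apply/max_idPr; rewrite mulr_ge0 ?divr_ge0 ?(ltW pi0)//; case/andP: (u01 j) => /ltW.
  move=> hy; rewrite -[leRHS]cos_norm normrM.
  have b0 : 0 < 1 + v^-1 by rewrite addr_gt0// invr_gt0.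
  rewrite (gtr0_norm b0).
  have hb : (1 + v^-1) * `|y| <= (1 + v) * (pi / 4).
    have -> : (1 + v) * (pi / 4) = (1 + v^-1) * (v * (pi / 4)).
      by rewrite [RHS]mulrA [X in _ = X * _]mulrDl mul1r mulVf ?gt_eqF// [v + 1]addrC.
    rewrite ler_pM2l// (le_trans hy)//.
    have : pi * u ord0 j <= pi * v by rewrite ler_pM2l.
    lra.
  have [->//|ne] := eqVneq ((1 + v^-1) * `|y|) ((1 + v) * (pi / 4)).
  apply: ltW; rewrite ltr_cos ?in_itv/=; last 2 first.
  - by apply/andP; split; [rewrite mulr_ge0 ?(ltW b0)|lra].
  - by rewrite (ltW h0)/=; lra.
  by rewrite lt_neqAle ne.
- by move=> rho rho0; rewrite expr0n mul0r !mulr_ge0 ?phi0 ?(ltW e0) ?(ltW k0).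
Qed.

Lemma sin_ge_linear (x : R) : 0 <= x <= 1 -> x * cos 1 <= sin x.
Proof.
move=> /andP[x0 x1].
have [|c cx E] := @MVT_segment R sin cos 0 x x0 (fun z _ => is_derive_sin z).
  by apply: continuous_subspaceT; exact: continuous_sin.
rewrite sin0 !subr0 in E; rewrite E mulrC ler_wpM2r//.
move: cx; rewrite in_itv/= => /andP[c0 cx].
have [->//|ne] := eqVneq c 1.
have := pi_ge2 R => p2.
apply: ltW; rewrite ltr_cos ?in_itv/= ?c0 ?ler01/=; [|lra..].
by rewrite lt_neqAle ne (le_trans cx).
Qed.

(** Strips of width [pi / 2] are shrunk by [delta] on both sides, and [beta > 2] is
    chosen with [beta (pi / 4 - delta) = pi / 2 - delta]. The loss
    [delta^2 rho^2] has the order of the weight, but it is multiplied by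
    [1 / kappa] with [kappa = sin delta], which leaves a factor [O(delta)]. *)
Lemma sector_gap_half d (u : 'rV[R]_d) :
  (forall j, 0 < u ord0 j <= 1) -> sector_gap (pow_weight 2) u.
Proof.
move=> u01 e e0; have c1 : 0 < cos 1 :> R := cos1_gt0 R.
have p2 := pi_ge2 R.
pose de := Num.min (4^-1) (e * cos 1).
have de0 : 0 < de by rewrite lt_min invr_gt0 ltr0n mulr_gt0.
have de4 : de <= 4^-1 by rewrite ge_min lexx.
have dee : de <= e * cos 1 by rewrite ge_min lexx orbT.
have den : 0 < pi / 4 - de by lra.
exists de, ((pi / 2 - de) / (pi / 4 - de)), (sin de).
have s0 : 0 < sin de by apply: sin_gt0_pi; rewrite de0/=; lra.
split=> //; first exact: ltW.
- rewrite ltr_pdivlMr//; lra.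
- move=> j y hy.
  have hy' : `|y| <= pi / 4 - de.
    apply: (le_trans hy); rewrite ler_pdivrMr// ge_max; apply/andP; split.
      by rewrite mulr_ge0// ltW.
    have : pi / 2 * u ord0 j <= pi / 2 * 1.
      by rewrite ler_pM2l ?divr_gt0 ?pi_gt0//; case/andP: (u01 j).
    lra.
  rewrite -[leRHS]cos_norm normrM.
  have b0 : 0 < (pi / 2 - de) / (pi / 4 - de) by rewrite divr_gt0//; lra.
  rewrite (gtr0_norm b0).
  set beta := _ / _ in b0 *.
  have hb : beta * `|y| <= pi / 2 - de.
    by rewrite /beta mulrAC ler_pdivrMr// ler_pM2l//; lra.
  have -> : sin de = cos (pi / 2 - de).
    by rewrite -cosN opprB cosBpihalf.
  have [->//|ne] := eqVneq (beta * `|y|) (pi / 2 - de).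
  apply: ltW; rewrite ltr_cos ?in_itv/=; last 2 first.
  - by apply/andP; split; [rewrite mulr_ge0 ?(ltW b0)|lra].
  - by apply/andP; split; lra.
  by rewrite lt_neqAle ne.
- move=> rho rho0; rewrite /pow_weight powR_mulrn// ler_wpM2r ?sqr_ge0//.
  have hs : de * cos 1 <= sin de by apply: sin_ge_linear; rewrite (ltW de0)/=; lra.
  have := ler_wpM2l (ltW e0) hs; have := ler_wpM2l (ltW de0) dee.
  rewrite expr2; lra.
Qed.

End weights.

(** * Growth of the Hermite functions *)

Section hermite_growth.
Context {R : realType}.

Lemma norm_coord_le_enorm d (x : 'rV[R]_d) j : `|x ord0 j| <= enorm x.
Proof.
rewrite -sqrtr_sqr ler_wsqrtr// /sqnorm (bigD1 j)//= lerDl.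
by apply: sumr_ge0 => i _; exact: sqr_ge0.
Qed.

Lemma hfun_le n y : exists2 k, (k <= n)%N &
  `|hfun n y| <= expR (- (y ^+ 2 / 2)) * 2 ^+ n *
                 ((Num.sqrt 2 * `|y|) ^+ k / Num.sqrt (k`!%:R : R)).
Proof.
have [k kn hk] := herm_le n y; exists k => //.
have h0 := hnorm_gt0 (R := R) n.
rewrite /hfun !normrM (ger0_norm (powR_ge0 _ _)) (ger0_norm (expR_ge0 _)).
rewrite gtr0_norm ?invr_gt0//.
set M := (X in _ <= _ * _ * X) in hk *.
have -> : expR (- (y ^+ 2 / 2)) * 2 ^+ n * M =
    1 * (hnorm n)^-1 * expR (- (y ^+ 2 / 2)) * (hnorm n * 2 ^+ n * M).
  by field; rewrite gt_eqF.
rewrite ler_pM ?mulr_ge0 ?invr_ge0 ?powR_ge0 ?expR_ge0 ?(ltW h0)//.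
by rewrite !ler_wpM2r ?expR_ge0 ?invr_ge0 ?(ltW h0)// pi_powRN_le1.
Qed.

Lemma powRN_ge1 (eta p : R) : 0 < eta <= 1 -> 0 <= p -> 1 <= eta `^ (- p).
Proof.
move=> /andP[e0 e1] p0; rewrite powRN -[leLHS]invr1 lef_pV2 ?posrE ?powR_gt0//.
have -> : 1 = 1 `^ p :> R by rewrite powR1.
by rewrite ge0_ler_powR ?nnegrE ?(ltW e0).
Qed.

(** Raising the elementary bound [t^k <= k! eta^-k exp(eta t)] for [t = A^q] to
    the power [1/q] bounds [A^k] by a power of [k!], which exceeds the square root
    in the denominator by the exponent [1/q - 1/2 >= 0] only. *)
Lemma pow_term_le (q A eta : R) k n : 0 < q <= 2 -> 0 <= A -> 0 < eta <= 1 ->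
  (k <= n)%N ->
  A ^+ k / Num.sqrt (k`!%:R : R) <=
  n`!%:R `^ (q^-1 - 2^-1) * (eta `^ (- q^-1)) ^+ n * expR (q^-1 * (eta * A `^ q)).
Proof.
move=> /andP[q0 q2] A0 /andP[e0 e1] kn.
have qV : 0 < q^-1 by rewrite invr_gt0.
have qV2 : 0 <= q^-1 - 2^-1 by rewrite subr_ge0 lef_pV2 ?posrE.
have k0 : 0 < (k`!%:R : R) by rewrite ltr0n fact_gt0.
have h1 : A ^+ k <= k`!%:R `^ q^-1 * (eta `^ (- q^-1)) ^+ k * expR (q^-1 * (eta * A `^ q)).
  have -> : A ^+ k = ((A `^ q) ^+ k) `^ q^-1.
    rewrite -(powR_mulrn _ (powR_ge0 A q)) -!powRrM mulrA mulrAC divff ?gt_eqF// mul1r.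
    by rewrite powR_mulrn.
  have -> : (eta `^ (- q^-1)) ^+ k = (eta ^- k) `^ q^-1.
    by rewrite -powR_mulrn ?powR_ge0// -powRrM -powR_invn ?ltW// -powRrM mulNr mulrC mulNr.
  rewrite [q^-1 * _]mulrC expRM -!powRM ?expR_ge0 ?mulr_ge0 ?invr_ge0 ?exprn_ge0
    ?(ltW e0) ?(ltW k0)//.
  rewrite ge0_ler_powR ?nnegrE ?(ltW qV) ?exprn_ge0 ?powR_ge0 ?mulr_ge0 ?expR_ge0
    ?invr_ge0 ?(ltW e0) ?(ltW k0)//.
    by rewrite exprn_ge0// ltW.
  have := expr_div_fact_le k (mulr_ge0 (ltW e0) (powR_ge0 A q)).
  rewrite ler_pdivrMr// exprMn => h.
  have ek : 0 < eta ^+ k by rewrite exprn_gt0.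
  rewrite -(ler_pM2l ek) (le_trans h)//.
  by rewrite le_eqVlt; apply/orP; left; apply/eqP; field; rewrite gt_eqF.
rewrite ler_pdivrMr ?sqrtr_gt0//; apply: (le_trans h1).
have -> : k`!%:R `^ q^-1 = k`!%:R `^ (q^-1 - 2^-1) * Num.sqrt (k`!%:R : R).
  rewrite -powR12_sqrt ?(ltW k0)// -powRD ?subrK//.
  by apply/implyP => _; rewrite gt_eqF.
set S := Num.sqrt _; set X := expR _.
have -> : k`!%:R `^ (q^-1 - 2^-1) * S * (eta `^ (- q^-1)) ^+ k * X =
    k`!%:R `^ (q^-1 - 2^-1) * (eta `^ (- q^-1)) ^+ k * (X * S) by ring.
rewrite -[leRHS]mulrA ler_wpM2r ?mulr_ge0 ?expR_ge0 ?sqrtr_ge0//.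
have eV : 1 <= eta `^ (- q^-1) by apply: powRN_ge1; rewrite ?e0 ?(ltW qV).
rewrite ler_pM ?powR_ge0 ?exprn_ge0 ?powR_ge0//.
  rewrite ge0_ler_powR ?nnegrE ?ler0n// ler_nat.
  exact: leq_fact.
by rewrite ler_weXn2l.
Qed.

Lemma fact_mulr_gt0 d (a : {ffun 'I_d -> nat}) : 0 < (mfact a)%:R :> R.
Proof. by rewrite ltr0n /mfact prodn_gt0// => j; exact: fact_gt0. Qed.

Lemma prod_powR d (F : 'I_d -> R) (p : R) : (forall j, 0 <= F j) ->
  \prod_j (F j `^ p) = (\prod_j F j) `^ p.
Proof.
move=> F0; suff [] : \prod_j (F j `^ p) = (\prod_j F j) `^ p /\ 0 <= \prod_j F j by [].
elim/big_ind2 : _ => [|x1 x2 y1 y2 [-> x0] [-> y0]|j _]; rewrite ?powR1 ?ler01//.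
by rewrite powRM// mulr_ge0.
Qed.

Lemma hermite_fun_pow_le d (q e : R) : 0 < q <= 2 -> 0 < e ->
  exists2 K : R, 1 < K & forall (x : 'rV[R]_d) a,
  `|hermite_fun a x| <= expR (- (sqnorm x / 2)) * expR (e * pow_weight q (enorm x)) *
     (2^-1) ^+ mlength a * (K ^+ mlength a * (mfact a)%:R `^ (q^-1 - 2^-1)).
Proof.
move=> q02 e0; have /andP[q0 q2] := q02.
(* the coordinates contribute together at most [4 d eta / q] to the exponent *)
pose eta := Num.min 1 (e * q / (4 * d%:R + 1)).
have d1 : 0 < 4 * d%:R + 1 :> R by rewrite ltr_wpDl ?mulr_ge0.
have eta0 : 0 < eta by rewrite lt_min ltr01 divr_gt0 ?mulr_gt0.
have eta1 : eta <= 1 by rewrite ge_min lexx.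
have etae : eta * (4 * d%:R) <= e * q.
  have : eta * (4 * d%:R + 1) <= e * q by rewrite -ler_pdivlMr// ge_min lexx orbT.
  by rewrite mulrDr mulr1; lra.
have eV : 1 <= eta `^ (- q^-1).
  by apply: powRN_ge1; rewrite ?eta0 ?invr_ge0 ?(ltW q0).
exists (4 * eta `^ (- q^-1)); first by lra.
move=> x a; have n0 : 0 <= enorm x by exact: sqrtr_ge0.
rewrite hermite_funE normr_prod.
pose F j := expR (- (x ord0 j ^+ 2 / 2)) * 2 ^+ a j *
  ((a j)`!%:R `^ (q^-1 - 2^-1) * (eta `^ (- q^-1)) ^+ a j *
   expR (q^-1 * (eta * (4 * enorm x `^ q)))).
apply: (@le_trans _ _ (\prod_j F j)).
  apply: ler_prod => j _; rewrite normr_ge0/=.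
  have [k kn hk] := hfun_le (a j) (x ord0 j); apply: (le_trans hk).
  rewrite ler_wpM2l ?mulr_ge0 ?expR_ge0//.
  apply: (le_trans (@pow_term_le q _ eta k (a j) q02 _ _ kn)).
  - by rewrite mulr_ge0// sqrtr_ge0.
  - by rewrite eta0.
  rewrite ler_wpM2l ?mulr_ge0 ?powR_ge0 ?exprn_ge0 ?powR_ge0// ler_expR.
  rewrite ler_wpM2l ?invr_ge0 ?(ltW q0)// ler_wpM2l ?(ltW eta0)//.
  apply: (@le_trans _ _ ((2 * enorm x) `^ q)).
    rewrite ge0_ler_powR ?nnegrE ?(ltW q0) ?mulr_ge0 ?sqrtr_ge0//.
    rewrite ler_pM ?sqrtr_ge0 ?norm_coord_le_enorm//.
    by rewrite -[leRHS]ger0_norm// -sqrtr_sqr ler_wsqrtr// expr2 -natrM ler_nat.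
  rewrite powRM// ler_wpM2r ?powR_ge0//.
  have -> : 4 = 2 `^ 2 :> R by rewrite powR_mulrn// expr2 -natrM.
  by rewrite ler_powR// ler1n.
rewrite /F !big_split/= -!expR_sum -!expr_sum.
rewrite prod_powR => [|j]; last by rewrite ler0n.
rewrite -natr_prod -/(mfact a) -/(mlength a) sumr_const card_ord.
have -> : \sum_j - (x ord0 j ^+ 2 / 2) = - (sqnorm x / 2).
  by rewrite sumrN mulr_suml.
set E1 := expR (- _); set E2 := expR (_ *+ _); set N := mlength a.
set M := _ `^ (q^-1 - _); set Q := _ `^ (- _).
rewrite exprMn; have -> : (4 : R) ^+ N = 2 ^+ N * 2 ^+ N.
  by rewrite -exprMn -natrM.
have -> : E1 * 2 ^+ N * (M * Q ^+ N * E2) = E1 * E2 * (2 ^+ N * Q ^+ N * M) by ring.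
have -> : E1 * expR (e * pow_weight q (enorm x)) * 2^-1 ^+ N * (2 ^+ N * 2 ^+ N * Q ^+ N * M) =
  E1 * expR (e * pow_weight q (enorm x)) * (2^-1 ^+ N * 2 ^+ N) * (2 ^+ N * Q ^+ N * M) by ring.
rewrite -[_^-1 ^+ _ * _]exprMn mulVf// expr1n mulr1 ler_wpM2r ?mulr_ge0 ?exprn_ge0 ?powR_ge0//.
rewrite ler_wpM2l ?expR_ge0// ler_expR -[_ *+ d]mulr_natl /pow_weight.
have -> : d%:R * (q^-1 * (eta * (4 * enorm x `^ q))) =
  (eta * (4 * d%:R) / q) * enorm x `^ q by ring.
by rewrite ler_wpM2r ?powR_ge0// ler_pdivrMr.
Qed.

(** The two regimes [n <= e L^(1/rho)] and [n > e L^(1/rho)] are treated apart: in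
    each of them one of the two summands alone dominates. *)
Lemma mulr_le_powR (e L n rho : R) : 0 < e -> 0 <= L -> 0 <= n -> 0 < rho ->
  n * L <= e * L `^ (1 + rho^-1) + e `^ (- rho) * n `^ (1 + rho).
Proof.
move=> e0 L0 n0 r0; have rV : 0 < rho^-1 by rewrite invr_gt0.
have powS (x p : R) : 0 <= x -> 0 < p -> x `^ (1 + p) = x * x `^ p.
  move=> x0 p0; rewrite powRD ?powRr1// gt_eqF//=.
  by rewrite addr_gt0.
rewrite !powS//.
have [nL|nL] := leP n (e * L `^ rho^-1).
  apply: (@le_trans _ _ (e * (L * L `^ rho^-1))).
    by rewrite mulrCA mulrC ler_wpM2l.
  by rewrite lerDl !mulr_ge0 ?powR_ge0.
apply: (@le_trans _ _ (e `^ (- rho) * (n * n `^ rho))); last first.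
  by rewrite lerDr !mulr_ge0 ?powR_ge0 ?(ltW e0).
rewrite mulrCA ler_wpM2l//.
have -> : e `^ (- rho) = e^-1 `^ rho by rewrite -powR_inv1 ?(ltW e0)// -powRrM mulN1r.
rewrite -powRM ?invr_ge0 ?(ltW e0)//.
have -> : L = (L `^ rho^-1) `^ rho by rewrite -powRrM mulVf ?gt_eqF// powRr1.
rewrite ge0_ler_powR ?nnegrE ?powR_ge0 ?mulr_ge0 ?invr_ge0 ?(ltW e0) ?(ltW r0)//.
by rewrite ler_pdivlMl// ltW.
Qed.

(** For the logarithmic weights this crude bound is sharp enough, because their
    exponentials grow faster than any power. *)
Lemma hermite_fun_bracket_le d (x : 'rV[R]_d) (a : {ffun 'I_d -> nat}) :
  `|hermite_fun a x| <= expR (- (sqnorm x / 2)) *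
    (4 * Num.sqrt (1 + enorm x ^+ 2)) ^+ mlength a.
Proof.
pose B := Num.sqrt (1 + enorm x ^+ 2).
have B1 : 1 <= B by rewrite -[leLHS]sqrtr1 ler_wsqrtr// lerDl sqr_ge0.
have xB : enorm x <= B.
  by rewrite -[leLHS]ger0_norm ?sqrtr_ge0// -sqrtr_sqr ler_wsqrtr// lerDr.
rewrite hermite_funE normr_prod.
apply: (@le_trans _ _ (\prod_j (expR (- (x ord0 j ^+ 2 / 2)) * (4 * B) ^+ a j))).
  apply: ler_prod => j _; rewrite normr_ge0/=.
  have [k kn hk] := hfun_le (a j) (x ord0 j); apply: (le_trans hk).
  rewrite -[leLHS]mulrA ler_wpM2l ?expR_ge0//.
  have -> : 4 * B = 2 * (2 * B) by rewrite mulrA -natrM.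
  rewrite [leRHS]exprMn ler_wpM2l ?exprn_ge0//.
  apply: (@le_trans _ _ ((2 * B) ^+ k)); last by rewrite ler_weXn2l//; lra.
  rewrite ler_pdivrMr ?sqrtr_gt0 ?ltr0n ?fact_gt0//.
  apply: (@le_trans _ _ ((2 * B) ^+ k * 1)).
    rewrite mulr1 lerXn2r ?nnegrE ?mulr_ge0 ?sqrtr_ge0//.
    rewrite ler_pM ?sqrtr_ge0//; last exact: (le_trans (norm_coord_le_enorm _ _)).
    by rewrite -[leRHS]ger0_norm// -sqrtr_sqr ler_wsqrtr// expr2 -natrM ler_nat.
  rewrite ler_wpM2l ?exprn_ge0 ?mulr_ge0 ?sqrtr_ge0//.
  by rewrite -[leLHS]sqrtr1 ler_wsqrtr// ler1n fact_gt0.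
rewrite big_split/= -expR_sum -expr_sum -/(mlength a).
by rewrite sumrN mulr_suml.
Qed.

Lemma hermite_fun_log_le d (sg e : R) : 0 < sg < 2^-1 -> 0 < e ->
  exists2 r : R, 0 < r & forall (x : 'rV[R]_d) a,
  `|hermite_fun a x| <= expR (- (sqnorm x / 2)) *
     expR (e * log_weight (1 / (1 - 2 * sg)) (enorm x)) *
     (2^-1) ^+ mlength a * expR (r * (mlength a)%:R `^ (1 / (2 * sg))).
Proof.
move=> s02 e0; have [rho rho0 [-> ->]] := log_exponents s02.
have l8 : 0 < ln 8 :> R by rewrite ln_gt0// ltr1n.
exists (e `^ (- rho) + ln 8); first by rewrite ltr_wpDl ?powR_ge0.
move=> x a; apply: (le_trans (hermite_fun_bracket_le x a)).
rewrite -!mulrA ler_wpM2l ?expR_ge0//.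
set N := mlength a; set B := Num.sqrt _.
have B1 : 1 <= B by rewrite -[leLHS]sqrtr1 ler_wsqrtr// lerDl sqr_ge0.
have B0 : 0 < B by rewrite (lt_le_trans ltr01).
have -> : (4 * B) ^+ N = 2^-1 ^+ N * expR (N%:R * ln B + ln 8 * N%:R).
  rewrite expRD [ln 8 * _]mulrC !expRM_natl !lnK ?posrE// -!exprMn.
  by rewrite (_ : 4 * B = 2^-1 * (B * 8))//; lra.
rewrite mulrCA ler_wpM2l ?exprn_ge0// -expRD ler_expR mulrDl addrA lerD//.
  by rewrite /log_weight; apply: mulr_le_powR; rewrite ?ln_ge0.
rewrite ler_wpM2l ?(ltW l8)//.
have [->|N0] := posnP N; first by rewrite powR_ge0.
rewrite -{1}(powRr1 (ler0n R N)) ler_powR ?ler1n// lerDl ltW//.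
Qed.

(** The smaller the exponent [e] allowed in [x], the faster the coefficients have
    to decay for the Hermite series to converge geometrically. *)
Lemma hermite_fun_vartheta_le d (s : Rflat R) (e : R) :
  Rflat_le s (@Rflat_half R) -> 0 < e ->
  exists2 r : R, 0 < r & forall (x : 'rV[R]_d) a,
  `|hermite_fun a x| <= expR (- (sqnorm x / 2)) *
     expR (e * weight_exponent s (enorm x)) *
     (2^-1) ^+ mlength a * vartheta r s a.
Proof.
move=> sh e0.
case: s sh => [s [[s2]|/= s2]|sg _]/=.
- rewrite s2 /= ltxx.
  have [|K K1 hK] := @hermite_fun_pow_le d 2 e _ e0; first by rewrite ltr0n lexx.
  have K0 : 0 < K by rewrite (lt_trans ltr01).
  exists (ln K) => [|x a]; first by rewrite ln_gt0.
  have := hK x a; rewrite subrr powRr0 mulr1 divff// divr1 powRr1//.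
  by rewrite [ln K * _]mulrC expRM_natl lnK.
- by rewrite s2; apply: (@hermite_fun_log_le d _ e _ e0); rewrite s2 andbT.
- have sg0 : 0 < sg%:num by [].
  have [q02 qE] := flat_exponents sg0.
  have [K K1 hK] := @hermite_fun_pow_le d _ e q02 e0.
  exists K => [|x a]; first by rewrite (lt_trans ltr01).
  by have := hK x a; rewrite qE.
Qed.

End hermite_growth.

(** * Decay of the coefficients *)

Section coefficient_decay.
Context {R : realType}.

Lemma fact_le_exp n : (n`! <= (maxn n 1) ^ n)%N.
Proof.
elim: n => [//|[//|n] ih]; rewrite factS expnS (maxn_idPl _)// leq_mul2l/=.
by rewrite (leq_trans ih)// leq_exp2r// geq_max leqnSn.
Qed.

Section bound.
Context {d : nat} (phi : R -> R) (f : hermite_series R d).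
Hypothesis d0 : (0 < d)%N.
Hypothesis fphi : forall e : R, 0 < e -> exists2 C : R, 0 <= C &
  forall (X : 'I_d -> R) (a : {ffun 'I_d -> nat}),
  nc (f a) * (\prod_j (Num.sqrt ((a j)`!%:R : R))^-1 * \prod_j expR (X j) ^+ a j) <=
  C * expR (e * phi (Num.sqrt (\sum_j expR (X j) ^+ 2))).

Let dR : 0 < d%:R :> R. Proof. by rewrite ltr0n. Qed.

(** The bound is optimised at [exp X_j] proportional to [a_j^(1/q)], where
    [exp (X_j a_j)] recovers [(a_j!)^(1/q)]. *)
Lemma coef_decay_pow q : phi = pow_weight q -> 0 < q -> forall K : R, 0 < K ->
  exists C : R, forall a,
  nc (f a) * (K ^+ mlength a * (mfact a)%:R `^ (q^-1 - 2^-1)) <= C.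
Proof.
move=> phiE q0 K K0; have qV : 0 < q^-1 by rewrite invr_gt0.
(* the factor [expR 1] is spent on the bound [Sb] of the weight below *)
pose L := expR 1 * K; have L0 : 0 < L by rewrite mulr_gt0 ?expR_gt0.
pose b := L `^ (- q); have b0 : 0 < b by rewrite powR_gt0.
have dq0 : 0 < d%:R `^ q :> R by rewrite powR_gt0.
have [|C C0 hC] := fphi (e := b / d%:R `^ q); first by rewrite divr_gt0.
exists (C * expR d%:R) => a.
pose m j : R := (maxn (a j) 1)%:R; pose X j := ln (m j / b) / q.
have m0 j : 0 < m j by rewrite ltr0n leq_max orbT.
have XE j : expR (X j) = (m j / b) `^ q^-1.
  by rewrite expRM lnK// posrE divr_gt0.
have bV : b `^ (- q^-1) = L.
  by rewrite -powRrM mulrNN divff ?gt_eqF// powRr1// ltW.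
pose S := \sum_j m j / b.
have S0 : 0 <= S by apply: sumr_ge0 => j _; rewrite divr_ge0// ltW.
have XS : Num.sqrt (\sum_j expR (X j) ^+ 2) `^ q <= d%:R `^ q * S.
  have -> : d%:R `^ q * S = (d%:R * S `^ q^-1) `^ q.
    by rewrite powRM ?powR_ge0// -powRrM mulVf ?gt_eqF// powRr1.
  have dS : 0 <= d%:R * S `^ q^-1 by rewrite mulr_ge0 ?powR_ge0.
  rewrite ge0_ler_powR ?nnegrE ?(ltW q0) ?sqrtr_ge0//.
  rewrite -[leRHS]ger0_norm// -sqrtr_sqr ler_wsqrtr//.
  apply: (@le_trans _ _ (\sum_(j < d) (S `^ q^-1) ^+ 2)).
    apply: ler_sum => j _; rewrite lerXn2r ?nnegrE ?expR_ge0 ?powR_ge0// XE.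
    rewrite ge0_ler_powR ?nnegrE ?(ltW qV) ?divr_ge0 ?(ltW b0) ?(ltW (m0 _))//.
    rewrite /S (bigD1 j)//= lerDl; apply: sumr_ge0 => i _.
    by rewrite divr_ge0// ltW.
  rewrite sumr_const card_ord -[_ *+ d]mulr_natl exprMn ler_wpM2r ?sqr_ge0//.
  by rewrite expr2 -natrM ler_nat leq_pmulr.
have Sb : b / d%:R `^ q * (d%:R `^ q * S) <= (mlength a)%:R + d%:R.
  rewrite mulrA divfK ?gt_eqF// /S mulr_sumr.
  apply: (@le_trans _ _ (\sum_(j < d) ((a j)%:R + 1))).
    apply: ler_sum => j _; rewrite mulrC divfK ?gt_eqF// /m natr1 ler_nat.
    by rewrite geq_max leqnSn.
  by rewrite big_split/= -natr_sum sumr_const card_ord.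
have hX := hC X a; rewrite phiE /pow_weight in hX.
have {hX} hX := le_trans hX (ler_wpM2l C0 (_ : expR _ <= expR ((mlength a)%:R + d%:R))).
have f0 := nc_ge0 (f a).
have F0 : 0 < (mfact a)%:R :> R by exact: fact_mulr_gt0.
have low : (mfact a)%:R `^ (q^-1 - 2^-1) * L ^+ mlength a <=
    \prod_j (Num.sqrt ((a j)`!%:R : R))^-1 * \prod_j expR (X j) ^+ a j.
  have -> : \prod_j (Num.sqrt ((a j)`!%:R : R))^-1 = (mfact a)%:R `^ (- 2^-1).
    under eq_bigr do rewrite -powR12_sqrt// -powRN.
    by rewrite prod_powR// -natr_prod.
  rewrite addrC powRD; last by apply/implyP => _; rewrite gt_eqF.
  rewrite -mulrA ler_wpM2l ?powR_ge0//.
  have -> : L ^+ mlength a = \prod_j L ^+ a j by rewrite expr_sum.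
  have -> : (mfact a)%:R `^ q^-1 = \prod_j ((a j)`!%:R `^ q^-1) :> R.
    by rewrite prod_powR// -natr_prod.
  rewrite -big_split; apply: ler_prod => j _.
  rewrite mulr_ge0 ?powR_ge0 ?exprn_ge0 ?(ltW L0)//=.
  rewrite XE powRM ?(ltW (m0 _)) ?invr_ge0 ?(ltW b0)//.
  have -> : b^-1 `^ q^-1 = L.
    by rewrite -(powR_inv1 (ltW b0)) -powRrM mulN1r bV.
  rewrite [leRHS]exprMn ler_wpM2r ?exprn_ge0 ?(ltW L0)//.
  have -> : (m j `^ q^-1) ^+ a j = (m j ^+ a j) `^ q^-1.
    by rewrite -powR_mulrn ?powR_ge0// powRAC powR_mulrn ?(ltW (m0 _)).
  rewrite ge0_ler_powR ?nnegrE ?(ltW qV) ?exprn_ge0 ?(ltW (m0 _))//.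
  by rewrite -natrX ler_nat fact_le_exp.
have := le_trans (ler_wpM2l f0 low) (hX _); rewrite /L exprMn expRD -expRM_natl mulr1.
have E0 : 0 < expR (mlength a)%:R :> R by exact: expR_gt0.
move=> H; rewrite -(ler_pM2l E0).
have -> : expR (mlength a)%:R * (C * expR d%:R) = C * (expR (mlength a)%:R * expR d%:R) by ring.
apply: le_trans (H _); first by rewrite le_eqVlt; apply/orP; left; apply/eqP; ring.
rewrite -expRD ler_expR; apply: (le_trans _ Sb).
by rewrite ler_wpM2l// divr_ge0// ltW.
Qed.

(** Here the optimal choice is [X_j] of the order of [|a|^rho] for all [j]; the
    factorials are then of lower order than [exp (|a|^(1 + rho))]. *)
Lemma coef_decay_log rho : 0 < rho -> phi = log_weight (1 + rho^-1) ->
  forall r : R, 0 < r ->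
  exists C : R, forall a,
  nc (f a) * expR (r * (mlength a)%:R `^ (1 + rho)) <= C.
Proof.
move=> rho0 phiE r r0; have rhoV : 0 < rho^-1 by rewrite invr_gt0.
pose p := 1 + rho^-1; have p0 : 0 < p by rewrite addr_gt0.
pose B := r + 1 + rho^-1; have B0 : 0 < B by rewrite !addr_gt0.
(* [e] makes the weight at [expR X] cost at most [|a|^(1 + rho)] up to constants *)
pose e := (2 * B) `^ (- p); have e0 : 0 < e by rewrite powR_gt0// mulr_gt0.
have [C C0 hC] := fphi e0.
pose D := e * 2 `^ p * ln (1 + d%:R) `^ p.
exists (C * expR D) => a; set n := mlength a.
have powS (x : R) : 0 <= x -> x `^ (1 + rho) = x * x `^ rho.
  move=> x0; rewrite powRD ?powRr1// gt_eqF//=.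
  by rewrite addr_gt0.
pose X := B * n%:R `^ rho; have X0 : 0 <= X by rewrite mulr_ge0 ?powR_ge0// ltW.
have d1 : 1 <= 1 + d%:R :> R by rewrite lerDl ltW.
have up : e * phi (Num.sqrt (\sum_(j < d) expR X ^+ 2)) <= D + n%:R `^ (1 + rho).
  rewrite phiE /log_weight -/p sqr_sqrtr; last first.
    by apply: sumr_ge0 => j _; exact: sqr_ge0.
  set Y := 1 + _.
  have Y1 : 1 <= Y by rewrite lerDl; apply: sumr_ge0 => j _; exact: sqr_ge0.
  have h : ln (Num.sqrt Y) <= ln (1 + d%:R) + X.
    have d10 : 0 < 1 + d%:R :> R by rewrite (lt_le_trans ltr01).
    have Y0 : 0 < Y by rewrite (lt_le_trans ltr01).
    rewrite -[X in _ + X]expRK -lnM ?posrE ?expR_gt0//.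
    have P0 : 0 < (1 + d%:R) * expR X by rewrite mulr_gt0 ?expR_gt0.
    rewrite ler_ln ?posrE ?sqrtr_gt0//.
    rewrite -[leRHS]ger0_norm ?(ltW P0)// -sqrtr_sqr ler_wsqrtr//.
    rewrite /Y sumr_const card_ord -[_ *+ d]mulr_natl.
    have eX : 1 <= expR X ^+ 2.
      by rewrite exprn_ege1// -[leLHS]expR0 ler_expR.
    have h0 := ler_wpM2l (ltW dR) eX.
    have h1 := ler_wpM2l (mulr_ge0 (ltW dR) (ltW dR)) eX.
    have := mulr_ge0 (ltW dR) (ltW dR); have := dR.
    rewrite exprMn; move: (expR X ^+ 2) eX h0 h1 => z; rewrite expr2; lra.
  have lY : 0 <= ln (Num.sqrt Y).
    by rewrite ln_ge0// -[leLHS]sqrtr1 ler_wsqrtr.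
  apply: (@le_trans _ _ (e * (2 `^ p * (ln (1 + d%:R) `^ p + X `^ p)))).
    rewrite ler_wpM2l ?(ltW e0)//.
    apply: le_trans (powR_add_le (ltW p0) (ln_ge0 d1) X0).
    rewrite ge0_ler_powR ?nnegrE ?(ltW p0) ?lY ?h// addr_ge0//.
    exact: ln_ge0.
  rewrite mulrDr mulrDr mulrA lerD2l.
  have -> : X `^ p = B `^ p * n%:R `^ (1 + rho).
    rewrite /X powRM ?powR_ge0 ?(ltW B0)// -powRrM; congr (_ * _ `^ _).
    by rewrite mulrDr mulr1 mulfV ?gt_eqF// addrC.
  rewrite [leLHS](_ : _ = e * (2 `^ p * B `^ p) * n%:R `^ (1 + rho)); last by ring.
  have -> : e * (2 `^ p * B `^ p) = 1.
    by rewrite -powRM ?(ltW B0)// /e powRN mulVf// gt_eqF// powR_gt0// mulr_gt0.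
  by rewrite mul1r.
have fa : \prod_j Num.sqrt ((a j)`!%:R : R) <= expR (rho^-1 * n%:R `^ (1 + rho)).
  apply: (@le_trans _ _ (\prod_j ((maxn n 1)%:R ^+ a j))).
    apply: ler_prod => j _; rewrite sqrtr_ge0/=.
    apply: (@le_trans _ _ ((a j)`!%:R)).
      rewrite -[leRHS]ger0_norm// -sqrtr_sqr ler_wsqrtr// expr2 -natrM ler_nat.
      by rewrite leq_pmulr// fact_gt0.
    rewrite -natrX ler_nat (leq_trans (fact_le_exp _))//.
    have [->//|aj] := posnP (a j).
    rewrite leq_exp2r// geq_max leq_maxr andbT leq_max; apply/orP; left.
    by rewrite /n /mlength (bigD1 j)//= leq_addr.
  rewrite -expr_sum -/(mlength a) -/n.
  have [->|n0] := posnP n; first by rewrite expr0 -[leLHS]expR0 ler_expR mulr_ge0 ?powR_ge0 ?ltW.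
  have nR : 0 < n%:R :> R by rewrite ltr0n.
  rewrite (maxn_idPl _)// -[n%:R in leLHS]lnK ?posrE// -expRM_natl ler_expR.
  rewrite powS ?(ltW nR)// mulrCA ler_wpM2l//.
  rewrite -ler_pdivrMl ?invr_gt0// invrK -ln_powR.
  by rewrite (le_trans (ltW (ln_sublinear _)))// powR_gt0.
have := hC (fun=> X) a.
move: up; set E := expR (e * _); move=> up H.
have f0 := nc_ge0 (f a).
have P0 : 0 < \prod_j Num.sqrt ((a j)`!%:R : R).
  by apply: prodr_gt0 => j _; rewrite sqrtr_gt0 ltr0n fact_gt0.
have := ler_wpM2l (ltW P0) H.
have -> : \prod_(j < d) expR X ^+ a j = expR (B * n%:R `^ (1 + rho)).
  by rewrite -expr_sum -/(mlength a) -/n -expRM_natl powS// mulrCA.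
rewrite prodfV => {}H.
have {}H : nc (f a) * expR (B * n%:R `^ (1 + rho)) <=
    expR (rho^-1 * n%:R `^ (1 + rho)) * (C * expR (D + n%:R `^ (1 + rho))).
  have : nc (f a) * expR (B * n%:R `^ (1 + rho)) <=
    \prod_j Num.sqrt ((a j)`!%:R : R) * (C * E).
    apply: le_trans H; rewrite le_eqVlt; apply/orP; left; apply/eqP.
    by field; rewrite gt_eqF.
  move=> /le_trans; apply; rewrite ler_pM ?mulr_ge0 ?expR_ge0 ?(ltW P0)//.
  by rewrite ler_wpM2l// ler_expR.
pose Z := expR ((1 + rho^-1) * n%:R `^ (1 + rho)).
have Z0 : 0 < Z by exact: expR_gt0.
rewrite -(ler_pM2r Z0).
have -> : nc (f a) * expR (r * n%:R `^ (1 + rho)) * Z = nc (f a) * expR (B * n%:R `^ (1 + rho)).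
  by rewrite -mulrA -expRD; congr (_ * expR _); rewrite /B; ring.
apply: (le_trans H); rewrite le_eqVlt; apply/orP; left; apply/eqP.
rewrite /Z mulrDl mul1r !expRD; ring.
Qed.

End bound.

End coefficient_decay.

(** * Weighted suprema *)

Section weighted_supremum.
Context {R : realType} {d : nat}.
Local Notation mu := (@lebesgue_rV R d).

Lemma Loo_norm_le (f : hermite_series R d) (w : 'rV[R]_d -> R) g (B : R) :
  given_by f g -> 0 <= B -> (forall x, 0 <= w x) ->
  (forall x, nc (g x) * w x <= B) -> (Loo_norm f w <= B%:E)%E.
Proof.
move=> fg B0 w0 gB.
apply: (@le_trans _ _ (Lnorm mu +oo%E (fun x => (Normc.normc (g x) * w x)%:E))).
  by apply: ereal_inf_lbound; exists g.
rewrite unlock; case: ifPn => _; last by rewrite lee_fin.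
apply/ess_supP; apply: nearW => x /=.
by rewrite lee_fin ger0_norm ?gB// mulr_ge0// nc_ge0.
Qed.

Lemma Loo_norm_lt (f : hermite_series R d) (w : 'rV[R]_d -> R) (B : R) :
  (forall x, 0 <= w x) -> (Loo_norm f w < B%:E)%E ->
  exists2 g, given_by f g & \forall x \ae mu, nc (g x) * w x <= B.
Proof.
move=> w0 /ereal_inf_lt[_ [g fg <-]] h; exists g => //; move: h.
rewrite unlock; case: ifPn => [_ /ltW/ess_supP|mu0 _].
  apply: filterS => x /=; rewrite lee_fin ger0_norm//.
  by rewrite mulr_ge0// nc_ge0.
(* if [mu] vanished, the norm would be [0] by convention *)
exists setT; split => //.
by apply/eqP; rewrite eq_le measure_ge0 andbT leNgt.
Qed.

Lemma nc_frac_fourier (t : 'rV[R]_d) (f : hermite_series R d) a :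
  nc (frac_fourier t f a) = nc (f a).
Proof.
rewrite /frac_fourier Normc.normcM; set v := - _.
have -> : nc (expi v) = 1 by rewrite /= cos2Dsin2 sqrtr1.
by rewrite mul1r.
Qed.

Lemma weight_ge0 r s (x : 'rV[R]_d) : 0 <= weight r s x.
Proof. by rewrite weightE mulr_ge0 ?expR_ge0. Qed.

Lemma mulr_weight_le r s (x : 'rV[R]_d) (b B : R) :
  (b * weight r s x <= B) =
  (b <= B * expR (- (sqnorm x / 2)) * expR (r * weight_exponent s (enorm x))).
Proof.
rewrite weightE expRN -[X in expR (- X)]opprK !expRN invrK.
rewrite -ler_pdivlMr ?mulr_gt0 ?invr_gt0 ?expR_gt0//.
by rewrite invfM invrK mulrA.
Qed.

Lemma vartheta_ge0 (r : R) (s : Rflat R) (a : {ffun 'I_d -> nat}) : 0 <= r -> 0 <= vartheta r s a.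
Proof.
move=> r0; case: s => s /=; first exact: expR_ge0.
by rewrite mulr_ge0 ?powR_ge0 ?exprn_ge0.
Qed.

(** The synthesis only depends on the moduli of the coefficients, which
    [frac_fourier] preserves: this is why the bound is uniform in [t]. *)
Lemma pilipovic_Loo (s : Rflat R) (f : hermite_series R d) :
  Rflat_le s (@Rflat_half R) -> pilipovic s f -> forall r : R, 0 < r ->
  (ereal_sup [set Loo_norm (frac_fourier t f) (weight r s) | t in [set: 'rV[R]_d]]
   < +oo)%E.
Proof.
move=> sh fs.
have hf e : 0 < e -> exists2 C : R, 0 <= C & forall (x : 'rV[R]_d) a,
    nc (f a) * `|hermite_fun a x| <= C * expR (- (sqnorm x / 2)) *
      expR (e * weight_exponent s (enorm x)) * 2^-1 ^+ mlength a.
  move=> e0; have [r r0 hr] := @hermite_fun_vartheta_le R d s e sh e0.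
  have [C hC] := fs _ r0.
  have C0 : 0 <= C.
    apply: (@le_trans _ _ (nc (f [ffun=> 0%N]) * vartheta r s [ffun=> 0%N])).
      by apply: mulr_ge0; [exact: nc_ge0|apply: vartheta_ge0; exact: ltW].
    by apply: hC; exists [ffun=> 0%N].
  exists C => // x a; apply: (le_trans (ler_wpM2l (nc_ge0 _) (hr x a))).
  rewrite [leLHS](_ : _ = (nc (f a) * vartheta r s a) * (expR (- (sqnorm x / 2)) *
    expR (e * weight_exponent s (enorm x)) * 2^-1 ^+ mlength a)); last by ring.
  rewrite [leRHS](_ : _ = C * (expR (- (sqnorm x / 2)) *
    expR (e * weight_exponent s (enorm x)) * 2^-1 ^+ mlength a)); last by ring.
  rewrite ler_wpM2r ?mulr_ge0 ?expR_ge0 ?exprn_ge0//.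
  by apply: hC; exists a.
move=> r r0; have [C C0 hC] := hf _ r0.
apply: (@le_lt_trans _ _ ((2 ^+ d.+1 * C)%:E)); last exact: ltry.
apply: ge_ereal_sup => _ [t _ <-].
have [|g fg hg] := hermite_synthesis (subquadratic_weight_exponent s)
    (f := frac_fourier t f).
  move=> e e0; have [C' C'0 hC'] := hf _ e0; exists C' => // x a.
  by rewrite nc_frac_fourier.
apply: (Loo_norm_le fg); first by rewrite mulr_ge0 ?exprn_ge0.
  by move=> x; exact: weight_ge0.
move=> x; rewrite mulr_weight_le; apply: hg => // {}x a.
by rewrite nc_frac_fourier.
Qed.

Lemma sector_gap_weight_exponent (s : Rflat R) (u : 'rV[R]_d) :
  Rflat_le s (@Rflat_half R) ->
  (s = @Rflat_half R -> forall j, 0 < u ord0 j <= 1) ->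
  (Rflat_lt s (@Rflat_half R) -> forall j, 0 < u ord0 j < 1) ->
  (forall j, 0 < u ord0 j) /\ sector_gap (weight_exponent s) u.
Proof.
have [s0 _ _] := subquadratic_weight_exponent s.
case=> [sE /(_ sE) u1 _|sl _ /(_ sl) u1]; split=> [j|].
- by case/andP: (u1 j).
- by rewrite sE /= ltxx; exact: sector_gap_half.
- by case/andP: (u1 j).
- exact: sector_gap_lt1.
Qed.

(** The bounds for [t] in [Lambda] give [coef_bound], from which
    [coef_decay_pow] and [coef_decay_log] extract the decay of the coefficients by
    choosing the radii. *)
Lemma Loo_pilipovic (s : Rflat R) (t0 u : 'rV[R]_d) (f : hermite_series R d) :
  (0 < d)%N -> Rflat_le s (@Rflat_half R) ->
  (forall j, 0 < u ord0 j) -> sector_gap (weight_exponent s) u ->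
  (forall r : R, 0 < r ->
    (ereal_sup [set Loo_norm (frac_fourier t f) (weight r s) | t in Lambda t0 u]
     < +oo)%E) ->
  pilipovic s f.
Proof.
move=> d0 sh u0 gap hf.
have hB r : 0 < r -> exists2 B : R, 0 <= B & forall t, Lambda t0 u t ->
    exists2 g, given_by (frac_fourier t f) g &
    \forall y \ae mu, nc (g y) <= B * expR (- (sqnorm y / 2)) *
      expR (r * weight_exponent s (enorm y)).
  move=> r0; have := hf r r0; set M := ereal_sup _ => Moo.
  have [B B0 MB] : exists2 B : R, 0 <= B & (M < B%:E)%E.
    move: M Moo => [x _||_]; [|by rewrite ltxx|by exists 0 => //; exact: ltNyr].
    exists (Num.max 0 x + 1); first by rewrite addr_ge0// le_max lexx.
    by rewrite lte_fin (@le_lt_trans _ _ (Num.max 0 x)) ?ltrDl// le_max lexx orbT.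
  exists B => // t tL.
  have [|g fg hg] := @Loo_norm_lt (frac_fourier t f) (weight r s) B (weight_ge0 r s).
    by apply: le_lt_trans MB; apply: ereal_sup_ubound; exists t.
  by exists g => //; apply: filterS hg => x; rewrite mulr_weight_le.
have hC := coef_bound d0 (subquadratic_weight_exponent s) u0 gap hB.
move=> r r0 /=.
have ubP (F : {ffun 'I_d -> nat} -> R) : (exists C, forall a, F a <= C) ->
    has_ubound (range F).
  by move=> [C FC]; exists C => _ [a _ <-].
apply: ubP; clear hB hf gap.
case: s sh hC => [s [[sE]|/= s2]|sg _] /= hC.
- have := coef_decay_pow d0 hC (q := 2); rewrite sE/= ltxx => /(_ erefl).
  have K0 : 0 < expR r by exact: expR_gt0.
  move=> /(_ (ltr0n _ 2) _ K0)[C fC]; exists C => a; have := fC a.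
  by rewrite subrr powRr0 mulr1 divff// divr1 powRr1// [r * _]mulrC expRM_natl.
- have s0 : 0 < s%:num by [].
  have [|rho rho0 [E1 E2]] := @log_exponents R s%:num; first by rewrite s0 s2.
  have := coef_decay_log d0 hC rho0; rewrite s2 E1 => /(_ erefl _ r0)[C fC].
  by exists C => a; rewrite E2.
- have sg0 : 0 < sg%:num by [].
  have [/andP[q0 _] qE] := flat_exponents sg0.
  have [C fC] := coef_decay_pow d0 hC erefl q0 r0.
  by exists C => a; have := fC a; rewrite qE.
Qed.

End weighted_supremum.

Theorem theorem3p3 (R : realType) (d : nat) (s : Rflat R) (t0 u : 'rV[R]_d)
    (f : hermite_series R d) :
  (0 < d)%N ->
  Rflat_le s Rflat_half ->
  (s = Rflat_half -> forall j, 0 < u ord0 j <= 1) ->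
  (Rflat_lt s Rflat_half -> forall j, 0 < u ord0 j < 1) ->
  [<-> pilipovic s f;
       forall r : R, 0 < r ->
         (ereal_sup [set Loo_norm (frac_fourier t f) (weight r s)
                    | t in Lambda t0 u] < +oo)%E;
       forall r : R, 0 < r ->
         (ereal_sup [set Loo_norm (frac_fourier t f) (weight r s)
                    | t in [set: 'rV[R]_d]] < +oo)%E].
Proof.
move=> d0 sh u1 u2; have [u0 gap] := sector_gap_weight_exponent sh u1 u2.
have loo_le : (forall r : R, 0 < r ->
         (ereal_sup [set Loo_norm (frac_fourier t f) (weight r s)
                    | t in [set: 'rV[R]_d]] < +oo)%E) ->
       forall r : R, 0 < r ->
         (ereal_sup [set Loo_norm (frac_fourier t f) (weight r s)
                    | t in Lambda t0 u] < +oo)%E.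
  move=> h r r0; apply: le_lt_trans (h r r0); apply: ereal_sup_le => _ [t _ <-].
  by exists t.
tfae.
- by move=> fs; apply: loo_le; exact: pilipovic_Loo.
- by move=> h; apply: pilipovic_Loo => //; exact: (Loo_pilipovic d0 sh u0 gap h).
- by move=> /loo_le h; exact: (Loo_pilipovic d0 sh u0 gap h).
Qed.
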